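(* Let $0\le\epsilon<1/\sqrt2$ and $\epsilon'=\sqrt2\,\epsilon$. Let $U\subset\mathbb{R}^{2n}$ be open and let $\varphi\colon U\to\mathbb{R}^{2n}$ be an $\epsilon$-symplectic embedding. Then $\varphi$ preserves the capacity of ellipsoids up to $\epsilon'$ (for any normalized symplectic capacity $c$ on $\mathbb{R}^{2n}$).
   Context: $\mathbb{R}^{2n}$ carries the standard metric and the standard symplectic form $\omega_0=\sum_{j=1}^n dx_j\wedge dy_j$. For a two-form $\beta$, $\|\beta(x)\|_2$ is the Euclidean norm of the coefficient vector of $\beta(x)$ in the basis of wedge products (with increasing indices) of the standard orthonormal coframe, and $\|\beta\|_2=\sup_x\|\beta(x)\|_2$. A smooth embedding $\varphi\colon U\to\mathbb{R}^{2n}$ is $\epsilon$-symplectic if $\|\varphi^*\omega_0-\omega_0\|_2\le\epsilon$. A (normalized symplectic) capacity on $\mathbb{R}^{2n}$ assigns to each subset $U\subset\mathbb{R}^{2n}$ a number $c(U)\in[0,\infty]$ such that: (monotonicity) if there is a symplectic embedding $\psi\colon U\to\mathbb{R}^{2n}$ with $\psi(U)\subset V$, then $c(U)\le c(V)$ (for arbitrary $U$, $\psi$ is the restriction of a symplectic embedding of an open neighborhood of $U$); (conformality) $c(aU)=a^2c(U)$ for $a\neq0$; (normalization) $c(B_1^{2n})=\pi=c(Z_1^{2n})$, where $B_r^{2n}$ is the ball of radius $r$ centered at the origin and $Z_1^{2n}=B_1^2\times\mathbb{R}^{2n-2}$. For a non-singular $2n\times2n$ matrix $A$, $E(A)=AB_1^{2n}$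 (image of the closed unit ball). Given $0\le\epsilon<1$, put $\rho=\sqrt{1-\epsilon}$, let $r_A$ be the smallest number with $E(A)\subset B_{r_A}^{2n}$, $s_A=(1+\|A^{-1}\|(\rho^{-1}-1)r_A)^{-1}$, and, if $\|A^{-1}\|(\rho^{-1}-1)r_A<1$, $e_A=(1-\|A^{-1}\|(\rho^{-1}-1)r_A)^{-1}$; here $\|\cdot\|$ is the operator norm. An embedding $\varphi\colon U\to\mathbb{R}^{2n}$ preserves the capacity of ellipsoids up to $\epsilon$ (with respect to $c$) if $s_A^2\,c(E)\le c(\varphi(E))\le e_A^2\,c(E)$ for every ellipsoid $E\subset U$ that is a translate of some $E(A)$, $A$ non-singular, the second inequality being required whenever $e_A$ is defined. (In the proposition this is applied with $\epsilon'$ in place of $\epsilon$.) *)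

(* Defs.v *)
From HB Require Import structures.
From mathcomp Require Import all_boot all_order all_algebra.
From mathcomp Require Import all_classical all_reals all_analysis.
Set Implicit Arguments.
Unset Strict Implicit.
Unset Printing Implicit Defensive.
Import Order.TTheory GRing.Theory Num.Theory.
Import numFieldNormedType.Exports.
Local Open Scope classical_set_scope.
Local Open Scope ring_scope.

(** Points of R^{2n} are column vectors with coordinates ordered as
    (x_1, ..., x_n, y_1, ..., y_n).  The library norm [`|v|] on matrices is the
    maximum norm: it provides the topology and the derivative, while all metric
    quantities below use the Euclidean norm [enorm]. *)
Notation R2n R n := 'cV[R]_(n + n).

Section Euclidean.
Variables (R : realType) (n : nat).

Definition coord_x (j : 'I_n) (v : R2n R n) : R := v (lshift n j) ord0.
Definition coord_y (j : 'I_n) (v : R2n R n) : R := v (rshift n j) ord0.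

Definition enorm (v : R2n R n) : R := Num.sqrt (\sum_i v i ord0 ^+ 2).

Definition cball (r : R) : set (R2n R n) := [set v | enorm v <= r].

(** Z_1 = B_1^2 x R^{2n-2}; the index [j] with value 0 is the (x_1, y_1)-plane. *)
Definition cylinder1 : set (R2n R n) :=
  [set v | forall j : 'I_n, nat_of_ord j = 0%N ->
     coord_x j v ^+ 2 + coord_y j v ^+ 2 <= 1].

Definition opnorm (A : 'M[R]_(n + n)) : R :=
  sup [set enorm (A *m v) | v in cball 1].

End Euclidean.

Arguments cball {R} n r _.
Arguments cylinder1 R n _ : clear implicits.

Section Smooth.
Variables (R : realType) (V W : normedModType R).

(** C^k regularity on a set [U], meant for open [U]: for [V] finite-dimensional,
    [f] is C^{k+1} iff it is differentiable and all its directional derivatives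
    are C^k. *)
Fixpoint Ck_on (k : nat) (U : set V) (f : V -> W) : Prop :=
  match k with
  | 0 => {in U, continuous f}
  | k'.+1 => (forall x, U x -> differentiable f x) /\
             (forall v : V, Ck_on k' U ('D_v f))
  end.

Definition smooth_on (U : set V) (f : V -> W) : Prop := forall k, Ck_on k U f.

(** Injective immersion that is a homeomorphism onto its image.  Only the values
    of [f] on the open set [U] matter. *)
Definition smooth_embedding (U : set V) (f : V -> W) : Prop :=
  [/\ smooth_on U f,
      (forall x, U x -> injective ('d f x)) &
      exists g : W -> V,
        {in U, cancel f g} /\ {within f @` U, continuous g}].

End Smooth.

Section Symplectic.
Variables (R : realType) (n : nat).
Local Notation V := (R2n R n).

Definition two_form := V -> V -> V -> R.

Definition wedge (a b : V -> R) (u v : V) : R := a u * b v - a v * b u.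

Definition omega0 : two_form :=
  fun _ u v => \sum_(j < n) wedge (@coord_x R n j) (@coord_y R n j) u v.

Definition pullback (f : V -> V) (beta : two_form) : two_form :=
  fun x u v => beta (f x) ('d f x u) ('d f x v).

Definition basis_vec (i : 'I_(n + n)) : V := delta_mx i ord0.

(** The coefficient of an alternating form [b] on e_i^* /\ e_j^*, i < j, is
    [b e_i e_j]. *)
Definition coef_norm (b : V -> V -> R) : R :=
  Num.sqrt (\sum_(i < n + n) \sum_(j < n + n | (i < j)%N)
              b (basis_vec i) (basis_vec j) ^+ 2).

Definition form_norm (U : set V) (beta : two_form) : \bar R :=
  ereal_sup [set (coef_norm (beta x))%:E | x in U].

Definition epsilon_symplectic_embedding (eps : R) (U : set V) (f : V -> V) :=
  smooth_embedding U f /\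
  (form_norm U
     (fun x u v => pullback f omega0 x u v - omega0 x u v)%R <= eps%:E)%E.

Definition symplectic_embedding (U : set V) (f : V -> V) : Prop :=
  smooth_embedding U f /\
  forall x, U x -> forall u v, pullback f omega0 x u v = omega0 x u v.

Definition capacity (c : set V -> \bar R) : Prop :=
  [/\ (forall U, (0 <= c U)%E),
      (forall (U X W : set V) (psi : V -> V), open W -> U `<=` W ->
         symplectic_embedding W psi -> psi @` U `<=` X -> (c U <= c X)%E),
      (forall (a : R) (U : set V), a != 0 ->
         c [set a *: v | v in U] = ((a ^+ 2)%:E * c U)%E),
      c (cball n 1) = pi%:E &
      c (cylinder1 R n) = pi%:E].

Definition ellipsoid (A : 'M[R]_(n + n)) : set V :=
  [set A *m v | v in cball n 1].

Definition translate (b : V) (E : set V) : set V := [set b + v | v in E].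

(** The infimum is attained, so this is the smallest such radius. *)
Definition outer_radius (A : 'M[R]_(n + n)) : R :=
  inf [set r | ellipsoid A `<=` cball n r].

(** The quantity ||A^{-1}|| (rho^{-1} - 1) r_A, with rho = sqrt (1 - eps). *)
Definition distortion (eps : R) (A : 'M[R]_(n + n)) : R :=
  opnorm (invmx A) * ((Num.sqrt (1 - eps))^-1 - 1) * outer_radius A.

Definition inner_factor (eps : R) (A : 'M[R]_(n + n)) : R :=
  (1 + distortion eps A)^-1.

(** Meaningful when [distortion eps A < 1]. *)
Definition outer_factor (eps : R) (A : 'M[R]_(n + n)) : R :=
  (1 - distortion eps A)^-1.

Definition preserves_ellipsoid_capacity (c : set V -> \bar R) (eps : R)
    (U : set V) (f : V -> V) : Prop :=
  forall (A : 'M[R]_(n + n)) (b : V), A \in unitmx ->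
    let E := translate b (ellipsoid A) in
    E `<=` U ->
    ((inner_factor eps A ^+ 2)%:E * c E <= c (f @` E))%E /\
    (distortion eps A < 1 ->
       (c (f @` E) <= (outer_factor eps A ^+ 2)%:E * c E)%E).

End Symplectic.

(* Main.v *)
(** Moser's method with explicit constants.  After a translation the ellipsoid is
    [E = {gauge <= 1}], centred at 0.  Write [S = f^*omega0 - omega0] and
    [e = sqrt 2 * eps < 1]; comparing operator and Frobenius norms gives
    [|S(u, v)| <= e |u| |v|].  The Poincare primitive [lam] of [S] satisfies
    [|lam(y)| <= e/2 |y|], so the field [X_t] dual to [lam] under [omega0 + t S]
    satisfies [(1 - t e) |X_t(y)| <= e/2 |y|], and its time-one map [psi] pulls
    [f^*omega0] back to [omega0] as long as trajectories stay near [E].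
    Integrating the speed bound, a trajectory moves by at most
    [(1 - e)^(-1/2) - 1] times its norm, so the gauge changes by at most the
    distortion of [A].  Hence [f o psi] maps [s_A E] into [f(E)], and
    [psi^-1 o f^-1] maps [f(E)] into [e_A E], both symplectically.
    As [S] lives only near [E], it is cut off there; trajectories that could leave
    this region are controlled by using [N^*omega0 + t S] instead, where [N] is a
    norm-expanding map, the identity on the core and very large further out: the
    speed of [N(y(t))] obeys the same bound. *)
From HB Require Import structures.
Require Import Defs.
From mathcomp Require Import all_boot all_order all_algebra.
From mathcomp Require Import all_classical all_reals all_analysis.
From mathcomp Require Import ring lra.
Set Implicit Arguments.
Unset Strict Implicit.
Unset Printing Implicit Defensive.
Import Order.TTheory GRing.Theory Num.Theory.
Import numFieldNormedType.Exports.
Local Open Scope classical_set_scope.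
Local Open Scope ring_scope.

(** * C^k calculus *)

(* The factor rho^(-1) is the value at t = 1 of (1 - t e)^(-1/2), the solution of g' = (e/2) g / (1
   - t e) with g(0) = 1; the norm of A^(-1) and r_A then turn Euclidean displacement into gauge,
   which yields the distortion d. The two inequalities are not mirror images. In the inner one a
   trajectory starts at a known point and its norm grows at most like g. In the outer one only the
   end point is known, so the speed is bounded through the largest gauge sqrt b at which the cut off
   S still acts, and the displacement in gauge becomes sqrt b d. The strict inequality 1 + d < (1 -
   d)^(-1) for 0 < d < 1 leaves room for some b > 1. The obstacle is the layer where S is cut off:
   there it need not be closed and the pullback identity is lost. N throws this layer so far out
   that a backward trajectory, whose image under N moves a bounded amount, cannot reach it. The
   price is that its starting point may lie where N is not the identity, so psi pulls f^*omega0 back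
   to N^*omega0 only, and the symplectic map on f(E) is N o psi^-1 o f^-1. *)
#[local] Hint Extern 0 (open _) => exact: openT : core.

Section CkGeneral.
Variables (R : realType) (V W : normedModType R).
Implicit Types (U O : set V) (f g : V -> W) (k : nat).

Lemma open_near_eq U f g x : open U -> U x -> {in U, f =1 g} ->
  \forall y \near x, f y = g y.
Proof.
move=> oU Ux fg; have := open_nbhs_nbhs (conj oU Ux).
by apply: filterS => y Uy; apply: fg; rewrite inE.
Qed.

(** The estimate form of differentiability used throughout: a candidate differential is exhibited,
    and uniqueness of the little-o expansion identifies it with ['d f x]. *)
Lemma diff_criterion f (l : {linear V -> W}) (x : V) : continuous l ->
  (forall e : R, 0 < e ->
     \forall h \near (0 : V), `|f (h + x) - f x - l h| <= e * `|h|) ->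
  differentiable f x /\ 'd f x = l :> (V -> W).
Proof.
move=> cl fl.
have fE : f \o shift x = cst (f x) + l +o_ (0 : V) id.
  by apply/eqaddoP => e e0; apply: filterS (fl e e0) => h; rewrite !fctE/= opprD addrA.
have dl := diff_unique cl fE; split=> //.
by apply/diff_locallyP; rewrite dl.
Qed.

Lemma diff_near f (x : V) : differentiable f x -> forall e : R, 0 < e ->
  \forall h \near (0 : V), `|f (h + x) - f x - 'd f x h| <= e * `|h|.
Proof.
move=> /diff_locallyP[_ /eqaddoP dl] e /dl; apply: filterS => h.
by rewrite !fctE/= opprD addrA.
Qed.

Lemma near_eq_differentiable f g (x : V) : (\forall y \near x, f y = g y) ->
  differentiable f x -> differentiable g x.
Proof.
move=> fg df.
have dfc : continuous ('d f x) by exact: diff_continuous.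
apply: (proj1 (diff_criterion dfc _)) => e e0.
have fg0 : \forall h \near (0 : V), f (h + x) = g (h + x).
  by move: fg; rewrite (near_shift 0)/= subr0.
by apply: filterS2 fg0 (diff_near df e0) => h <-; rewrite (nbhs_singleton fg).
Qed.

(** Most closure rules below rest on this: a formula for the derivative that holds only on [U] may
    replace the derivative itself. Openness matters, because a derivative at a point depends on a
    neighbourhood. *)
Lemma Ck_eq k U f g : open U -> {in U, f =1 g} -> Ck_on k U f -> Ck_on k U g.
Proof.
move=> oU; elim: k f g => [|k IH] f g fg /=.
  move=> cf x; rewrite inE => Ux.
  have fgx := open_near_eq oU Ux fg.
  rewrite /continuous_at -(nbhs_singleton fgx).
  apply: cvg_trans (cf x _); last by rewrite inE.
  exact: near_eq_cvg.
move=> [df Df]; split=> [x Ux|v].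
  exact: near_eq_differentiable (open_near_eq oU Ux fg) (df x Ux).
apply: IH (Df v) => x; rewrite inE => Ux.
exact: near_eq_derive (open_near_eq oU Ux fg).
Qed.

Lemma CkW k U f : Ck_on k.+1 U f -> Ck_on k U f.
Proof.
elim: k f => [|k IH] f [df Df].
  move=> x; rewrite inE => Ux; exact: differentiable_continuous (df x Ux).
by split=> // v; apply: IH.
Qed.

Lemma Ck_le k l U f : (k <= l)%N -> Ck_on l U f -> Ck_on k U f.
Proof.
elim: l => [|l IH]; first by rewrite leqn0 => /eqP->.
by rewrite leq_eqVlt => /orP[/eqP->//|]; rewrite ltnS => kl /CkW; exact: IH.
Qed.

Lemma Ck_differentiable k U f x : Ck_on k.+1 U f -> U x -> differentiable f x.
Proof. by case=> df _; exact: df. Qed.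

Lemma Ck_sub k U O f : U `<=` O -> Ck_on k O f -> Ck_on k U f.
Proof.
move=> UO; elim: k f => [|k IH] f /=.
  by move=> cf x; rewrite inE => /UO Ux; apply: cf; rewrite inE.
by move=> [df Df]; split=> [x /UO /df//|v]; exact: IH.
Qed.

(** Continuity and differentiability are required at each point within the whole space, not relative
    to the set, so regularity glues over any two sets. *)
Lemma CkU k U O f : Ck_on k U f -> Ck_on k O f -> Ck_on k (U `|` O) f.
Proof.
elim: k f => [|k IH] f /=.
  by move=> cU cO x; rewrite inE => -[Ux|Ox]; [apply: cU|apply: cO]; rewrite inE.
move=> [dU DU] [dO DO]; split=> [x [Ux|Ox]|v]; [exact: dU|exact: dO|].
exact: IH.
Qed.

Lemma Ck_cst k U (a : W) : Ck_on k U (fun _ => a).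
Proof.
elim: k a => [|k IH] a; first by move=> x _; exact: cvg_cst.
split=> [x _|v]; first exact: differentiable_cst.
rewrite [X in Ck_on _ _ X](_ : _ = fun _ => 0) //.
by apply/funext => x; rewrite derive_cst.
Qed.

Lemma CkD k U f g : open U -> Ck_on k U f -> Ck_on k U g ->
  Ck_on k U (fun x => f x + g x).
Proof.
move=> oU; elim: k f g => [|k IH] f g /=.
  by move=> cf cg x Ux; apply: cvgD; [exact: cf|exact: cg].
move=> [df Df] [dg Dg]; split=> [x Ux|v].
  by apply: differentiableD; [exact: df|exact: dg].
apply: (@Ck_eq _ _ (fun x => 'D_v f x + 'D_v g x)) (IH _ _ (Df v) (Dg v)) => //.
move=> x; rewrite inE => Ux.
by rewrite deriveD//; apply: diff_derivable; [exact: df|exact: dg].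
Qed.

Lemma CkN k U f : open U -> Ck_on k U f -> Ck_on k U (fun x => - f x).
Proof.
move=> oU; elim: k f => [|k IH] f /=.
  by move=> cf x Ux; apply: cvgN; exact: cf.
move=> [df Df]; split=> [x Ux|v].
  by apply: differentiableN; exact: df.
apply: (@Ck_eq _ _ (fun x => - 'D_v f x)) (IH _ (Df v)) => //.
move=> x; rewrite inE => Ux.
by rewrite deriveN//; apply: diff_derivable; exact: df.
Qed.

Lemma CkB k U f g : open U -> Ck_on k U f -> Ck_on k U g ->
  Ck_on k U (fun x => f x - g x).
Proof. by move=> oU cf cg; apply: CkD => //; exact: CkN. Qed.

Lemma Ck_sum k U I (r : seq I) (P : pred I) (F : I -> V -> W) : open U ->
  (forall i, P i -> Ck_on k U (F i)) ->
  Ck_on k U (fun x => \sum_(i <- r | P i) F i x).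
Proof.
move=> oU cF; elim: r => [|i r IH].
  by rewrite (funext (fun x => big_nil _ _ P (F^~ x))); exact: Ck_cst.
rewrite (funext (fun x => big_cons _ _ i r P (F^~ x))).
by case Pi: (P i) => //; apply: CkD => //; exact: cF.
Qed.

Lemma Ck_linear k U (l : {linear V -> W}) : continuous l -> Ck_on k U l.
Proof.
case: k => [|k] cl; first by move=> x _; exact: cl.
split=> [x _|v]; first exact: linear_differentiable.
rewrite [X in Ck_on _ _ X](_ : _ = fun _ => l v); first exact: Ck_cst.
apply/funext => x; rewrite deriveE; last exact: linear_differentiable.
by rewrite diff_lin.
Qed.

End CkGeneral.

Lemma Ck_id (R : realType) (V : normedModType R) k (U : set V) : Ck_on k U (fun x : V => x).
Proof.
have -> : (fun x : V => x) = (idfun : {linear V -> V}) by [].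
by apply: Ck_linear => x; exact: cvg_id.
Qed.

Lemma differentiable_compE (R : realType) (V W X : normedModType R) (f : V -> W)
    (g : W -> X) x : differentiable f x -> differentiable g (f x) ->
  differentiable (fun y => g (f y)) x.
Proof. by move=> df dg; exact: (differentiable_comp df dg). Qed.

Lemma derive_comp (R : realType) (V W X : normedModType R) (f : V -> W)
    (g : W -> X) x v : differentiable f x -> differentiable g (f x) ->
  'D_v (fun y => g (f y)) x = 'd g (f x) ('D_v f x).
Proof.
move=> df dg; rewrite -[LHS]/('D_v (g \o f) x) deriveE; last exact: differentiable_compE.
by rewrite diff_comp//= [in RHS]deriveE.
Qed.

Section CkScalar.
Variables (R : realType) (V : normedModType R).
Implicit Types (U O : set V) (k : nat).

Lemma CkM k U (f g : V -> R) : open U -> Ck_on k U f -> Ck_on k U g ->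
  Ck_on k U (fun x => f x * g x).
Proof.
move=> oU; elim: k f g => [|k IH] f g.
  by move=> cf cg x Ux; apply: cvgM; [exact: cf|exact: cg].
move=> cf cg; have [df Df] := cf; have [dg Dg] := cg.
split=> [x Ux|v].
  by apply: differentiableM; [exact: df|exact: dg].
apply: (@Ck_eq _ _ _ _ _ (fun x => f x * 'D_v g x + g x * 'D_v f x)) => //.
  move=> x; rewrite inE => Ux.
  rewrite deriveM//; [exact: diff_derivable (df _ Ux)|exact: diff_derivable (dg _ Ux)].
by apply: CkD => //; apply: IH; [exact: CkW|exact: Dg|exact: CkW|exact: Df].
Qed.

Lemma Ck_prod k U I (r : seq I) (P : pred I) (F : I -> V -> R) : open U ->
  (forall i, P i -> Ck_on k U (F i)) ->
  Ck_on k U (fun x => \prod_(i <- r | P i) F i x).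
Proof.
move=> oU cF; elim: r => [|i r IH].
  by rewrite (funext (fun x => big_nil _ _ P (F^~ x))); exact: Ck_cst.
rewrite (funext (fun x => big_cons _ _ i r P (F^~ x))).
by case Pi: (P i) => //; apply: CkM => //; exact: cF.
Qed.

Lemma Ck_exp k U (f : V -> R) n : open U -> Ck_on k U f ->
  Ck_on k U (fun x => f x ^+ n).
Proof.
move=> oU cf; elim: n => [|n IH]; first exact: Ck_cst.
by rewrite (funext (fun x => exprS (f x) n)); exact: CkM.
Qed.

Lemma CkV k U (f : V -> R) : open U -> (forall x, U x -> f x != 0) ->
  Ck_on k U f -> Ck_on k U (fun x => (f x)^-1).
Proof.
move=> oU f0; elim: k => [|k IH].
  by move=> cf x; rewrite inE => Ux; apply: cvgV; [exact: f0|apply: cf; rewrite inE].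
move=> cf; have [df Df] := cf.
split=> [x Ux|v].
  by apply: differentiableV; [exact: df|exact: f0].
apply: (@Ck_eq _ _ _ _ _ (fun x => - ((f x)^-1 * (f x)^-1 * 'D_v f x))) => //.
  move=> x; rewrite inE => Ux.
  rewrite deriveV//; [|exact: f0|apply: diff_derivable; exact: df].
  by rewrite /GRing.scale/= mulNr -exprVn expr2.
by apply: CkN => //; apply: CkM; [by []|apply: CkM => //; apply: IH; exact: CkW|exact: Df].
Qed.

(** The induction generalises [g] alone: the chain rule produces ['D_1 g] composed with the same
    [f], of which only a lower regularity is then needed. *)
Lemma Ck_comp1 k U (O : set R) (f : V -> R) (g : R -> R) :
  open U -> open O -> f @` U `<=` O ->
  Ck_on k O g -> Ck_on k U f -> Ck_on k U (fun x => g (f x)).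
Proof.
move=> oU oO fUO; elim: k g => [|k IH] g.
  move=> cg cf x; rewrite inE => Ux; apply: continuous_comp.
    by apply: cf; rewrite inE.
  by apply: cg; rewrite inE; apply: fUO; exists x.
move=> cg cf; have [df Df] := cf; have [dg Dg] := cg.
split=> [x Ux|v].
  by apply: differentiable_compE; [exact: df|apply: dg; apply: fUO; exists x].
apply: (@Ck_eq _ _ _ _ _ (fun x => 'D_v f x * 'D_1 g (f x))) => //.
  move=> x; rewrite inE => Ux.
  have dgx : differentiable g (f x) by apply: dg; apply: fUO; exists x.
  have -> : 'D_1 g (f x) = 'd g (f x) 1 by rewrite deriveE.
  rewrite (derive_comp _ (df x Ux) dgx).
  rewrite -[LHS]/('D_v f x *: 'd g (f x) 1) -linearZ.
  by congr ('d g _ _); rewrite /GRing.scale/= mulr1.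
by apply: CkM => //; [exact: Df|apply: (IH ('D_1 g)); [exact: Dg|exact: CkW]].
Qed.

End CkScalar.

(** * Matrix-valued maps *)

Section CkMatrix.
Variables (R : realType) (V : normedModType R).
Implicit Types (U O : set V) (k : nat).

Lemma entry_continuous p q (i : 'I_p) (j : 'I_q) :
  continuous (fun M : 'M[R]_(p, q) => M i j).
Proof. exact: coord_continuous. Qed.

Lemma mx_norm_le p q (M : 'M[R]_(p, q)) (e : R) : 0 <= e ->
  (forall i j, `|M i j| <= e) -> `|M| <= e.
Proof.
move=> e0 Me; rewrite /Num.Def.normr/= mx_normrE.
by apply: bigmax_le => //= -[i j] _; exact: Me.
Qed.

Lemma mx_norm_ge p q (M : 'M[R]_(p, q)) i j : `|M i j| <= `|M|.
Proof.
rewrite [leRHS]/Num.Def.normr/= mx_normrE.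
exact: (le_bigmax _ (fun ij => `|M ij.1 ij.2|) (i, j)).
Qed.

Lemma continuous_mxP p q (f : V -> 'M[R]_(p, q)) x :
  {for x, continuous f} <-> forall i j, {for x, continuous (fun y => f y i j)}.
Proof.
split=> [cf i j|cf].
  by apply: (@continuous_comp _ _ _ f (fun M => M i j)) => //; exact: entry_continuous.
apply/cvgrPdist_le => /= e e0.
have : \forall y \near x, forall ij : 'I_p * 'I_q, `|f x ij.1 ij.2 - f y ij.1 ij.2| <= e.
  apply: filter_forall => -[i j]/=.
  by have /cvgrPdist_le := cf i j; apply.
apply: filterS => y fy; apply: mx_norm_le; first exact: ltW.
by move=> i j; rewrite !mxE; exact: fy (i, j).
Qed.

Lemma differentiable_mxP p q (f : V -> 'M[R]_(p, q)) x :
  differentiable f x <-> forall i j, differentiable (fun y => f y i j) x.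
Proof.
split=> [df i j|df].
  exact: (differentiable_comp df (differentiable_coord _ _ _)).
pose l0 h := \matrix_(i, j) 'd (fun y => f y i j) x h.
have ll : linear l0.
  by move=> a u v; apply/matrixP => i j; rewrite !mxE linearP.
pose lM := GRing.isLinear.Build _ _ _ _ _ ll.
pose l : {linear V -> 'M[R]_(p, q)} := HB.pack l0 lM.
apply: (proj1 (@diff_criterion _ _ _ f l x _ _)).
  move=> y; apply/continuous_mxP => i j.
  have E : (fun y => l y i j) = 'd (fun y => f y i j) x :> (V -> R).
    by apply/funext => h; rewrite mxE.
  by rewrite E; exact: (diff_continuous (df i j)).
move=> e e0.
have : \forall h \near (0 : V), forall ij : 'I_p * 'I_q,
  `|f (h + x) ij.1 ij.2 - f x ij.1 ij.2 - 'd (fun y => f y ij.1 ij.2) x h| <= e * `|h|.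
  by apply: filter_forall => -[i j]/=; exact: (diff_near (df i j) e0).
apply: filterS => h Hh; apply: mx_norm_le; first by rewrite mulr_ge0// ltW.
by move=> i j; rewrite !mxE; exact: Hh (i, j).
Qed.

Lemma derive_entry p q (f : V -> 'M[R]_(p, q)) x v i j : derivable f x v ->
  ('D_v f x) i j = 'D_v (fun y => f y i j) x.
Proof. by move=> /derive_mx ->; rewrite mxE. Qed.

Lemma Ck_mxP k U p q (f : V -> 'M[R]_(p, q)) : open U ->
  Ck_on k U f <-> forall i j, Ck_on k U (fun y => f y i j).
Proof.
move=> oU; elim: k f => [|k IH] f.
  split=> [cf i j x Ux|cf x Ux].
    by have /(continuous_mxP f) := cf x Ux; apply.
  by apply/continuous_mxP => i j; exact: cf.
split=> [[df Df] i j|cf].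
  split=> [x Ux|v]; first by have /differentiable_mxP := df x Ux; apply.
  apply: (@Ck_eq _ _ _ _ _ (fun y => ('D_v f y) i j)) => //.
    by move=> x; rewrite inE => Ux; rewrite derive_entry//; apply: diff_derivable; exact: df.
  by have /IH := Df v; apply.
have df x : U x -> differentiable f x.
  by move=> Ux; apply/differentiable_mxP => i j; have [+ _] := cf i j; apply.
split=> // v; apply/IH => i j.
apply: (@Ck_eq _ _ _ _ _ ('D_v (fun y => f y i j))) => //.
  by move=> x; rewrite inE => Ux; rewrite derive_entry//; apply: diff_derivable; exact: df.
by have [_] := cf i j; apply.
Qed.

Lemma Ck_entry k U p q (f : V -> 'M[R]_(p, q)) i j : open U -> Ck_on k U f ->
  Ck_on k U (fun y => f y i j).
Proof. by move=> oU /(Ck_mxP k f oU). Qed.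

Lemma Ck_mx k U p q (F : 'I_p -> 'I_q -> V -> R) : open U ->
  (forall i j, Ck_on k U (F i j)) ->
  Ck_on k U (fun x => \matrix_(i, j) F i j x).
Proof.
move=> oU cF; apply/Ck_mxP => // i j.
by rewrite (_ : (fun y => _) = F i j)//; apply/funext => y; rewrite mxE.
Qed.

Lemma Ck_mulmx k U p q r (f : V -> 'M[R]_(p, q)) (g : V -> 'M[R]_(q, r)) :
  open U -> Ck_on k U f -> Ck_on k U g -> Ck_on k U (fun x => f x *m g x).
Proof.
move=> oU cf cg; apply/Ck_mxP => // i j.
rewrite (_ : (fun y => _) = fun y => \sum_l f y i l * g y l j).
  by apply: Ck_sum => // l _; apply: CkM => //; exact: Ck_entry.
by apply/funext => y; rewrite mxE.
Qed.

Lemma Ck_mulmxl k U p q r (B : 'M[R]_(p, q)) (g : V -> 'M[R]_(q, r)) :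
  open U -> Ck_on k U g -> Ck_on k U (fun x => B *m g x).
Proof. by move=> oU; apply: Ck_mulmx => //; exact: Ck_cst. Qed.

Lemma Ck_tr k U p q (f : V -> 'M[R]_(p, q)) : open U -> Ck_on k U f ->
  Ck_on k U (fun x => (f x)^T).
Proof.
move=> oU cf; apply/Ck_mxP => // i j.
rewrite (_ : (fun y => _) = fun y => f y j i); first exact: Ck_entry.
by apply/funext => y; rewrite mxE.
Qed.

Lemma CkZ k U p q (a : V -> R) (f : V -> 'M[R]_(p, q)) : open U ->
  Ck_on k U a -> Ck_on k U f -> Ck_on k U (fun x => a x *: f x).
Proof.
move=> oU ca cf; apply/Ck_mxP => // i j.
rewrite (_ : (fun y => _) = fun y => a y * f y i j).
  by apply: CkM => //; exact: Ck_entry.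
by apply/funext => y; rewrite mxE.
Qed.

Lemma Ck_det k U p (f : V -> 'M[R]_p) : open U -> Ck_on k U f ->
  Ck_on k U (fun x => \det (f x)).
Proof.
move=> oU cf; rewrite /determinant; apply: Ck_sum => // s _.
apply: CkM => //; first exact: Ck_cst.
by apply: Ck_prod => // i _; exact: Ck_entry.
Qed.

Lemma Ck_invmx k U p (f : V -> 'M[R]_p) : open U ->
  (forall x, U x -> f x \in unitmx) -> Ck_on k U f ->
  Ck_on k U (fun x => invmx (f x)).
Proof.
move=> oU uf cf.
apply: (@Ck_eq _ _ _ _ _ (fun x => (\det (f x))^-1 *: \adj (f x))) => //.
  by move=> x; rewrite inE => Ux; rewrite /invmx uf.
apply: CkZ => //.
  apply: CkV => // [x Ux|]; last exact: Ck_det.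
  by have := uf x Ux; rewrite unitmxE unitfE.
apply/Ck_mxP => // i j.
rewrite (_ : (fun y => _) = fun y => (-1) ^+ (j + i) * \det (row' j (col' i (f y)))).
  apply: CkM => //; first exact: Ck_cst.
  apply: Ck_det => //; apply/Ck_mxP => // a b.
  rewrite (_ : (fun y => _) = fun y => f y (lift j a) (lift i b)); first exact: Ck_entry.
  by apply/funext => y; rewrite !mxE.
by apply/funext => y; rewrite mxE.
Qed.

Lemma Ck_col_mx k U p1 p2 q (f : V -> 'M[R]_(p1, q)) (g : V -> 'M[R]_(p2, q)) :
  open U -> Ck_on k U f -> Ck_on k U g -> Ck_on k U (fun x => col_mx (f x) (g x)).
Proof.
move=> oU cf cg; apply/Ck_mxP => // i j.
case: (split_ordP i) => l ->.
  by rewrite (funext (fun x => col_mxEu (f x) (g x) l j)); exact: Ck_entry.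
by rewrite (funext (fun x => col_mxEd (f x) (g x) l j)); exact: Ck_entry.
Qed.

Lemma Ck_usubmx k U p1 p2 q (f : V -> 'M[R]_(p1 + p2, q)) :
  open U -> Ck_on k U f -> Ck_on k U (fun x => usubmx (f x)).
Proof.
move=> oU cf; apply/Ck_mxP => // i j.
rewrite (_ : (fun y => _) = fun y => f y (lshift p2 i) j); first exact: Ck_entry.
by apply/funext => y; rewrite mxE.
Qed.

Lemma Ck_dsubmx k U p1 p2 q (f : V -> 'M[R]_(p1 + p2, q)) :
  open U -> Ck_on k U f -> Ck_on k U (fun x => dsubmx (f x)).
Proof.
move=> oU cf; apply/Ck_mxP => // i j.
rewrite (_ : (fun y => _) = fun y => f y (rshift p1 i) j); first exact: Ck_entry.
by apply/funext => y; rewrite mxE.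
Qed.

End CkMatrix.

(** * Composition in several variables and Jacobians *)

Section CkComp.
Variables (R : realType).
Implicit Types (k m p q : nat).

Definition bvec m (i : 'I_m) : 'cV[R]_m := delta_mx i ord0.

Lemma cV_sum m (v : 'cV[R]_m) : v = \sum_i v i ord0 *: bvec i.
Proof.
rewrite {1}(matrix_sum_delta v); apply: eq_bigr => i _.
by rewrite big_ord_recl big_ord0 addr0.
Qed.

Lemma diff_sum m (W : normedModType R) (g : 'cV[R]_m -> W) x v :
  differentiable g x -> 'd g x v = \sum_i v i ord0 *: 'D_(bvec i) g x.
Proof.
move=> dg; rewrite {1}(cV_sum v) linear_sum; apply: eq_bigr => i _.
by rewrite linearZ deriveE.
Qed.

Lemma Ck_comp_scalar k m (X : normedModType R) (U : set X) (O : set 'cV[R]_m)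
    (f : X -> 'cV[R]_m) (g : 'cV[R]_m -> R) :
  open U -> open O -> f @` U `<=` O ->
  Ck_on k O g -> Ck_on k U f -> Ck_on k U (fun x => g (f x)).
Proof.
move=> oU oO fUO; elim: k g => [|k IH] g.
  move=> cg cf x; rewrite inE => Ux; apply: continuous_comp.
    by apply: cf; rewrite inE.
  by apply: cg; rewrite inE; apply: fUO; exists x.
move=> cg cf; have [df Df] := cf; have [dg Dg] := cg.
have dgx x : U x -> differentiable g (f x) by move=> Ux; apply: dg; apply: fUO; exists x.
split=> [x Ux|v].
  by apply: differentiable_compE; [exact: df|exact: dgx].
apply: (@Ck_eq _ _ _ _ _ (fun x => \sum_i ('D_v f x) i ord0 * 'D_(bvec i) g (f x))) => //.
  move=> x; rewrite inE => Ux.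
  by rewrite (derive_comp _ (df x Ux) (dgx x Ux)) (diff_sum _ (dgx x Ux)).
apply: Ck_sum => // i _; apply: CkM => //; first by apply: Ck_entry => //; exact: Df.
by apply: (IH ('D_(bvec i) g)); [exact: Dg|exact: CkW].
Qed.

Lemma Ck_comp k m p q (X : normedModType R) (U : set X) (O : set 'cV[R]_m)
    (f : X -> 'cV[R]_m) (g : 'cV[R]_m -> 'M[R]_(p, q)) :
  open U -> open O -> f @` U `<=` O ->
  Ck_on k O g -> Ck_on k U f -> Ck_on k U (fun x => g (f x)).
Proof.
move=> oU oO fUO cg cf; apply/Ck_mxP => // i j.
by apply: (@Ck_comp_scalar _ _ _ _ O f (fun y => g y i j)) => //; exact: Ck_entry.
Qed.

Lemma Ck_compT k m p q (X : normedModType R) (U : set X)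
    (f : X -> 'cV[R]_m) (g : 'cV[R]_m -> 'M[R]_(p, q)) :
  open U -> Ck_on k setT g -> Ck_on k U f -> Ck_on k U (fun x => g (f x)).
Proof. by move=> oU; apply: Ck_comp => //; exact: openT. Qed.

Definition jac m p (f : 'cV[R]_m -> 'cV[R]_p) (x : 'cV[R]_m) : 'M[R]_(p, m) :=
  \matrix_(i, j) ('D_(bvec j) f x) i ord0.

Lemma jacE m p (f : 'cV[R]_m -> 'cV[R]_p) x v : differentiable f x ->
  'd f x v = jac f x *m v.
Proof.
move=> df; rewrite (diff_sum _ df); apply/colP => i; rewrite summxE mxE.
by apply: eq_bigr => j _; rewrite !mxE mulrC.
Qed.

Lemma derive_jac m p (f : 'cV[R]_m -> 'cV[R]_p) x v : differentiable f x ->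
  'D_v f x = jac f x *m v.
Proof. by move=> df; rewrite deriveE// jacE. Qed.

Lemma Ck_jac k m p (U : set 'cV[R]_m) (f : 'cV[R]_m -> 'cV[R]_p) : open U ->
  Ck_on k.+1 U f -> Ck_on k U (jac f).
Proof.
move=> oU [_ Df]; apply: Ck_mx => // i j; apply: Ck_entry => //; exact: Df.
Qed.

End CkComp.

Arguments bvec {R m} i.

(** * Compactness and mean value theorems *)

Section Compact.
Variable R : realType.

Lemma trmx_continuous p q : continuous (fun M : 'M[R]_(p, q) => M^T).
Proof.
move=> M; apply/continuous_mxP => i j.
have -> : (fun N : 'M[R]_(p, q) => N^T i j) = (fun N => N j i).
  by apply/funext => N; rewrite mxE.
exact: entry_continuous.
Qed.

(** Transposition carries the Heine-Borel theorem from row vectors to column vectors. *)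
Lemma cV_compact m (A : set 'cV[R]_m) : bounded_set A -> closed A -> compact A.
Proof.
move=> [M [Mr bA]] cA.
pose B := [set w : 'rV[R]_m | A w^T].
have -> : A = (fun w : 'rV[R]_m => w^T) @` B.
  apply/seteqP; split=> [x Ax|_ [w Bw <-]//].
  by exists x^T; rewrite /B /= ?trmxK.
apply: continuous_compact.
  by apply: continuous_subspaceT => w; exact: trmx_continuous.
apply: bounded_closed_compact.
  exists M; split=> // x Mx w Bw.
  apply: le_trans (bA x Mx _ Bw); apply: mx_norm_le => // i j.
  by apply: le_trans (mx_norm_ge w^T j i); rewrite mxE.
have := @closed_comp _ _ (fun w : 'rV[R]_m => w^T) A.
by apply => // w _; exact: trmx_continuous.
Qed.

Lemma cV_ball_compact m (x : 'cV[R]_m) (r : R) : compact [set y | `|y - x| <= r].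
Proof.
apply: cV_compact.
  exists (r + `|x|); split; first by rewrite num_real.
  move=> e re y /= yr; apply: ltW; apply: le_lt_trans re.
  by rewrite -[y in `|y|](subrK x); apply: le_trans (ler_normD _ _) _; rewrite lerD2r.
have -> : [set y | `|y - x| <= r] = (fun y => `|y - x|) @^-1` [set s | s <= r].
  by [].
apply: closed_comp; last exact: closed_le.
move=> y _.
have c1 : {for y, continuous (fun y : 'cV[R]_m => y - x)}.
  exact: (cvgB cvg_id (cvg_cst x)).
exact: (continuous_comp c1 (@norm_continuous _ _ _)).
Qed.

Lemma mulmx_norm p m q (A : 'M[R]_(p, m)) (B : 'M[R]_(m, q)) :
  `|A *m B| <= m%:R * `|A| * `|B|.
Proof.
apply: mx_norm_le => [|i j]; first by rewrite !mulr_ge0.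
rewrite mxE; apply: le_trans (ler_norm_sum _ _ _) _.
apply: le_trans (_ : \sum_(k < m) `|A| * `|B| <= _).
  by apply: ler_sum => k _; rewrite normrM ler_pM// mx_norm_ge.
by rewrite sumr_const card_ord -[leLHS]mulr_natl mulrA.
Qed.

End Compact.

Section RealLine.
Variable R : realType.
Implicit Types (f df : R -> R) (a b : R).

Lemma is_derive_within f df a b :
  (forall x, x \in `[a, b]%R -> is_derive x 1 f (df x)) ->
  {within `[a, b], continuous f}.
Proof.
by move=> fd; apply: derivable_within_continuous => x xab; have [] := fd x xab.
Qed.

Lemma nonincr_derive f df a b : a <= b ->
  (forall x, x \in `[a, b]%R -> is_derive x 1 f (df x)) ->
  (forall x, x \in `[a, b]%R -> df x <= 0) -> f b <= f a.
Proof.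
move=> ab fd d0.
have fd' x : x \in `]a, b[%R -> is_derive x 1 f (df x) by move=> /subset_itv_oo_cc; exact: fd.
have [c cab E] := MVT_segment ab fd' (is_derive_within fd).
by rewrite -subr_le0 E mulr_le0_ge0 ?subr_ge0// d0.
Qed.

Lemma nondecr_derive f df a b : a <= b ->
  (forall x, x \in `[a, b]%R -> is_derive x 1 f (df x)) ->
  (forall x, x \in `[a, b]%R -> 0 <= df x) -> f a <= f b.
Proof.
move=> ab fd d0.
have fd' x : x \in `]a, b[%R -> is_derive x 1 f (df x) by move=> /subset_itv_oo_cc; exact: fd.
have [c cab E] := MVT_segment ab fd' (is_derive_within fd).
by rewrite -subr_ge0 E mulr_ge0 ?subr_ge0// d0.
Qed.

Lemma derive_compare f df (g dg : R -> R) a b : a <= b ->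
  (forall x, x \in `[a, b]%R -> is_derive x 1 f (df x)) ->
  (forall x, x \in `[a, b]%R -> is_derive x 1 g (dg x)) ->
  (forall x, x \in `[a, b]%R -> `|df x| <= dg x) -> `|f b - f a| <= g b - g a.
Proof.
move=> ab fd gd dfg; rewrite ler_norml; apply/andP; split.
  have : (f + g) a <= (f + g) b.
    apply: (@nondecr_derive _ (fun x => df x + dg x)) => // x xab.
      by have := fd x xab; have := gd x xab => *; exact: is_deriveD.
    by have := dfg x xab; rewrite ler_norml => /andP[]; rewrite lerNl; lra.
  by rewrite !fctE; lra.
have : (f - g) b <= (f - g) a.
  apply: (@nonincr_derive _ (fun x => df x - dg x)) => // x xab.
    by have := fd x xab; have := gd x xab => *; exact: is_deriveB.
  by have := dfg x xab; rewrite ler_norml => /andP[]; lra.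
by rewrite !fctE; lra.
Qed.

Lemma const_derive f a b : a <= b ->
  (forall x, x \in `[a, b]%R -> is_derive x 1 f 0) -> f a = f b.
Proof.
move=> ab fd; apply/eqP; rewrite eq_le; apply/andP; split.
  exact: (@nondecr_derive f (fun=> 0) a b).
exact: (@nonincr_derive f (fun=> 0) a b).
Qed.

End RealLine.

Section MeanValue.
Variables (R : realType) (V : normedModType R).

Lemma is_derive_line (a h : V) (s : R) : is_derive s 1 (fun t : R => a + t *: h) h.
Proof.
have := @is_deriveD R R V (cst a) ( *:%R^~ h) s 1 0 h (is_derive_cst _ _ _).
rewrite add0r; apply.
have [d1 e1] := @is_diff_scalel R V s h.
by apply: DeriveDef; [exact: diff_derivable|rewrite deriveE// e1 scale1r].
Qed.

Lemma is_derive_along (W : normedModType R) (f : V -> W) (u : R -> V) du (t : R) :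
  is_derive t 1 u du -> differentiable f (u t) ->
  is_derive t 1 (fun s => f (u s)) ('d f (u t) du).
Proof.
move=> [/derivable1_diffP du1 <-] df; apply: DeriveDef.
  by apply/derivable1_diffP; exact: differentiable_compE.
exact: derive_comp.
Qed.

Lemma mvt_segment (f : V -> R) (a h : V) :
  (forall s : R, 0 <= s <= 1 -> differentiable f (a + s *: h)) ->
  exists2 s : R, 0 < s < 1 & f (a + h) - f a = 'd f (a + s *: h) h.
Proof.
move=> df.
have fd (x : R) : x \in `[0, 1]%R -> is_derive x 1 (fun s : R => f (a + s *: h)) ('d f (a + x *: h) h).
  rewrite in_itv/= => x01; apply: is_derive_along; first exact: is_derive_line.
  exact: df.
have fd' (x : R) : x \in `]0, 1[%R -> is_derive x 1 (fun s : R => f (a + s *: h)) ('d f (a + x *: h) h).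
  by move=> /subset_itv_oo_cc; exact: fd.
have [s s01] := MVT (@ltr01 R) fd' (is_derive_within fd).
rewrite scale1r scale0r addr0 subr0 mulr1 => E; exists s => //.
Qed.

Lemma mvt_dir (f : V -> R) (a u : V) (h : R) :
  (forall s : R, 0 <= s <= 1 -> differentiable f (a + (s * h) *: u)) ->
  exists2 s : R, 0 < s < 1 & f (a + h *: u) - f a = h * 'D_u f (a + (s * h) *: u).
Proof.
move=> df; have [|s s01 E] := @mvt_segment f a (h *: u).
  by move=> s s01; rewrite scalerA; exact: df.
exists s => //; rewrite E linearZ scalerA deriveE//; apply: df.
by move: s01 => /andP[/ltW-> /ltW->].
Qed.

(* The second difference of f over a small parallelogram equals each of the two mixed derivatives
   at some nearby point. *)
Lemma derive_sym (U : set V) (f : V -> R) (x u v : V) : open U -> U x ->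
  Ck_on 2 U f -> 'D_u ('D_v f) x = 'D_v ('D_u f) x.
Proof.
move=> oU Ux [df Df].
suff step (p q : V) (e : R) : 0 < e -> exists2 r : R, 0 < r & forall h, 0 < h < r ->
    `| f (x + h *: p + h *: q) - f (x + h *: p) - f (x + h *: q) + f x
        - h * (h * 'D_q ('D_p f) x)| <= h * h * e.
  apply/eqP; rewrite -subr_eq0 -normr_le0; apply/ler_addgt0Pr => e e0; rewrite add0r.
  have e2 : 0 < e / 2 by rewrite divr_gt0.
  have [r1 r10 H1] := step u v _ e2; have [r2 r20 H2] := step v u _ e2.
  pose h := Num.min r1 r2 / 2.
  have m0 : 0 < Num.min r1 r2 by rewrite lt_min r10.
  have h0 : 0 < h by rewrite divr_gt0.
  have hm : h < Num.min r1 r2 by rewrite /h; lra.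
  move: (hm); rewrite lt_min => /andP[h1 h2].
  have := H1 h; have := H2 h; rewrite h0 h1 h2 => /(_ isT) + /(_ isT).
  rewrite (addrAC x (h *: v)).
  set a := f _; set b := f _; set c := f _; set d := f _.
  set X := 'D_u ('D_v f) x; set Y := 'D_v ('D_u f) x; move=> A1 A2.
  rewrite -(@ler_pM2l _ (h * h)) ?mulr_gt0// -[in leLHS](gtr0_norm (mulr_gt0 h0 h0)) -normrM.
  have -> : h * h * (X - Y) = (a - c - b + d - h * (h * Y)) - (a - b - c + d - h * (h * X)) by ring.
  have -> : h * h * e = h * h * (e / 2) + h * h * (e / 2) by rewrite -mulrDr -splitr.
  exact: le_trans (ler_normB _ _) (lerD A2 A1).
move=> e0; move: p q => {}u {}v.
have cD : {for x, continuous ('D_v ('D_u f))}.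
  have [_ Dfu] := Df u; have := Dfu v; apply; by rewrite inE.
have /nbhs_ballP[r0 /= r00 Hr0] : \forall y \near x, U y /\ `|'D_v ('D_u f) y - 'D_v ('D_u f) x| <= e.
  near=> y; split; first by near: y; exact: (open_nbhs_nbhs (conj oU Ux)).
  by rewrite distrC; near: y; move/cvgrPdist_le : cD; apply.
pose M := `|u| + `|v| + 1.
have M0 : 0 < M by rewrite /M ltr_pwDr// addr_ge0.
exists (r0 / M); first by rewrite divr_gt0.
move=> h /andP[h0]; rewrite ltr_pdivlMr// => hr.
have inb (s t : R) : 0 <= s <= 1 -> 0 <= t <= 1 ->
   U (x + (s * h) *: u + (t * h) *: v) /\
   `|'D_v ('D_u f) (x + (s * h) *: u + (t * h) *: v) - 'D_v ('D_u f) x| <= e.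
  move=> /andP[s0 s1] /andP[t0 t1]; apply: Hr0; rewrite -ball_normE /ball_/=.
  rewrite distrC -(addrA x) [x + _]addrC addrK; apply: le_lt_trans hr.
  apply: le_trans (ler_normD _ _) _; rewrite !normrZ.
  rewrite (gtr0_norm h0) (ger0_norm s0) (ger0_norm t0).
  have Hu : s * h * `|u| <= h * `|u| by rewrite ler_wpM2r// ler_piMl// ltW.
  have Hv : t * h * `|v| <= h * `|v| by rewrite ler_wpM2r// ler_piMl// ltW.
  by rewrite /M !mulrDr mulr1; have := ltW h0; lra.
have inU s t : 0 <= s <= 1 -> 0 <= t <= 1 -> U (x + (s * h) *: u + (t * h) *: v).
  by move=> s01 t01; have [] := inb s t s01 t01.
pose phi y := f (y + h *: v) - f y.
have df0 s : 0 <= s <= 1 -> differentiable f (x + (s * h) *: u).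
  move=> s01; apply: df; have := inU s 0 s01; rewrite mul0r scale0r addr0; apply.
  by rewrite lexx ler01.
have df1 s : 0 <= s <= 1 -> differentiable f (x + (s * h) *: u + h *: v).
  by move=> s01; apply: df; have := inU s 1 s01; rewrite mul1r; apply; rewrite ler01 lexx.
have dsh z : differentiable (fun y : V => y + h *: v) z.
  by apply: (@differentiableD _ _ _ id (cst (h *: v))) => //; exact: differentiable_cst.
have dfs s : 0 <= s <= 1 -> differentiable (fun y : V => f (y + h *: v)) (x + (s * h) *: u).
  by move=> s01; apply: differentiable_compE; [exact: dsh|exact: df1].
have [s0 s01 E1] : exists2 s : R, 0 < s < 1 & phi (x + h *: u) - phi x = h * 'D_u phi (x + (s * h) *: u).
  apply: mvt_dir => s s01; exact: (differentiableB (dfs s s01) (df0 s s01)).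
have s01' : 0 <= s0 <= 1 by move: s01 => /andP[/ltW-> /ltW->].
have E2 : 'D_u phi (x + (s0 * h) *: u) = 'D_u f (x + (s0 * h) *: u + h *: v) - 'D_u f (x + (s0 * h) *: u).
  rewrite deriveB; [|exact: diff_derivable (dfs _ s01')|exact: diff_derivable (df0 _ s01')].
  rewrite derive_comp; [|exact: dsh|exact: df1].
  congr (_ - _); rewrite (deriveE u (df1 _ s01')); congr ('d f _ _).
  by rewrite (@deriveD _ _ _ id (cst (h *: v)))// derive_id derive_cst addr0.
have [t0 t01 E3] : exists2 t : R, 0 < t < 1 & 'D_u f (x + (s0 * h) *: u + h *: v) - 'D_u f (x + (s0 * h) *: u)
   = h * 'D_v ('D_u f) (x + (s0 * h) *: u + (t * h) *: v).
  apply: (@mvt_dir ('D_u f)) => t t01; have [Dfu _] := Df u; apply: Dfu; exact: inU.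
have t01' : 0 <= t0 <= 1 by move: t01 => /andP[/ltW-> /ltW->].
rewrite (_ : f (x + h *: u + h *: v) - f (x + h *: u) - f (x + h *: v) + f x = phi (x + h *: u) - phi x); last first.
  by rewrite /phi; ring.
rewrite E1 E2 E3 -!mulrBr !normrM (gtr0_norm h0) mulrA ler_wpM2l//.
  by rewrite mulr_ge0// ltW.
by have [] := inb s0 t0 s01' t01'.
Unshelve. all: by end_near. Qed.

End MeanValue.

Section Uniform.
Variable R : realType.

(** Continuity of the Jacobian gives the estimate near each point of [K], with a radius for [h] that
    serves all nearby base points; a covering argument then makes it uniform over [K]. *)
Lemma C1_uniform_diff m p (f : 'cV[R]_m -> 'cV[R]_p) (K : set 'cV[R]_m) :
  Ck_on 1 setT f -> compact K -> forall e : R, 0 < e ->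
  \forall h \near (0 : 'cV[R]_m), forall x, K x ->
    `|f (x + h) - f x - 'd f x h| <= e * `|h|.
Proof.
move=> cf cK e e0.
have df x : differentiable f x by exact: Ck_differentiable cf I.
have /compact_near_coveringP cov := cK.
have := @cov _ (nbhs (0 : 'cV[R]_m)) (fun h x => `|f (x + h) - f x - 'd f x h| <= e * `|h|) _.
apply=> x Kx.
have cj : {for x, continuous (jac f)} by apply: (Ck_jac openT cf); rewrite inE.
(* Each of the [m] coordinates will contribute at most e / c times |h|; the added 1 keeps [c]
   positive in dimension 0. The further division by 2 pays for comparing both Jacobians with the one
   at [x]. *)
pose c := m%:R + 1 : R.
have c0 : 0 < c by rewrite ltr_pwDr.
have e1 : 0 < e / c / 2 by rewrite !divr_gt0.
have /nbhs_ballP[r /= r0 Hr] : \forall y \near x, `|jac f x - jac f y| <= e / c / 2.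
  by move/cvgrPdist_le : cj; apply.
have r2 : 0 < r / 2 by rewrite divr_gt0.
exists (ball x (r / 2), ball (0 : 'cV[R]_m) (r / 2)).
  by split; exact: nbhsx_ballx.
move=> [y h] /= []; rewrite -ball_normE /ball_/= sub0r normrN => xy hr.
rewrite jacE//; apply: mx_norm_le => [|i j]; first by rewrite mulr_ge0// ltW.
rewrite ord1 {j} !mxE.
have di z : differentiable (fun y => f y i ord0) z.
  by have /differentiable_mxP := df z; apply.
have [|s /andP[s0 s1] E] := @mvt_segment _ _ (fun y => f y i ord0) y h.
  by move=> s _; exact: di.
rewrite E (diff_sum _ (di _)) -sumrB.
apply: le_trans (ler_norm_sum _ _ _) _.
apply: (@le_trans _ _ (\sum_(k < m) e / c * `|h|)); last first.
  rewrite sumr_const card_ord -mulr_natl mulrA ler_wpM2r//.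
  by rewrite mulrA ler_pdivrMr// mulrC ler_wpM2l ?(ltW e0)// lerDl.
apply: ler_sum => k _.
have Jk z : 'D_(bvec k) (fun y => f y i ord0) z = jac f z i k.
  by rewrite mxE derive_entry//; exact: diff_derivable.
rewrite Jk -[_ *: _]/(_ * _) mulrC -mulrBl normrM ler_pM//; last exact: mx_norm_ge.
have H z : ball x r z -> `|jac f x i k - jac f z i k| <= e / c / 2.
  move=> /Hr; apply: le_trans.
  by have := mx_norm_ge (jac f x - jac f z) i k; rewrite !mxE.
rewrite -[X in `|X|](subrKA (jac f x i k)) -[X in `|X + _|]opprB.
apply: le_trans (ler_normD _ _) _; rewrite normrN (splitr (e / c)) lerD//; apply: H.
  rewrite -ball_normE/= /ball_/= opprD addrA; apply: le_lt_trans (ler_normB _ _) _.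
  rewrite (splitr r) ltrD// normrZ (gtr0_norm s0); apply: le_lt_trans hr.
  by rewrite ler_piMl// ltW.
by rewrite -ball_normE/= /ball_/=; apply: lt_trans xy _; lra.
Qed.

Lemma C1_bounded_diff m p (f : 'cV[R]_m -> 'cV[R]_p) (K : set 'cV[R]_m) :
  Ck_on 1 setT f -> compact K ->
  exists2 L : R, 0 <= L & forall x, K x -> forall h, `|'d f x h| <= L * `|h|.
Proof.
move=> cf cK.
have df x : differentiable f x by exact: Ck_differentiable cf I.
have cj : continuous (jac f) by move=> x; apply: (Ck_jac openT cf); rewrite inE.
have /compact_bounded[M [Mr HM]] : compact (jac f @` K).
  by apply: continuous_compact => //; exact: continuous_subspaceT.
exists (m%:R * (`|M| + 1)); first by rewrite mulr_ge0// addr_ge0.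
move=> x Kx h; rewrite jacE//; apply: le_trans (mulmx_norm _ _) _.
rewrite ler_wpM2r// ler_wpM2l//; apply: HM; last by exists x.
by apply: le_lt_trans (ler_norm _) _; rewrite ltrDl.
Qed.

(** With the maximum norm the mean value inequality can be proved entry by entry, each entry having
    its own intermediate point on the segment. *)
Lemma C1_lipschitz m p (f : 'cV[R]_m -> 'cV[R]_p) (L : R) x y : 0 <= L ->
  Ck_on 1 setT f ->
  (forall s : R, 0 <= s <= 1 -> forall h, `|'d f (x + s *: (y - x)) h| <= L * `|h|) ->
  `|f y - f x| <= L * `|y - x|.
Proof.
move=> L0 cf HL.
have df z : differentiable f z by exact: Ck_differentiable cf I.
apply: mx_norm_le => [|i j]; first by rewrite mulr_ge0.
rewrite ord1 {j} !mxE.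
have di z : differentiable (fun y => f y i ord0) z.
  by have /differentiable_mxP := df z; apply.
have [|s /andP[s0 s1]] := @mvt_segment _ _ (fun y => f y i ord0) x (y - x).
  by move=> s _; exact: di.
rewrite [x + (y - x)]addrC subrK => ->; have := HL s; rewrite (ltW s0) (ltW s1) => /(_ isT (y - x)).
apply: le_trans; rewrite -!deriveE//.
by rewrite -derive_entry ?mx_norm_ge//; exact: diff_derivable.
Qed.

End Uniform.

(** * Derivatives of matrix-valued curves *)

Section DeriveMx.
Variables (R : realType).

Lemma is_derive_entry p q (D : R -> 'M[R]_(p, q)) (d : 'M[R]_(p, q)) (t : R) i j :
  is_derive t 1 D d -> is_derive t 1 (fun s => D s i j) (d i j).
Proof.
move=> [Dd <-]; apply: DeriveDef; last by rewrite derive_entry.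
by move/derivable_mxP: Dd.
Qed.

Lemma is_derive_mxP p q (D : R -> 'M[R]_(p, q)) (d : 'M[R]_(p, q)) (t : R) :
  (forall i j, is_derive t 1 (fun s => D s i j) (d i j)) -> is_derive t 1 D d.
Proof.
move=> Dd; have DD : derivable D t 1 by apply/derivable_mxP => i j; case: (Dd i j).
apply: DeriveDef => //; apply/matrixP => i j.
by rewrite derive_entry//; case: (Dd i j).
Qed.

Lemma is_derive_continuous (W : normedModType R) (D : R -> W) (d : W) (t : R) :
  is_derive t 1 D d -> {for t, continuous D}.
Proof. by case=> /derivable1_diffP /differentiable_continuous. Qed.

Lemma is_derive_col_mx p q (u : R -> 'cV[R]_p) (v : R -> 'cV[R]_q) du dv (t : R) :
  is_derive t 1 u du -> is_derive t 1 v dv ->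
  is_derive t 1 (fun s => col_mx (u s) (v s)) (col_mx du dv).
Proof.
move=> ud vd; apply: is_derive_mxP => i j; case: (split_ordP i) => k ->.
  rewrite (funext (fun s => col_mxEu (u s) (v s) k j)) col_mxEu.
  exact: is_derive_entry.
rewrite (funext (fun s => col_mxEd (u s) (v s) k j)) col_mxEd.
exact: is_derive_entry.
Qed.

Lemma is_derive_mulmx p q r (A : R -> 'M[R]_(p, q)) (B : R -> 'M[R]_(q, r)) dA dB (t : R) :
  is_derive t 1 A dA -> is_derive t 1 B dB ->
  is_derive t 1 (fun s => A s *m B s) (dA *m B t + A t *m dB).
Proof.
move=> Ad Bd; apply: is_derive_mxP => i j.
have -> : (fun s => (A s *m B s) i j) = \sum_(k < q) (fun s => A s i k * B s k j).
  by apply/funext => s; rewrite mxE fct_sumE.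
have -> : (dA *m B t + A t *m dB) i j =
    \sum_(k < q) (A t i k *: dB k j + B t k j *: dA i k).
  rewrite !mxE -big_split/=; apply: eq_bigr => k _.
  by rewrite addrC [X in _ + X = _]mulrC.
apply: is_derive_sum => k.
have A1 := is_derive_entry i k Ad; have B1 := is_derive_entry k j Bd.
exact: (@is_deriveM R R (fun s => A s i k) (fun s => B s k j) t 1).
Qed.

Lemma is_derive_mulmxr p q r (A : R -> 'M[R]_(p, q)) dA (B : 'M[R]_(q, r)) (t : R) :
  is_derive t 1 A dA -> is_derive t 1 (fun s => A s *m B) (dA *m B).
Proof.
by move=> Ad; have := is_derive_mulmx Ad (is_derive_cst B t 1); rewrite mulmx0 addr0.
Qed.

Lemma is_derive_mulmxl p q r (A : 'M[R]_(p, q)) (B : R -> 'M[R]_(q, r)) dB (t : R) :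
  is_derive t 1 B dB -> is_derive t 1 (fun s => A *m B s) (A *m dB).
Proof.
by move=> Bd; have := is_derive_mulmx (is_derive_cst A t 1) Bd; rewrite mul0mx add0r.
Qed.

End DeriveMx.

Lemma is_derive_scale (R : realType) (c t : R) : is_derive t 1 (fun s : R => c * s) c.
Proof.
have := @is_deriveZ R R R id c t 1 1 (is_derive_id _ _).
by rewrite -[_ *: 1]/(_ * 1) mulr1.
Qed.

Lemma is_derive_expRM (R : realType) (c t : R) :
  is_derive t 1 (fun s : R => expR (c * s)) (c * expR (c * t)).
Proof.
have := @is_derive1_comp R expR ( *%R c) t _ _ (is_derive_expR _) (is_derive_scale c t).
by rewrite mulrC.
Qed.

(** * Euclidean norm *)

Section Euclid.
Variables (R : realType).

Definition dot m (u v : 'cV[R]_m) : R := (u^T *m v) ord0 ord0.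
Definition nrm m (v : 'cV[R]_m) : R := Num.sqrt (dot v v).

Section Fixed.
Variable m : nat.
Implicit Types (u v w : 'cV[R]_m).

Lemma dotE u v : dot u v = \sum_i u i ord0 * v i ord0.
Proof. by rewrite /dot mxE; apply: eq_bigr => i _; rewrite mxE. Qed.

Lemma dotC u v : dot u v = dot v u.
Proof. by rewrite !dotE; apply: eq_bigr => i _; rewrite mulrC. Qed.

Lemma dotDr u v w : dot u (v + w) = dot u v + dot u w.
Proof. by rewrite /dot mulmxDr mxE. Qed.

Lemma dotDl u v w : dot (v + w) u = dot v u + dot w u.
Proof. by rewrite dotC dotDr !(dotC u). Qed.

Lemma dotZr u v a : dot u (a *: v) = a * dot u v.
Proof. by rewrite /dot -scalemxAr mxE. Qed.

Lemma dotZl u v a : dot (a *: u) v = a * dot u v.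
Proof. by rewrite dotC dotZr dotC. Qed.

Lemma dotNr u v : dot u (- v) = - dot u v.
Proof. by rewrite -scaleN1r dotZr mulN1r. Qed.

Lemma dotNl u v : dot (- u) v = - dot u v.
Proof. by rewrite dotC dotNr dotC. Qed.

Lemma dotBr u v w : dot u (v - w) = dot u v - dot u w.
Proof. by rewrite dotDr dotNr. Qed.

Lemma dotBl u v w : dot (v - w) u = dot v u - dot w u.
Proof. by rewrite dotDl dotNl. Qed.

Lemma dot0r u : dot u 0 = 0.
Proof. by rewrite /dot mulmx0 mxE. Qed.

Lemma dot0l u : dot 0 u = 0.
Proof. by rewrite dotC dot0r. Qed.

Lemma dot_ge0 u : 0 <= dot u u.
Proof. by rewrite dotE sumr_ge0// => i _; rewrite -expr2 sqr_ge0. Qed.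

Lemma dot_eq0 u : dot u u = 0 -> u = 0.
Proof.
rewrite dotE => /eqP; rewrite psumr_eq0 => [/allP H|i _]; last by rewrite -expr2 sqr_ge0.
apply/colP => i; rewrite mxE; apply/eqP.
by have := H i; rewrite mem_index_enum mulf_eq0 orbb => /(_ isT).
Qed.

Lemma nrm_ge0 u : 0 <= nrm u.
Proof. exact: sqrtr_ge0. Qed.

Lemma nrm_sqr u : nrm u ^+ 2 = dot u u.
Proof. by rewrite sqr_sqrtr ?dot_ge0. Qed.

Lemma nrm0 : nrm (0 : 'cV[R]_m) = 0.
Proof. by rewrite /nrm dot0r sqrtr0. Qed.

Lemma nrm_eq0 u : nrm u = 0 -> u = 0.
Proof. by move=> u0; apply: dot_eq0; rewrite -nrm_sqr u0 expr0n. Qed.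

Lemma dot_sqr_le u v : dot u v ^+ 2 <= dot u u * dot v v.
Proof.
have [u0|u0] := eqVneq (dot u u) 0.
  by rewrite (dot_eq0 u0) !dot0l expr0n/= mul0r.
have up : 0 < dot u u by rewrite lt0r u0 dot_ge0.
have := dot_ge0 (dot u u *: v - dot u v *: u).
rewrite !dotBl !dotBr !dotZl !dotZr (dotC v u).
set a := dot u u; set b := dot u v; set c := dot v v.
rewrite (_ : _ - _ = a * (a * c - b ^+ 2)); last by ring.
by rewrite pmulr_rge0// subr_ge0.
Qed.

Lemma dot_le u v : `|dot u v| <= nrm u * nrm v.
Proof.
rewrite -(@ler_pXn2r _ 2) ?nnegrE ?mulr_ge0 ?nrm_ge0//.
by rewrite real_normK ?num_real// exprMn !nrm_sqr dot_sqr_le.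
Qed.

Lemma dot_le' u v : dot u v <= nrm u * nrm v.
Proof. exact: le_trans (ler_norm _) (dot_le u v). Qed.

Lemma nrmZ a u : nrm (a *: u) = `|a| * nrm u.
Proof. by rewrite /nrm dotZl dotZr mulrA -expr2 sqrtrM ?sqr_ge0// sqrtr_sqr. Qed.

Lemma nrmN u : nrm (- u) = nrm u.
Proof. by rewrite -scaleN1r nrmZ normrN1 mul1r. Qed.

Lemma nrmD u v : nrm (u + v) <= nrm u + nrm v.
Proof.
rewrite -(@ler_pXn2r _ 2) ?nnegrE ?addr_ge0 ?nrm_ge0//.
rewrite nrm_sqr dotDl !dotDr sqrrD !nrm_sqr (dotC v u).
have := dot_le' u v; set a := dot u u; set b := dot v v; set c := dot u v; lra.
Qed.

Lemma nrmB u v : nrm (u - v) <= nrm u + nrm v.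
Proof. by rewrite -[X in _ <= _ + X]nrmN; exact: nrmD. Qed.

Lemma nrm_distC u v : nrm (u - v) = nrm (v - u).
Proof. by rewrite -nrmN opprB. Qed.

Lemma entry_le_nrm u i : `|u i ord0| <= nrm u.
Proof.
rewrite -(@ler_pXn2r _ 2) ?nnegrE ?nrm_ge0// nrm_sqr dotE (bigD1 i)//=.
rewrite real_normK ?num_real// expr2 lerDl sumr_ge0// => j _.
by rewrite -expr2 sqr_ge0.
Qed.

Lemma norm_le_nrm u : `|u| <= nrm u.
Proof.
apply: mx_norm_le; first exact: nrm_ge0.
by move=> i j; rewrite ord1; exact: entry_le_nrm.
Qed.

Lemma nrm_le_norm u : nrm u <= m.+1%:R * `|u|.
Proof.
rewrite -(@ler_pXn2r _ 2) ?nnegrE ?nrm_ge0 ?mulr_ge0// nrm_sqr dotE.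
apply: (@le_trans _ _ (\sum_(i < m) `|u| ^+ 2)).
  apply: ler_sum => i _; rewrite -expr2 -real_normK ?num_real//.
  by rewrite lerXn2r ?nnegrE//; exact: mx_norm_ge.
rewrite sumr_const card_ord -[leLHS]mulr_natl exprMn ler_wpM2r ?sqr_ge0//.
rewrite -natrX ler_nat expnS expn1; apply: leq_trans (leqnSn m) _.
by rewrite leq_pmulr.
Qed.

End Fixed.

Lemma dot_mul m p (A : 'M[R]_(p, m)) (u : 'cV[R]_p) (v : 'cV[R]_m) :
  dot u (A *m v) = dot (A^T *m u) v.
Proof. by rewrite /dot trmx_mul trmxK mulmxA. Qed.

Definition frob m p (A : 'M[R]_(p, m)) : R := Num.sqrt (\sum_i \sum_j A i j ^+ 2).

Lemma nrm_mulmx m p (A : 'M[R]_(p, m)) (v : 'cV[R]_m) : nrm (A *m v) <= frob A * nrm v.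
Proof.
have S0 : 0 <= \sum_i \sum_j A i j ^+ 2.
  by rewrite sumr_ge0// => i _; rewrite sumr_ge0// => j _; exact: sqr_ge0.
rewrite -(@ler_pXn2r _ 2) ?nnegrE ?mulr_ge0 ?sqrtr_ge0// exprMn nrm_sqr sqr_sqrtr//.
rewrite nrm_sqr mulr_suml dotE; apply: ler_sum => i _.
have -> : (A *m v) i ord0 = dot (row i A)^T v.
  by rewrite dotE mxE; apply: eq_bigr => j _; rewrite !mxE.
rewrite -expr2; apply: le_trans (dot_sqr_le _ _) _.
rewrite ler_wpM2r ?dot_ge0// dotE le_eqVlt; apply/orP; left; apply/eqP.
by apply: eq_bigr => j _; rewrite !mxE expr2.
Qed.

Lemma Ck_dot k (V : normedModType R) (U : set V) m (f g : V -> 'cV[R]_m) : open U ->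
  Ck_on k U f -> Ck_on k U g -> Ck_on k U (fun x => dot (f x) (g x)).
Proof.
by move=> oU cf cg; apply: Ck_entry => //; apply: Ck_mulmx => //; exact: Ck_tr.
Qed.

Lemma is_derive_tr p q (A : R -> 'M[R]_(p, q)) dA (t : R) :
  is_derive t 1 A dA -> is_derive t 1 (fun s => (A s)^T) dA^T.
Proof.
move=> Ad; apply: is_derive_mxP => i j; rewrite mxE.
have -> : (fun s => (A s)^T i j) = (fun s => A s j i) by apply/funext => s; rewrite mxE.
exact: is_derive_entry.
Qed.

Lemma is_derive_dot m (u v : R -> 'cV[R]_m) du dv (t : R) :
  is_derive t 1 u du -> is_derive t 1 v dv ->
  is_derive t 1 (fun s => dot (u s) (v s)) (dot du (v t) + dot (u t) dv).
Proof.
move=> ud vd; have := is_derive_entry ord0 ord0 (is_derive_mulmx (is_derive_tr ud) vd).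
by rewrite mxE.
Qed.

Lemma is_derive_dotr m (b : 'cV[R]_m) (u : R -> 'cV[R]_m) du (t : R) :
  is_derive t 1 u du -> is_derive t 1 (fun s => dot b (u s)) (dot b du).
Proof.
by move=> ud; have := is_derive_dot (is_derive_cst b t 1) ud; rewrite dot0l add0r.
Qed.

(** The Euclidean norm is not differentiable at 0, so the curve is projected onto its fixed total
    displacement [D] and the scalar function [dot D (x s) - nrm D * G s] is shown to be
    non-increasing. *)
Lemma nrm_mean_value m (x dx : R -> 'cV[R]_m) (G dG : R -> R) (a b : R) : a <= b ->
  (forall t, t \in `[a, b]%R -> is_derive t 1 x (dx t)) ->
  (forall t, t \in `[a, b]%R -> is_derive t 1 G (dG t)) ->
  (forall t, t \in `[a, b]%R -> nrm (dx t) <= dG t) ->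
  nrm (x b - x a) <= G b - G a.
Proof.
move=> ab xd Gd xG; pose D := x b - x a.
have Gab : 0 <= G b - G a.
  rewrite subr_ge0; apply: (nondecr_derive ab Gd) => t tab.
  exact: le_trans (nrm_ge0 _) (xG t tab).
have fd (t : R) : t \in `[a, b]%R ->
    is_derive t 1 (fun s => dot D (x s) - nrm D * G s) (dot D (dx t) - nrm D * dG t).
  move=> tab.
  have A1 := is_derive_dotr D (xd t tab).
  have A2 := @is_deriveZ R R R G (nrm D) t 1 _ (Gd t tab).
  exact: (is_deriveB A1 A2).
have := nonincr_derive ab fd _; rewrite lerBlDr => H.
have {H} : dot D D <= nrm D * (G b - G a).
  have := H _; rewrite {2}/D dotBr mulrBr; set X := dot D (x b); set Y := dot D (x a).
  move=> H1; rewrite lerBlDl; apply: le_trans (H1 _) _; last by lra.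
  move=> t tab; rewrite subr_le0; apply: le_trans (dot_le' _ _) _.
  by rewrite ler_wpM2l ?nrm_ge0// xG.
rewrite -nrm_sqr expr2; have [->//|D0] := eqVneq (nrm D) 0.
by rewrite ler_pM2l// lt0r D0 nrm_ge0.
Qed.

End Euclid.

(** * Ordinary differential equations *)

Lemma expR_ge1_ge0 (R : realType) (x : R) : (1 <= expR x) = (0 <= x).
Proof. by rewrite -[X in X <= _]expR0 ler_expR. Qed.

Section Gronwall.
Variables (R : realType) (m : nat).
Local Notation V := 'cV[R]_m.

Definition gron_const (L T : R) : R := m.+1%:R * expR (m.+1%:R * (2 * L + 1) * T).

Lemma gron_const_ge0 L T : 0 <= gron_const L T.
Proof. by rewrite mulr_ge0// expR_ge0. Qed.

(** The maximum norm is not differentiable, so the argument runs on the energy n^2 + c^2, with n the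
    Euclidean norm of u. For M = m + 1, the bound 2 n M (L n + c) <= M (2 L + 1) (n^2 + c^2) makes
    the energy times exp (- K s) non-increasing. Keeping c^2 in the energy absorbs the inhomogeneous
    term; the factors M convert between the two norms. *)
Lemma gronwall (u du : R -> V) (T L c t : R) : 0 <= L -> 0 <= c ->
  (forall s, s \in `[0, T]%R -> is_derive s 1 u (du s)) ->
  (forall s, s \in `[0, T]%R -> `|du s| <= L * `|u s| + c) ->
  t \in `[0, T]%R -> `|u t| <= gron_const L T * (`|u 0| + c).
Proof.
move=> L0 c0 ud dul; rewrite in_itv/= => /andP[t0 tT].
set M : R := m.+1%:R; pose K := M * (2 * L + 1).
have M1 : 1 <= M by rewrite ler1n.
have M0 : 0 <= M by [].
have K0 : 0 <= K by rewrite mulr_ge0// addr_ge0// mulr_ge0.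
have sT s : s \in `[0, t]%R -> s \in `[0, T]%R.
  by rewrite !in_itv/= => /andP[-> /le_trans->].
have dF (s : R) : s \in `[0, t]%R -> is_derive s 1
    ((fun s => dot (u s) (u s) + c ^+ 2) * (fun s => expR (- K * s)))
    ((dot (u s) (u s) + c ^+ 2) *: (- K * expR (- K * s)) +
     expR (- K * s) *: (dot (du s) (u s) + dot (u s) (du s))).
  move=> /sT/ud us; apply: is_deriveM; last exact: is_derive_expRM.
  have := is_deriveD (is_derive_dot us us) (is_derive_cst (c ^+ 2) s 1).
  by rewrite addr0.
have := nonincr_derive t0 dF _; rewrite !fctE/= mulr0 expR0 mulr1 mulNr expRN.
rewrite ler_pdivrMr ?expR_gt0// -!nrm_sqr => H.
have {}H : nrm (u t) ^+ 2 + c ^+ 2 <= (nrm (u 0) ^+ 2 + c ^+ 2) * expR (K * t).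
  apply: H => s /sT/dul; rewrite (dotC (du s)) -![_ *: _]/(_ * _) -nrm_sqr => dus.
  rewrite [X in X + _](_ : _ = expR (- K * s) * - (K * (nrm (u s) ^+ 2 + c ^+ 2))); last by ring.
  rewrite -mulrDr mulr_ge0_le0 ?expR_ge0// addrC subr_le0 -mulr2n -[leLHS]mulr_natl.
  have : dot (u s) (du s) <= nrm (u s) * (M * (L * nrm (u s) + c)).
    apply: le_trans (dot_le' _ _) _; rewrite ler_wpM2l ?nrm_ge0//.
    apply: le_trans (nrm_le_norm _) _; rewrite ler_wpM2l//; apply: le_trans dus _.
    by rewrite lerD2r ler_wpM2l// norm_le_nrm.
  have : 0 <= M * ((nrm (u s) - c) ^+ 2 + 2 * L * c ^+ 2).
    apply: mulr_ge0 => //; apply: addr_ge0; first exact: sqr_ge0.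
    by apply: mulr_ge0; [rewrite mulr_ge0|exact: sqr_ge0].
  by rewrite /K; move: (dot _ _) (nrm _) => p q; nra.
have E1 : 1 <= expR (K * T) by rewrite expR_ge1_ge0 mulr_ge0// (le_trans t0).
have c2 : 0 <= c ^+ 2 by exact: sqr_ge0.
rewrite -(@ler_pXn2r _ 2) ?nnegrE ?mulr_ge0 ?addr_ge0 ?expR_ge0// /gron_const -/M -/K.
apply: (@le_trans _ _ ((nrm (u 0) ^+ 2 + c ^+ 2) * expR (K * T))).
  apply: (@le_trans _ _ (nrm (u t) ^+ 2 + c ^+ 2)).
    by rewrite -[leLHS]addr0 lerD// lerXn2r ?nnegrE ?nrm_ge0// norm_le_nrm.
  apply: le_trans H _; rewrite ler_wpM2l ?addr_ge0 ?sqr_ge0//.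
  by rewrite ler_expR ler_wpM2l.
rewrite [M * expR _ * _]mulrAC [leRHS]exprMn.
apply: ler_pM; [by rewrite addr_ge0 ?sqr_ge0|exact: expR_ge0| |by rewrite ler_eXnr].
have H0 : nrm (u 0) <= M * `|u 0| by exact: nrm_le_norm.
apply: (@le_trans _ _ ((M * `|u 0|) ^+ 2 + (M * c) ^+ 2)).
  rewrite lerD// lerXn2r ?nnegrE ?nrm_ge0 ?mulr_ge0//.
  by rewrite ler_peMl.
rewrite mulrDr [leRHS]sqrrD -addrA [X in _ <= _ + X]addrC lerD2l lerDl.
by rewrite mulrn_wge0// !mulr_ge0.
Qed.

End Gronwall.

(** * Primitives of continuous curves *)

Section Primitive.
Variables (R : realType).

(** Integration starts at -T, so that 0 is an interior point and times of both signs are covered;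
    subtracting the value at 0 normalises the primitive. *)
Lemma primitive_itv (h : R -> R) (T : R) : continuous h -> 0 < T ->
  exists2 H : R -> R, H 0 = 0 & forall t : R, `|t| < T -> is_derive t 1 H (h t).
Proof.
move=> ch T0; pose mu := @lebesgue_measure R.
pose H0 x := (\int[mu]_(t in [set` `[(- T), x]]) h t)%R.
exists (fun x => H0 x - H0 0); first by rewrite subrr.
move=> t; rewrite ltr_norml => /andP[tl tr].
have ih : mu.-integrable `[(- T), T] (EFin \o h).
  apply: continuous_compact_integrable; first exact: segment_compact.
  exact: continuous_subspaceT.
have [dH eH] := @continuous_FTC1_closed R h (- T) t T tr ih tl (ch t).
rewrite -[h t]subr0; apply: (@is_deriveB R R R H0 (cst (H0 0)) t 1 (h t) 0).
have e2 : 'D_1 H0 t = h t by rewrite -derive1E.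
exact: (DeriveDef dH e2).
Qed.

Lemma primitive_exists (h : R -> R) : continuous h ->
  exists2 H : R -> R, H 0 = 0 & forall t : R, is_derive t 1 H (h t).
Proof.
move=> ch.
have /choice[P HP] : forall T : R, exists H : R -> R,
    0 < T -> H 0 = 0 /\ forall t : R, `|t| < T -> is_derive t 1 H (h t).
  move=> T; have [T0|T0] := ltP 0 T; last by exists (fun=> 0).
  by have [H H0 Hd] := primitive_itv ch T0; exists H.
have uniq (S T t : R) : 0 < S -> S <= T -> `|t| < S -> P S t = P T t.
  move=> S0 ST tS; have T0 := lt_le_trans S0 ST.
  have [PS0 PSd] := HP S S0; have [PT0 PTd] := HP T T0.
  have dd (s : R) : `|s| <= `|t| -> is_derive s 1 (P S - P T) 0.
    move=> st; rewrite -(subrr (h s)).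
    have A1 := PSd s (le_lt_trans st tS).
    have A2 := PTd s (lt_le_trans (le_lt_trans st tS) ST).
    exact: is_deriveB.
  have E0 : (P S - P T) 0 = 0 by rewrite !fctE PS0 PT0 subrr.
  apply/eqP; rewrite -subr_eq0 -[_ - _]/((P S - P T) t) -E0; apply/eqP.
  have [t0|t0] := leP 0 t.
    have dd0 s : s \in `[0, t]%R -> is_derive s 1 (P S - P T) 0.
      by rewrite in_itv/= => /andP[s0 st]; apply: dd; rewrite !ger0_norm.
    exact/esym/(const_derive t0 dd0).
  have dd0 s : s \in `[t, 0]%R -> is_derive s 1 (P S - P T) 0.
    rewrite in_itv/= => /andP[s0 st]; apply: dd.
    by rewrite !ler0_norm ?lerN2// ltW.
  exact: (const_derive (ltW t0) dd0).
(* Primitives on nested intervals agree on the smaller one, so near [t] this diagonal choice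
   coincides with the single primitive on the interval of radius |t| + 2. *)
exists (fun t => P (`|t| + 1) t) => [|t].
  by rewrite normr0 add0r; have [] := HP 1 ltr01.
have [t2 d2] : 0 < `|t| + 2 /\ is_derive t 1 (P (`|t| + 2)) (h t).
  have t2 : 0 < `|t| + 2 by rewrite ltr_wpDl.
  by split=> //; have [_] := HP _ t2; apply; rewrite ltrDl.
apply: near_eq_is_derive d2; near=> s.
have st : `|s| < `|t| + 1.
  rewrite -[s](subrK t); apply: le_lt_trans (ler_normD _ _) _; rewrite addrC ltrD2l distrC.
  by near: s; exact: nbhsx_ballx.
apply/esym/uniq; [by rewrite ltr_wpDl| |by rewrite ltrDl].
by rewrite (_ : 2 = 1 + 1)// addrA lerD2r ltW.
Unshelve. all: by end_near. Qed.

Lemma mx_primitive_exists p q (h : R -> 'M[R]_(p, q)) : continuous h ->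
  exists H : R -> 'M[R]_(p, q), H 0 = 0 /\ forall t : R, is_derive t 1 H (h t).
Proof.
move=> ch.
have /choice[P HP] : forall ij : 'I_p * 'I_q, exists H : R -> R,
    H 0 = 0 /\ forall t : R, is_derive t 1 H (h t ij.1 ij.2).
  move=> [i j]; have [|H H0 Hd] := @primitive_exists (fun t => h t i j).
    by move=> t; have /(continuous_mxP h) := ch t; apply.
  by exists H.
exists (fun t => \matrix_(i, j) P (i, j) t); split=> [|t].
  by apply/matrixP => i j; rewrite !mxE; case: (HP (i, j)).
apply: is_derive_mxP => i j.
have -> : (fun s => (\matrix_(i, j) P (i, j) s) i j) = P (i, j).
  by apply/funext => s; rewrite mxE.
by case: (HP (i, j)).
Qed.

Lemma mx_derive_compare p q (D dD : R -> 'M[R]_(p, q)) (G dG : R -> R) (a b : R) : a <= b ->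
  (forall s, s \in `[a, b]%R -> is_derive s 1 D (dD s)) ->
  (forall s, s \in `[a, b]%R -> is_derive s 1 G (dG s)) ->
  (forall s, s \in `[a, b]%R -> `|dD s| <= dG s) -> `|D b - D a| <= G b - G a.
Proof.
move=> ab Dd Gd DG; apply: mx_norm_le => [|i j].
  rewrite subr_ge0; apply: (nondecr_derive ab Gd) => s sI.
  exact: le_trans (DG s sI).
have := derive_compare ab (fun s sI => is_derive_entry i j (Dd s sI)) Gd.
rewrite !mxE; apply => s sI; exact: le_trans (mx_norm_ge _ i j) (DG s sI).
Qed.

Lemma mx_mean_value p q (D dD : R -> 'M[R]_(p, q)) (c : R) :
  (forall s : R, s \in `[0, 1]%R -> is_derive s 1 D (dD s)) ->
  (forall s : R, s \in `[0, 1]%R -> `|dD s| <= c) -> `|D 1 - D 0| <= c.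
Proof.
move=> Dd dDc.
have := mx_derive_compare ler01 Dd (fun s _ => is_derive_scale c s) dDc.
by rewrite mulr1 mulr0 subr0.
Qed.

End Primitive.

(** * Picard iteration *)

Section Picard.
Variables (R : realType) (m : nat).
Local Notation V := 'cV[R]_m.

Lemma le0_geometric (x M : R) : (forall k, x <= M / 2 ^+ k) -> x <= 0.
Proof.
move=> H; rewrite leNgt; apply/negP => x0.
have M0 : 0 < M by apply: lt_le_trans x0 _; have := H 0%N; rewrite expr0 divr1.
pose k := Num.Def.archi_bound (M / x).
have Hk : M / x < 2 ^+ k by exact: upper_nthrootP.
have := H k; rewrite leNgt => /negP; apply.
by rewrite ltr_pdivrMr ?exprn_gt0// mulrC -ltr_pdivrMr.
Qed.

(** The limit is chosen before the constant [C] is quantified, because [ode_exists] fixes one limit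
    for each time and then uses it with a different bound for every time interval containing it. *)
Lemma geometric_cauchy (u : nat -> V) :
  (exists C : R, forall k, `|u k.+1 - u k| <= C / 2 ^+ k) ->
  exists l : V, forall C : R, (forall k, `|u k.+1 - u k| <= C / 2 ^+ k) ->
    forall k, `|l - u k| <= 2 * C / 2 ^+ k.
Proof.
have tele (C : R) : (forall k, `|u k.+1 - u k| <= C / 2 ^+ k) ->
    forall p k, `|u (k + p)%N - u k| <= 2 * C / 2 ^+ k.
  move=> HC; have C0 : 0 <= C by have := HC 0%N; rewrite expr0 divr1; apply: le_trans.
  elim=> [|p IH] k; first by rewrite addn0 subrr normr0 divr_ge0 ?exprn_ge0// mulr_ge0.
  rewrite addnS -addSn -(subrKA (u k.+1)); apply: le_trans (ler_normD _ _) _.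
  apply: le_trans (lerD (IH k.+1) (HC k)) _.
  rewrite exprS invfM le_eqVlt; apply/orP; left; apply/eqP.
  have : (2 ^+ k : R) != 0 by rewrite expf_neq0.
  by move=> ?; field.
move=> [C HC]; have T := tele C HC.
have C0 : 0 <= C by have := HC 0%N; rewrite expr0 divr1; apply: le_trans.
have small (e : R) : 0 < e -> exists k, 2 * C / 2 ^+ k < e.
  move=> e0; exists (Num.Def.archi_bound (2 * C / e)).
  rewrite ltr_pdivrMr ?exprn_gt0// [e * _]mulrC -ltr_pdivrMr//.
  exact: upper_nthrootP.
have /cauchy_cvgP cu : cauchy (u @ \oo).
  apply: cauchy_exP => e e0; have [k Hk] := small e e0.
  exists (u k); exists k => // j /= kj.
  rewrite -ball_normE/= /ball_/= distrC -(subnKC kj).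
  exact: le_lt_trans (T _ _) Hk.
exists (lim (u @ \oo)) => D HD k.
apply/ler_addgt0Pr => e e0.
have /cvgrPdist_le/(_ e e0)[j _ Hj] := cu.
have := Hj (k + j)%N; rewrite /= leq_addl => /(_ isT) Hl.
rewrite -(subrKA (u (k + j)%N)); apply: le_trans (ler_normD _ _) _.
by rewrite addrC lerD// tele.
Qed.

(** The comparison function is exp (b |t|), which is smooth on either side of 0 but not across it;
    negative times therefore use the reflected exponential separately. *)
Lemma exp_compare (D dD : R -> V) (K b T : R) : 0 < b -> 0 <= K ->
  D 0 = 0 -> (forall t : R, is_derive t 1 D (dD t)) ->
  (forall t : R, `|t| <= T -> `|dD t| <= K * (b * expR (b * `|t|))) ->
  forall t, `|t| <= T -> `|D t| <= K * (expR (b * `|t|) - 1).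
Proof.
move=> b0 K0 D0 Dd dDK t tT.
have ed (c s : R) : is_derive s 1 (fun s : R => K * expR (c * s)) (K * (c * expR (c * s))).
  exact: (@is_deriveZ R R R _ K s 1 _ (is_derive_expRM c s)).
have [t0|t0] := leP 0 t.
  have := mx_derive_compare t0 (fun s _ => Dd s) (fun s _ => ed b s).
  rewrite D0 subr0 mulr0 expR0 -mulrBr (ger0_norm t0); apply => s.
  rewrite in_itv/= => /andP[s0 st]; rewrite -{2}(ger0_norm s0); apply: dDK.
  by rewrite ger0_norm//; apply: le_trans tT; rewrite ger0_norm.
have ed' (s : R) : is_derive s 1 (fun s : R => - (K * expR (- b * s))) (K * (b * expR (- b * s))).
  have := @is_deriveN R R R _ s 1 _ (ed (- b) s).
  by rewrite !mulNr mulrN opprK.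
have := mx_derive_compare (ltW t0) (fun s _ => Dd s) (fun s _ => ed' s).
rewrite D0 sub0r normrN mulr0 expR0 mulr1 opprK (ltr0_norm t0) mulrN -mulNr.
rewrite (_ : - K + _ = K * (expR (- b * t) - 1)); last by ring.
apply => s; rewrite in_itv/= => /andP[ts s0].
rewrite (_ : - b * s = b * `|s|); last by rewrite ler0_norm// mulrN mulNr.
apply: dDK; apply: le_trans tT; rewrite !ler0_norm ?lerN2// ltW//.
Qed.

(** The Lipschitz bound is global in space, so no solution escapes and the iteration converges on
    the whole line, although the constant may grow with the time interval. Continuity of [g] is
    asked only along continuous curves, which is what integrating an iterate uses. *)
Lemma ode_exists (g : R -> V -> V) (x0 : V) :
  (forall u : R -> V, continuous u -> continuous (fun t => g t (u t))) ->
  (forall T : R, exists L : R, forall (t : R) x y, `|t| <= T ->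
     `|g t x - g t y| <= L * `|x - y|) ->
  exists u : R -> V, u 0 = x0 /\ forall t : R, is_derive t 1 u (g t (u t)).
Proof.
move=> gc gl.
have /choice[P HP] : forall h : R -> V, exists H : R -> V, continuous h ->
    H 0 = 0 /\ forall t : R, is_derive t 1 H (h t).
  move=> h; have [ch|nch] := pselect (continuous h); last by exists h.
  by have [H HH] := mx_primitive_exists ch; exists H.
pose N (u : R -> V) := fun t => x0 + P (fun t => g t (u t)) t.
have N0 u : continuous u -> N u 0 = x0.
  by move=> cu; rewrite /N; have [-> _] := HP _ (gc u cu); rewrite addr0.
have Nd u (t : R) : continuous u -> is_derive t 1 (N u) (g t (u t)).
  move=> cu; have [_ /(_ t)] := HP _ (gc u cu).
  by move=> /(is_deriveD (is_derive_cst x0 t 1)); rewrite add0r.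
have Nc u : continuous u -> continuous (N u).
  by move=> cu t; apply: is_derive_continuous (Nd u t cu).
pose u := fix u k : R -> V := if k is k'.+1 then N (u k') else fun=> x0.
have uc k : continuous (u k).
  by elim: k => [|k IH]; [move=> t; exact: cvg_cst|exact: Nc].
have u0 k : u k 0 = x0 by case: k => [//|k]; exact: N0.
have diffd v w (t : R) : continuous v -> continuous w ->
    is_derive t 1 (N v - N w) (g t (v t) - g t (w t)).
  move=> cv cw; have A1 := Nd v t cv; have A2 := Nd w t cw; exact: is_deriveB.
(* On [-T, T] the iteration contracts the weighted norm sup e^{-2L|t|}|u t| by 1/2. *)
have bnd (T : R) : exists L C : R, [/\ 0 < L, 0 <= C,
    (forall (t : R) x y, `|t| <= T -> `|g t x - g t y| <= L * `|x - y|) &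
    forall k t, `|t| <= T -> `|u k.+1 t - u k t| <= C / 2 ^+ k * expR (2 * L * `|t|)].
  have [L0 HL0] := gl T; pose L := `|L0| + 1.
  have L1 : 0 < L by rewrite ltr_wpDl.
  have HL (t : R) x y : `|t| <= T -> `|g t x - g t y| <= L * `|x - y|.
    move=> tT; apply: le_trans (HL0 t x y tT) _; rewrite ler_wpM2r//.
    by apply: le_trans (ler_norm _) _; rewrite lerDl.
  have [C C0 HC] : exists2 C : R, 0 <= C & forall t, `|t| <= T -> `|u 1%N t - u 0%N t| <= C.
    have /compact_bounded[M [Mr HM]] : compact ((fun t => u 1%N t - u 0%N t) @` `[- T, T]).
      apply: continuous_compact; last exact: segment_compact.
      by apply: continuous_subspaceT => t; apply: cvgB; exact: uc.
    exists (`|M| + 1); first by rewrite addr_ge0.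
    move=> t tT; apply: HM; first by apply: le_lt_trans (ler_norm _) _; rewrite ltrDl.
    by exists t => //=; rewrite in_itv/= -ler_norml.
  have b0 : 0 < 2 * L by rewrite mulr_gt0.
  exists L, C; split=> //; elim=> [|k IH] t tT.
    rewrite expr0 divr1; apply: le_trans (HC t tT) _.
    by rewrite ler_peMr// expR_ge1_ge0 mulr_ge0// ltW.
  have K0 : 0 <= C / 2 ^+ k.+1 by rewrite divr_ge0// exprn_ge0.
  apply: (@le_trans _ _ (C / 2 ^+ k.+1 * (expR (2 * L * `|t|) - 1))); last first.
    by rewrite ler_wpM2l// gerBl.
  have := @exp_compare (N (u k.+1) - N (u k)) _ (C / 2 ^+ k.+1) (2 * L) T b0 K0 _ (fun t => diffd _ _ t (uc k.+1) (uc k)).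
  rewrite !fctE !N0// subrr => /(_ erefl); apply => // s sT.
  apply: le_trans (HL _ _ _ sT) _; apply: le_trans (ler_wpM2l (ltW L1) (IH s sT)) _.
  rewrite exprS invfM le_eqVlt; apply/orP; left; apply/eqP.
  by field.
have /choice[v Hv] : forall t : R, exists l, forall C : R,
    (forall k, `|u k.+1 t - u k t| <= C / 2 ^+ k) ->
    forall k, `|l - u k t| <= 2 * C / 2 ^+ k.
  move=> t; apply: geometric_cauchy.
  have [L [C [L0 C0 _ HC]]] := bnd `|t|.
  exists (C * expR (2 * L * `|t|)) => k.
  by rewrite mulrAC; exact: HC.
have unif (T : R) : exists L C : R, [/\ 0 < L, 0 <= C,
    (forall (t : R) x y, `|t| <= T -> `|g t x - g t y| <= L * `|x - y|) &
    forall k t, `|t| <= T -> `|v t - u k t| <= C / 2 ^+ k].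
  have [L [C [L0 C0 HL HC]]] := bnd T.
  exists L, (2 * (C * expR (2 * L * T))); split=> //.
    by rewrite !mulr_ge0// expR_ge0.
  move=> k t tT; apply: Hv => {}k; apply: le_trans (HC k t tT) _.
  rewrite mulrAC ler_wpM2r ?invr_ge0 ?exprn_ge0// ler_wpM2l// ler_expR.
  by rewrite ler_wpM2l// mulr_ge0// ltW.
have vc : continuous v.
  move=> t; apply/cvgrPdist_le => e e0.
  have [L [C [L0 C0 _ HC]]] := unif (`|t| + 1).
  have [k Hk] : exists k, C / 2 ^+ k <= e / 3.
    exists (Num.Def.archi_bound (C / (e / 3))).
    rewrite ler_pdivrMr ?exprn_gt0// mulrC -ler_pdivrMr ?divr_gt0//.
    exact/ltW/upper_nthrootP.
  have nb : \forall s \near t, `|t - s| <= 1.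
    by apply: filterS (nbhsx_ballx (t : R) 1 ltr01) => s; rewrite -ball_normE => /ltW.
  near=> s.
  have st : `|s| <= `|t| + 1.
    rewrite -[s](subrK t); apply: le_trans (ler_normD _ _) _; rewrite addrC lerD2l distrC.
    by near: s.
  have tt : `|t| <= `|t| + 1 by rewrite lerDl.
  have A1 := le_trans (HC k t tt) Hk.
  have A2 := le_trans (HC k s st) Hk; rewrite distrC in A2.
  have A3 : `|u k t - u k s| <= e / 3.
    by near: s; have /cvgrPdist_le := uc k t; apply; rewrite divr_gt0.
  rewrite -(subrKA (u k t)) -[u k t - v s](subrKA (u k s)).
  apply: le_trans (ler_normD _ _) _.
  have := lerD A1 (le_trans (ler_normD _ _) (lerD A3 A2)); move/le_trans; apply.
  by rewrite le_eqVlt; apply/orP; left; apply/eqP; field.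
suff E : v = N v by exists v; split=> [|t]; rewrite E; [exact: N0|rewrite -{2}E; exact: Nd].
apply/funext => t; apply/eqP; rewrite -subr_eq0 -normr_le0.
have [L [C [L0 C0 HL HC]]] := unif `|t|.
(* Both [v] and [N v] are compared with u (k + 1) = N (u k): each distance is bounded by a constant
   over 2^k, so [v] is a fixed point. *)
apply: (@le0_geometric _ (C + C * (expR (L * `|t|) - 1))) => k.
rewrite mulrDl -(subrKA (u k.+1 t)); apply: le_trans (ler_normD _ _) _.
apply: lerD.
  apply: le_trans (HC k.+1 t (lexx _)) _; rewrite ler_wpM2l// lef_pV2 ?posrE ?exprn_gt0//.
  by rewrite ler_eXn2l// ltr1n.
rewrite distrC [X in _ <= X]mulrAC.
have K0 : 0 <= C / 2 ^+ k by rewrite divr_ge0// exprn_ge0.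
have := @exp_compare (N v - N (u k)) _ (C / 2 ^+ k) L `|t| L0 K0 _ (fun t => diffd _ _ t vc (uc k)).
rewrite !fctE !N0// subrr => /(_ erefl); apply => // s sT.
apply: le_trans (HL _ _ _ sT) _; apply: le_trans (ler_wpM2l (ltW L0) (HC k s sT)) _.
rewrite [leLHS]mulrC ler_wpM2l// ler_peMr ?(ltW L0)// expR_ge1_ge0 mulr_ge0//.
exact: ltW.
Unshelve. all: by end_near. Qed.

End Picard.

(** * Smooth dependence on initial conditions *)

Lemma setT_continuous (R : realType) (V W : normedModType R) (f : V -> W) :
  continuous f <-> Ck_on 0 setT f.
Proof. by split=> [cf x _|cf x]; [exact: cf|apply: cf; rewrite inE]. Qed.

Lemma diff_criterion_ball (R : realType) (V W : normedModType R) (f : V -> W)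
    (l : {linear V -> W}) (x : V) : continuous l ->
  (forall e : R, 0 < e -> exists2 r : R, 0 < r &
     forall h, `|h| < r -> `|f (h + x) - f x - l h| <= e * `|h|) ->
  differentiable f x /\ 'd f x = l :> (V -> W).
Proof.
move=> cl H; apply: diff_criterion => // e e0; have [r r0 Hr] := H e e0.
by apply: filterS (@nbhs0_lt _ V r r0) => h; exact: Hr.
Qed.

Section Flow.
Variables (R : realType).

(** The third clause, a bound uniform over nearby starting points on a compact time interval, stands
    in for a global Lipschitz condition. It passes to the variational system in [flow_Ck], whose
    field is in general only locally Lipschitz. *)
Definition is_flow m (f : 'cV[R]_m -> 'cV[R]_m) (ga : R -> 'cV[R]_m -> 'cV[R]_m) :=
  [/\ forall x, ga 0 x = x,
      forall (t : R) x, is_derive t 1 (ga^~ x) (f (ga t x)) &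
      forall x (T : R), 0 <= T -> exists M r : R, 0 < r /\
        forall y (t : R), `|y - x| < r -> 0 <= t <= T -> `|ga t y| <= M].

(** * First-order dependence of a flow on its starting point *)

Section FlowDiff.
Variables (m : nat) (f : 'cV[R]_m -> 'cV[R]_m) (ga : R -> 'cV[R]_m -> 'cV[R]_m).
Hypotheses (f1 : Ck_on 1 setT f) (flow : is_flow f ga).
Local Notation V := 'cV[R]_m.

Let df x : differentiable f x.
Proof. exact: Ck_differentiable f1 I. Qed.

Lemma C1_lip_ball (M : R) : exists2 L : R, 0 <= L &
  (forall x, `|x| <= M -> forall h, `|'d f x h| <= L * `|h|) /\
  (forall x y, `|x| <= M -> `|y| <= M -> `|f y - f x| <= L * `|y - x|).
Proof.
have [L L0 HL] := C1_bounded_diff f1 (@cV_ball_compact R m 0 M).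
have HL' x : `|x| <= M -> forall h, `|'d f x h| <= L * `|h|.
  by move=> xM h; apply: HL; rewrite /= subr0.
exists L => //; split=> // x y xM yM.
apply: C1_lipschitz => // s /andP[s0 s1] h; apply: HL'.
rewrite (_ : x + s *: (y - x) = (1 - s) *: x + s *: y); last first.
  by rewrite scalerBr scalerBl scale1r addrA addrAC.
apply: le_trans (ler_normD _ _) _; rewrite !normrZ (ger0_norm s0).
rewrite ger0_norm ?subr_ge0//.
apply: (@le_trans _ _ ((1 - s) * M + s * M)).
  by rewrite lerD// ler_wpM2l// subr_ge0.
by rewrite -mulrDl subrK mul1r.
Qed.

Lemma flow_continuous x : continuous (ga^~ x).
Proof. by have [_ gd _] := flow => t; apply: is_derive_continuous (gd t x). Qed.

Lemma flow_lip x (T : R) : 0 <= T -> exists M r C : R, [/\ 0 < r, 0 <= C &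
  forall y (t : R), `|y - x| < r -> 0 <= t <= T ->
    `|ga t y| <= M /\ `|ga t y - ga t x| <= C * `|y - x|].
Proof.
move=> T0; have [g0 gd gb] := flow; have [M [r [r0 HM]]] := gb x T T0.
have [L L0 [_ HL]] := C1_lip_ball M.
exists M, r, (gron_const m L T); split=> //; first exact: gron_const_ge0.
move=> y t yr tT; split; first exact: HM.
have xr : `|x - x| < r by rewrite subrr normr0.
have Hd (s : R) : s \in `[0, T]%R -> is_derive s 1 (ga^~ y - ga^~ x) (f (ga s y) - f (ga s x)).
  by move=> _; have A1 := gd s y; have A2 := gd s x; exact: is_deriveB.
have HdL (s : R) : s \in `[0, T]%R ->
    `|f (ga s y) - f (ga s x)| <= L * `|(ga^~ y - ga^~ x) s| + 0.
  by rewrite in_itv/= addr0 => sT; apply: HL; exact: HM.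
have tT' : t \in `[0, T]%R by rewrite in_itv.
have := gronwall L0 (lexx 0) Hd HdL tT'.
by rewrite !fctE !g0 addr0.
Qed.

Lemma linear_ode x v : exists w : R -> V, w 0 = v /\
  forall t : R, is_derive t 1 w ('d f (ga t x) (w t)).
Proof.
have cJ : continuous (fun t => jac f (ga t x)).
  apply/setT_continuous; apply: (@Ck_compT _ _ _ _ _ _ _ _ (jac f)) => //.
    by apply: Ck_jac f1; exact: openT.
  by apply/setT_continuous; exact: flow_continuous.
have [||w [w0 wd]] := @ode_exists R m (fun t y => jac f (ga t x) *m y) v.
- move=> u cu; apply/setT_continuous; exact: Ck_mulmx.
- move=> T.
  have /compact_bounded[M [Mr HM]] : compact ((fun t => jac f (ga t x)) @` `[- T, T]).
    apply: continuous_compact; last exact: segment_compact.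
    exact: continuous_subspaceT.
  exists (m%:R * (`|M| + 1)) => t y z tT.
  rewrite -mulmxBr; apply: le_trans (mulmx_norm _ _) _.
  rewrite ler_wpM2r// ler_wpM2l//; apply: HM.
    by apply: le_lt_trans (ler_norm _) _; rewrite ltrDl.
  by exists t => //=; rewrite in_itv/= -ler_norml.
exists w; split=> // t; rewrite jacE//; exact: wd.
Qed.

Lemma linear_ode_bound x (T : R) : 0 <= T -> exists r C : R, [/\ 0 < r, 0 <= C &
  forall y (w : R -> V) (t : R), `|y - x| < r ->
    (forall t : R, is_derive t 1 w ('d f (ga t y) (w t))) ->
    0 <= t <= T -> `|w t| <= C * `|w 0|].
Proof.
move=> T0; have [M [r [C [r0 _ HM]]]] := flow_lip x T0.
have [L L0 [HL _]] := C1_lip_ball M.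
exists r, (gron_const m L T); split=> //; first exact: gron_const_ge0.
move=> y w t yr wd tT.
have HdL (s : R) : s \in `[0, T]%R -> `|'d f (ga s y) (w s)| <= L * `|w s| + 0.
  by rewrite in_itv/= addr0 => sT; apply: HL; have [] := HM y s yr sT.
have tT' : t \in `[0, T]%R by rewrite in_itv.
have := gronwall L0 (lexx 0) (fun s _ => wd s) HdL tT'.
by rewrite addr0.
Qed.

(** The error ga(h + x) - ga(x) - W h vanishes at time 0 and satisfies a linear differential
    inequality whose source is the remainder in the differentiability of [f], small compared with
    |h| uniformly along the trajectories. Gronwall's inequality then makes the error small compared
    with |h|. *)
Lemma flow_diff (W : R -> V -> V -> V) :
  (forall x v, W 0 x v = v) ->
  (forall x v (t : R), is_derive t 1 (fun s => W s x v) ('d f (ga t x) (W t x v))) ->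
  forall (t : R) x, 0 <= t ->
    differentiable (ga t) x /\ 'd (ga t) x = W t x :> (V -> V).
Proof.
move=> W0 Wd t x t0; have [g0 gd gb] := flow.
have tt : 0 <= t <= t by rewrite t0 lexx.
have [r1 [CW [r10 CW0 HW]]] := linear_ode_bound x t0.
(* Linearity is uniqueness for the linear equation: the linearity defect solves it and is 0 at time
   0. *)
have lW : linear (W t x).
  move=> a u v; apply/eqP; rewrite -subr_eq0 -normr_le0.
  have D (s : R) : is_derive s 1
     ((fun s => W s x (a *: u + v)) - (a \*: (fun s => W s x u) + (fun s => W s x v)))
     ('d f (ga s x) (((fun s => W s x (a *: u + v)) - (a \*: (fun s => W s x u) + (fun s => W s x v))) s)).
    have A1 := Wd x (a *: u + v) s; have A2 := Wd x u s; have A3 := Wd x v s.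
    rewrite !fctE linearB linearD linearZ.
    apply: is_deriveB; apply: is_deriveD; exact: is_deriveZ.
  have := HW x _ t _ D tt; rewrite subrr normr0 => /(_ r10).
  rewrite -[X in _ <= _ * `|X|]/(W 0 x (a *: u + v) - (a *: W 0 x u + W 0 x v)).
  by rewrite !W0 subrr normr0 mulr0.
pose lM := GRing.isLinear.Build _ _ _ _ _ lW.
pose l : {linear V -> V} := HB.pack (W t x) lM.
have cl : continuous l.
  apply/linear_bounded_continuous; apply/linear_boundedP.
  exists CW; split; first exact: num_real.
  move=> M CM y; apply: le_trans (HW x (fun s => W s x y) t _ (Wd x y) tt) _.
    by rewrite subrr normr0.
  by rewrite W0 ler_wpM2r// ltW.
apply: (@diff_criterion_ball _ _ _ (ga t) l x cl) => e e0.
have [M [r [C [r0 C0 HM]]]] := flow_lip x t0.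
have [L L0 [HL _]] := C1_lip_ball M.
pose G := gron_const m L t; have G0 : 0 <= G by exact: gron_const_ge0.
(* [C] is the Lipschitz constant of the flow near [x] and [G] the Gronwall factor, so this tolerance
   accumulates to at most e |h|; the added ones keep the denominator positive. *)
pose eta := e / ((G + 1) * (C + 1)).
have GC : 0 < (G + 1) * (C + 1) by rewrite mulr_gt0// ltr_wpDl.
have eta0 : 0 < eta by rewrite divr_gt0.
have /nbhs_ballP[d /= d0 Hd] := C1_uniform_diff f1 (@cV_ball_compact R m 0 M) eta0.
have dC : 0 < d / (C + 1) by rewrite divr_gt0// ltr_wpDl.
exists (Num.min r (d / (C + 1))); first by rewrite lt_min r0.
move=> h; rewrite lt_min => /andP[hr hd].
rewrite -[h in `|h|](addrK x) in hr.
rewrite ltr_pdivlMr ?ltr_wpDl// mulrC in hd.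
have xr : `|x - x| < r by rewrite subrr normr0.
pose u := (ga^~ (h + x) - ga^~ x) - (fun s => W s x h).
have ud (s : R) : s \in `[0, t]%R -> is_derive s 1 u
    ((f (ga s (h + x)) - f (ga s x)) - 'd f (ga s x) (W s x h)).
  move=> _; have A1 := gd s (h + x); have A2 := gd s x; have A3 := Wd x h s.
  by apply: is_deriveB; exact: is_deriveB.
have uL (s : R) : s \in `[0, t]%R ->
    `|(f (ga s (h + x)) - f (ga s x)) - 'd f (ga s x) (W s x h)|
      <= L * `|u s| + eta * (C + 1) * `|h|.
  rewrite in_itv/= => st.
  have [M1 M2] := HM (h + x) s hr st; have [M3 _] := HM x s xr st.
  rewrite addrK in M2; set k := ga s (h + x) - ga s x in M2.
  have -> : ga s (h + x) = ga s x + k by rewrite /k [RHS]addrC subrK.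
  rewrite (_ : _ - _ = (f (ga s x + k) - f (ga s x) - 'd f (ga s x) k) + 'd f (ga s x) (u s)); last first.
    have -> : u s = k - W s x h by [].
    by rewrite (linearB _ k) [RHS]addrA subrK.
  apply: le_trans (ler_normD _ _) _; rewrite addrC lerD//; first exact: HL.
  have kC : `|k| <= (C + 1) * `|h|.
    by apply: le_trans M2 _; rewrite ler_wpM2r// lerDl.
  apply: le_trans (Hd k _ (ga s x) _) _.
  - by rewrite -ball_normE/= /ball_/= sub0r normrN; exact: le_lt_trans kC hd.
  - by rewrite /= subr0.
  - by rewrite -mulrA ler_wpM2l// ltW.
have tT' : t \in `[0, t]%R by rewrite in_itv/= t0 lexx.
have C1 : 0 <= C + 1 by rewrite addr_ge0.
have c0 : 0 <= eta * (C + 1) * `|h| by rewrite mulr_ge0// mulr_ge0// ltW.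
have u0 : u 0 = 0 by rewrite /u !fctE !g0 W0 addrK subrr.
have := gronwall L0 c0 ud uL tT'; rewrite u0 normr0 add0r => H.
apply: le_trans H _; rewrite mulrA ler_wpM2r// -/G.
have -> : eta * (C + 1) = e / (G + 1).
  rewrite /eta; field; apply/andP; split; apply/lt0r_neq0; rewrite ltr_wpDl//.
rewrite mulrA ler_pdivrMr; last by rewrite ltr_wpDl.
by rewrite mulrC ler_wpM2l ?(ltW e0)// lerDl.
Qed.

Lemma flow_variation : exists W : R -> V -> V -> V,
  [/\ forall x v, W 0 x v = v,
      forall x v (t : R), is_derive t 1 (fun s => W s x v) ('d f (ga t x) (W t x v)) &
      forall (t : R) x, 0 <= t -> differentiable (ga t) x /\ 'd (ga t) x = W t x :> (V -> V)].
Proof.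
have /choice[w Hw] := fun p : V * V => linear_ode p.1 p.2.
have W0 x v : w (x, v) 0 = v by have [] := Hw (x, v).
have Wd x v (s : R) : is_derive s 1 (w (x, v)) ('d f (ga s x) (w (x, v) s)).
  by have [_] := Hw (x, v); apply.
by exists (fun t x v => w (x, v) t); split=> //; exact: flow_diff.
Qed.

End FlowDiff.

(* The directional derivative of a flow is a component of the flow of (f(x), Df(x) w), which allows induction on k. *)
Lemma flow_Ck k : forall m (f : 'cV[R]_m -> 'cV[R]_m) ga, Ck_on k.+1 setT f -> is_flow f ga ->
  forall t : R, 0 <= t -> Ck_on k setT (ga t).
Proof.
elim: k => [|k IH] m f ga cf flow t t0; have f1 : Ck_on 1 setT f by apply: Ck_le cf.
  have [W [_ _ dg]] := flow_variation f1 flow.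
  by apply/setT_continuous => x; have [dx _] := dg t x t0; exact: differentiable_continuous.
have [g0 gd gb] := flow; have [W [W0 Wd dg]] := flow_variation f1 flow.
have df x : differentiable f x by exact: Ck_differentiable f1 I.
pose F (p : 'cV[R]_(m + m)) := col_mx (f (usubmx p)) (jac f (usubmx p) *m dsubmx p).
pose Ga (s : R) (p : 'cV[R]_(m + m)) := col_mx (ga s (usubmx p)) (W s (usubmx p) (dsubmx p)).
have us : Ck_on k.+1 setT (fun p : 'cV[R]_(m + m) => usubmx p).
  by apply: Ck_usubmx => //; exact: Ck_id.
have ds : Ck_on k.+1 setT (fun p : 'cV[R]_(m + m) => dsubmx p).
  by apply: Ck_dsubmx => //; exact: Ck_id.
have cF : Ck_on k.+1 setT F.
  apply: Ck_col_mx => //.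
    apply: (@Ck_compT _ _ _ _ _ _ _ _ f) => //.
    exact: CkW.
  apply: Ck_mulmx => //.
  apply: (@Ck_compT _ _ _ _ _ _ _ _ (jac f)) => //.
  by apply: Ck_jac cf; exact: openT.
have fG : is_flow F Ga.
  split.
  - by move=> p; rewrite /Ga g0 W0 vsubmxK.
  - move=> s p; rewrite /F /Ga col_mxKu col_mxKd -jacE//.
    exact: is_derive_col_mx.
  - move=> p T T0; have [r1 [C [r10 C0 HC]]] := linear_ode_bound f1 flow (usubmx p) T0.
    have [M [r [r0 HM]]] := gb (usubmx p) T T0.
    exists (Num.max M (C * (`|p| + 1))), (Num.min 1 (Num.min r r1)).
    split; first by rewrite !lt_min ltr01 r0 r10.
    move=> y s; rewrite !lt_min => /and3P[y1 yr yr1] sT.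
    have un : `|usubmx y - usubmx p| <= `|y - p|.
      apply: mx_norm_le => // i j; rewrite !mxE.
      by have := mx_norm_ge (y - p) (lshift m i) j; rewrite !mxE.
    have dn : `|dsubmx y| <= `|p| + 1.
      apply: mx_norm_le => [|i j]; first by rewrite addr_ge0.
      rewrite !mxE; apply: le_trans (mx_norm_ge y _ j) _.
      rewrite -[y](subrK p); apply: le_trans (ler_normD _ _) _.
      by rewrite addrC lerD2l ltW.
    have H1 : `|ga s (usubmx y)| <= M by apply: HM => //; exact: le_lt_trans un yr.
    have H2 : `|W s (usubmx y) (dsubmx y)| <= C * (`|p| + 1).
      have := HC (usubmx y) (fun s => W s (usubmx y) (dsubmx y)) s (le_lt_trans un yr1) (Wd _ _) sT.
      by rewrite W0 => /le_trans; apply; rewrite ler_wpM2l.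
    apply: mx_norm_le => [|i j]; first by rewrite le_max orbC mulr_ge0// addr_ge0.
    rewrite /Ga le_max; case: (split_ordP i) => l ->.
      by rewrite col_mxEu (le_trans (mx_norm_ge _ _ _) H1).
    by rewrite col_mxEd (le_trans (mx_norm_ge _ _ _) H2) orbT.
split=> [x _|v]; first by have [] := dg t x t0.
have -> : 'D_v (ga t) = fun x => dsubmx (Ga t (col_mx x v)).
  apply/funext => x; have [d1 e1] := dg t x t0.
  by rewrite deriveE// e1 /Ga col_mxKu !col_mxKd.
apply: Ck_dsubmx => //.
apply: (@Ck_compT _ _ _ _ _ _ _ _ (Ga t)) => //.
  exact: IH cF fG t t0.
by apply: Ck_col_mx => //; [exact: Ck_id|exact: Ck_cst].
Qed.

End Flow.

(** * Global flows and parametric integrals *)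

Lemma continuous_compE (R : realType) (U V W : normedModType R) (f : U -> V) (g : V -> W) :
  continuous f -> continuous g -> continuous (fun x => g (f x)).
Proof. by move=> cf cg x; apply: continuous_comp; [exact: cf|exact: cg]. Qed.

Lemma is_derive_rev (R : realType) (W : normedModType R) (u : R -> W) du (t : R) :
  is_derive (- t) 1 u du -> is_derive t 1 (fun s : R => u (- s)) (- du).
Proof.
move=> [/derivable1_diffP du1 <-].
have dN : is_derive t 1 (fun s : R => - s) (- 1).
  exact: (@is_deriveN R R R id t 1 1 (is_derive_id _ _)).
have := @is_derive_along R R W u (fun s => - s) (-1) t dN du1.
by rewrite linearN -deriveE.
Qed.

Lemma ode_unique_ge0 (R : realType) m (f : 'cV[R]_m -> 'cV[R]_m) (L : R) (u v : R -> 'cV[R]_m) (t : R) :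
  0 <= L -> (forall x y, `|f x - f y| <= L * `|x - y|) -> 0 <= t -> u 0 = v 0 ->
  (forall s : R, is_derive s 1 u (f (u s))) -> (forall s : R, is_derive s 1 v (f (v s))) ->
  u t = v t.
Proof.
move=> L0 fL t0 uv ud vd.
have D (s : R) : s \in `[0, t]%R -> is_derive s 1 (u - v) (f (u s) - f (v s)).
  by move=> _; have A1 := ud s; have A2 := vd s; exact: is_deriveB.
have DL (s : R) : s \in `[0, t]%R -> `|f (u s) - f (v s)| <= L * `|(u - v) s| + 0.
  by move=> _; rewrite addr0; exact: fL.
have tt : t \in `[0, t]%R by rewrite in_itv/= t0 lexx.
have := gronwall L0 (lexx 0) D DL tt.
rewrite !fctE uv subrr normr0 addr0 mulr0 normr_le0 subr_eq0.
by move/eqP.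
Qed.

Section GlobalFlow.
Variables (R : realType) (m : nat) (f : 'cV[R]_m -> 'cV[R]_m) (L : R).
Local Notation V := 'cV[R]_m.
Hypotheses (f1 : Ck_on 1 setT f) (L0 : 0 <= L).
Hypothesis fL : forall x y, `|f x - f y| <= L * `|x - y|.

Lemma ode_unique (u v : R -> V) (t : R) : u 0 = v 0 ->
  (forall s : R, is_derive s 1 u (f (u s))) -> (forall s : R, is_derive s 1 v (f (v s))) ->
  u t = v t.
Proof.
move=> uv ud vd; have [t0|t0] := leP 0 t; first exact: (ode_unique_ge0 L0 fL t0).
have fL' x y : `|- f x - - f y| <= L * `|x - y|.
  by rewrite -opprD normrN; exact: fL.
have t0' : 0 <= - t by rewrite oppr_ge0 ltW.
have ud' (s : R) : is_derive s 1 (fun s : R => u (- s)) (- f (u (- s))).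
  exact: (is_derive_rev (ud (- s))).
have vd' (s : R) : is_derive s 1 (fun s : R => v (- s)) (- f (v (- s))).
  exact: (is_derive_rev (vd (- s))).
have := ode_unique_ge0 L0 fL' t0' _ ud' vd'.
by rewrite oppr0 opprK; apply.
Qed.

Lemma solution_is_flow (g : R -> V -> V) :
  (forall x, g 0 x = x) -> (forall (t : R) x, is_derive t 1 (g^~ x) (f (g t x))) ->
  is_flow f g.
Proof.
move=> g0 gd; split=> // x T T0.
have /compact_bounded[M [Mr HM]] : compact ((g^~ x) @` `[0, T]).
  apply: continuous_compact; last exact: segment_compact.
  by apply: continuous_subspaceT => s; exact: is_derive_continuous (gd s x).
exists (`|M| + 1 + gron_const m L T), 1; split=> // y t y1 tT.
have D (s : R) : s \in `[0, T]%R -> is_derive s 1 (g^~ y - g^~ x) (f (g s y) - f (g s x)).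
  by move=> _; have A1 := gd s y; have A2 := gd s x; exact: is_deriveB.
have DL (s : R) : s \in `[0, T]%R -> `|f (g s y) - f (g s x)| <= L * `|(g^~ y - g^~ x) s| + 0.
  by move=> _; rewrite addr0; exact: fL.
have tt : t \in `[0, T]%R by rewrite in_itv.
have := gronwall L0 (lexx 0) D DL tt.
rewrite !fctE !g0 addr0 => H.
rewrite -[g t y](subrK (g t x)) addrC; apply: le_trans (ler_normD _ _) _.
apply: lerD.
  apply: HM; first by apply: le_lt_trans (ler_norm _) _; rewrite ltrDl.
  by exists t => //=; rewrite in_itv.
apply: le_trans H _; rewrite -[leRHS]mulr1 ler_wpM2l ?gron_const_ge0//.
exact: ltW.
Qed.

Lemma flow_exists : exists g : R -> V -> V,
  is_flow f g /\ forall (t : R) x, g (- t) (g t x) = x.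
Proof.
have H x : exists u : R -> V, u 0 = x /\ forall t : R, is_derive t 1 u (f (u t)).
  apply: (@ode_exists R m (fun=> f) x).
    move=> u cu; apply/setT_continuous.
    apply: (@Ck_compT _ _ _ _ _ _ _ _ f) => //.
    exact: CkW.
  by move=> T; exists L => t y z _; exact: fL.
have /choice[g Hg] := H.
exists (fun t x => g x t); split.
  by apply: solution_is_flow => [x|t x]; have [] := Hg x.
move=> t x; set y := g x t.
(* The group law by uniqueness: the time-shifted trajectory of [x] also solves the autonomous
   equation and starts at [y]. *)
have -> : g y (- t) = (fun s => g x (s + t)) (- t).
  apply: (@ode_unique (g y) (fun s => g x (s + t)) (- t)) => [|s|s]; first by rewrite add0r; case: (Hg y).
    by case: (Hg y).
  have [_ /(_ (s + t)) [/derivable1_diffP d1 e1]] := Hg x.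
  have dS : is_derive s 1 (fun s : R => s + t) 1.
    have := @is_deriveD R R R id (cst t) s 1 1 0 (is_derive_id _ _) (is_derive_cst _ _ _).
    by rewrite addr0.
  have := @is_derive_along R R V (g x) (fun s => s + t) 1 s dS d1.
  by rewrite -deriveE// e1.
by rewrite addNr; case: (Hg x).
Qed.

End GlobalFlow.

(** [flow_Ck] covers non-negative times only; smoothness of the inverse of the time-one map is
    obtained by running the negated field forward. *)
Lemma flow_rev (R : realType) m (f : 'cV[R]_m -> 'cV[R]_m) (L : R) g : 0 <= L ->
  (forall x y, `|f x - f y| <= L * `|x - y|) ->
  is_flow f g -> is_flow (fun x => - f x) (fun t => g (- t)).
Proof.
move=> L0 fL [g0 gd _]; apply: (@solution_is_flow _ _ _ L) => //.
- by move=> x y; rewrite -opprD normrN; exact: fL.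
- by move=> x; rewrite oppr0 g0.
- by move=> t x; exact: is_derive_rev (gd _ _).
Qed.

(** * Smooth dependence of integrals on a parameter *)

Section ParamIntegral.
Variables (R : realType) (m q : nat).

(** A space-time point: with time prepended as a 1 by 1 block, a time-dependent field becomes
    autonomous, and joint smoothness in (s, x) is smoothness of one map of a vector. *)
Definition tpt (s : R) (x : 'cV[R]_m) : 'cV[R]_(1 + m) := col_mx s%:M x.

Lemma is_derive_tpt (x : 'cV[R]_m) (s : R) : is_derive s 1 (fun t => tpt t x) (tpt 1 0).
Proof.
have E1 : is_derive s 1 (fun t : R => t%:M : 'M[R]_1) 1%:M; last first.
  exact: is_derive_col_mx E1 (is_derive_cst x s 1).
apply: is_derive_mxP => i j; rewrite !ord1.
have -> : (fun s : R => (s%:M : 'M[R]_1) 0 0) = id by apply/funext => t; rewrite mxE eqxx mulr1n.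
by rewrite mxE eqxx mulr1n; exact: is_derive_id.
Qed.

Lemma tpt_line (t : R) (y w : 'cV[R]_m) (r : R) : tpt t y + r *: tpt 0 w = tpt t (y + r *: w).
Proof. by rewrite /tpt scale_col_mx add_col_mx raddf0 scaler0 addr0. Qed.

Let tpt_continuous x : continuous (tpt^~ x).
Proof. by move=> s; exact: is_derive_continuous (is_derive_tpt x s). Qed.

(** The integral over [0, 1] is exposed through its primitives in s, [H] for the integrand and [K]
    for its derivative in direction [v], so that later identities can be checked by differentiating
    in s. Smoothness is differentiation under the integral sign, iterated because each derivative is
    again such an integral. *)
Lemma param_integral (Phi : 'cV[R]_(1 + m) -> 'cV[R]_q) : (forall k, Ck_on k setT Phi) ->
  exists (I : 'cV[R]_m -> 'cV[R]_q)
    (H : 'cV[R]_m -> R -> 'cV[R]_q) (K : 'cV[R]_m -> 'cV[R]_m -> R -> 'cV[R]_q),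
  [/\ forall k, Ck_on k setT I,
      forall x, [/\ H x 0 = 0, H x 1 = I x &
        forall s : R, is_derive s 1 (H x) (Phi (tpt s x))] &
      forall x v, [/\ K x v 0 = 0, K x v 1 = 'D_v I x &
        forall s : R, is_derive s 1 (K x v) ('d Phi (tpt s x) (tpt 0 v))]].
Proof.
move=> cPhi.
have /choice[P HP] : forall h : R -> 'cV[R]_q, exists H : R -> 'cV[R]_q, continuous h ->
    H 0 = 0 /\ forall t : R, is_derive t 1 H (h t).
  move=> h; have [ch|nh] := pselect (continuous h); last by exists (fun=> 0).
  by have [H HH] := mx_primitive_exists ch; exists H.
pose I (F : 'cV[R]_(1 + m) -> 'cV[R]_q) x := P (fun s => F (tpt s x)) 1.
have PF (F : 'cV[R]_(1 + m) -> 'cV[R]_q) x : Ck_on 0 setT F ->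
    P (fun s => F (tpt s x)) 0 = 0 /\
    forall s : R, is_derive s 1 (P (fun s => F (tpt s x))) (F (tpt s x)).
  by move=> cF; apply: HP; apply: continuous_compE => //; exact/setT_continuous.
(* The candidate differential at [x] is the primitive [Q] of the spatial Jacobian. Uniform
   differentiability along the compact segment of points [tpt s x] bounds the integrand of the
   remainder by e |h|. *)
have main (F : 'cV[R]_(1 + m) -> 'cV[R]_q) x : Ck_on 1 setT F ->
    differentiable (I F) x /\ forall v, 'D_v (I F) x = I ('D_(tpt 0 v) F) x.
  move=> cF; have dF p : differentiable F p by exact: Ck_differentiable cF Logic.I.
  pose E : 'M[R]_(1 + m, m) := col_mx 0 1%:M.
  have EE h : E *m h = tpt 0 h by rewrite mul_col_mx mul0mx mul1mx /tpt raddf0.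
  have [|Q [Q0 Qd]] := @mx_primitive_exists _ _ _ (fun s => jac F (tpt s x) *m E).
    apply/setT_continuous; apply: Ck_mulmx => //; last exact: Ck_cst.
    apply/setT_continuous/continuous_compE => //.
    by apply/setT_continuous; exact: Ck_jac openT cF.
  have Qv v (s : R) : is_derive s 1 (fun s => Q s *m v) ('d F (tpt s x) (tpt 0 v)).
    by have := is_derive_mulmxr v (Qd s); rewrite -mulmxA EE -jacE.
  have cQ : continuous (mulmx (Q 1) : {linear 'cV[R]_m -> 'cV[R]_q}).
    by apply/setT_continuous; apply: (Ck_mulmxl (Q 1)) => //; exact: Ck_id.
  have [d e] : differentiable (I F) x /\ 'd (I F) x = mulmx (Q 1) :> ('cV[R]_m -> 'cV[R]_q).
    apply: (diff_criterion_ball cQ) => e e0.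
    have comp : compact ((tpt^~ x) @` `[0, 1]).
      by apply: continuous_compact; [exact: continuous_subspaceT|exact: segment_compact].
    have /nbhs_ballP[r /= r0 Hr] := C1_uniform_diff cF comp e0.
    exists r => // h hr.
    have th : `|tpt 0 h| <= `|h|.
      apply: mx_norm_le => // i j; case: (split_ordP i) => l ->.
        by rewrite col_mxEu !ord1 mxE mul0rn normr0.
      by rewrite col_mxEd; exact: mx_norm_ge.
    have [A0 Ad] := PF F (h + x) (CkW cF); have [B0 Bd] := PF F x (CkW cF).
    have D (s : R) : s \in `[0, 1]%R -> is_derive s 1
        (P (fun s => F (tpt s (h + x))) - P (fun s => F (tpt s x)) - (fun s => Q s *m h))
        (F (tpt s (h + x)) - F (tpt s x) - 'd F (tpt s x) (tpt 0 h)).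
      by move=> _; exact: is_deriveB (is_deriveB (Ad s) (Bd s)) (Qv h s).
    have := mx_mean_value (c := e * `|h|) D; rewrite !fctE A0 B0 Q0 mul0mx !subr0; apply => s sI.
    have -> : tpt s (h + x) = tpt s x + tpt 0 h.
      by rewrite /tpt add_col_mx raddf0 addr0 addrC.
    apply: (@le_trans _ _ (e * `|tpt 0 h|)); last by rewrite ler_wpM2l// ltW.
    apply: Hr; last by exists s.
    by rewrite -ball_normE/= /ball_/= sub0r normrN (le_lt_trans th).
  split=> // v; rewrite deriveE// e.
  have [C0 Cd] := PF ('D_(tpt 0 v) F) x (cF.2 _).
  have D (s : R) : s \in `[0, 1]%R -> is_derive s 1
      ((fun s => Q s *m v) - P (fun s => 'D_(tpt 0 v) F (tpt s x))) 0.
    by move=> _; have := is_deriveB (Qv v s) (Cd s); rewrite deriveE// subrr.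
  apply/eqP; rewrite -subr_eq0 -normr_le0.
  have := mx_mean_value (c := 0) D; rewrite !fctE C0 Q0 mul0mx !subr0; apply => s _.
  by rewrite normr0.
have cI k (F : 'cV[R]_(1 + m) -> 'cV[R]_q) : (forall k, Ck_on k setT F) -> Ck_on k setT (I F).
  elim: k F => [|k IH] F cF.
    by apply/setT_continuous => x; apply: differentiable_continuous; exact: (main F x (cF 1%N)).1.
  split=> [x _|v]; first exact: (main F x (cF 1%N)).1.
  rewrite (_ : 'D_v (I F) = I ('D_(tpt 0 v) F)); last first.
    by apply/funext => x; exact: (main F x (cF 1%N)).2.
  by apply: IH => l; exact: (cF l.+1).2.
exists (I Phi), (fun x => P (fun s => Phi (tpt s x))), (fun x v => P (fun s => 'D_(tpt 0 v) Phi (tpt s x))).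
split; first by move=> k; exact: cI.
  by move=> x; have [H0 Hd] := PF Phi x (cPhi 0%N).
move=> x v; have [K0 Kd] := PF ('D_(tpt 0 v) Phi) x ((cPhi 1%N).2 _).
rewrite (main Phi x (cPhi 1%N)).2; split=> // s.
have := Kd s; rewrite deriveE//; exact: Ck_differentiable (cPhi 1%N) Logic.I.
Qed.

End ParamIntegral.

(** * Inverse function theorem *)

Section InverseFunction.
Variables (R : realType).

Lemma inj_unitmx m (A : 'M[R]_m) : (forall v : 'cV[R]_m, A *m v = 0 -> v = 0) ->
  A \in unitmx.
Proof.
move=> Ai; rewrite -unitmx_tr -row_free_unit -kermx_eq0; apply/eqP/row_matrixP => i.
rewrite row0; apply: trmx_inj; rewrite trmx0; apply: Ai.
apply: trmx_inj; rewrite trmx_mul trmxK trmx0 -row_mul mulmx_ker.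
exact: row0.
Qed.

Variables (m : nat) (U : set 'cV[R]_m) (f : 'cV[R]_m -> 'cV[R]_m).
Local Notation V := 'cV[R]_m.
Hypotheses (oU : open U) (cf : Ck_on 1 U f).
Hypothesis df_inj : forall x, U x -> forall v, 'd f x v = 0 -> v = 0.
Hypothesis f_inj : forall x y, U x -> U y -> f x = f y -> x = y.

Let df x : U x -> differentiable f x.
Proof. by move=> Ux; exact: Ck_differentiable cf Ux. Qed.

Lemma jac_unit x : U x -> jac f x \in unitmx.
Proof.
move=> Ux; apply: inj_unitmx => v; rewrite -jacE; last exact: df.
exact: df_inj.
Qed.

Lemma open_ball_sub x : U x -> exists2 r : R, 0 < r & forall y, `|y - x| <= r -> U y.
Proof.
move=> Ux; have /nbhs_ballP[r /= r0 Hr] := open_nbhs_nbhs (conj oU Ux).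
exists (r / 2); first by rewrite divr_gt0.
move=> y yr; apply: Hr; rewrite -ball_normE/= /ball_/= distrC.
by apply: le_lt_trans yr _; rewrite ltr_pdivrMr// ltr_pMr// ltr1n.
Qed.

(** The distance from f z to [y] is minimised over a small closed ball. Injectivity keeps [f] at
    distance at least [mu] from f x on the sphere, so for [y] close to f x the minimum is interior;
    invertibility of the Jacobian there forces its value to be 0. *)
Lemma open_mapping_at x (r : R) : U x -> 0 < r -> exists2 d : R, 0 < d &
  forall y, `|y - f x| < d -> exists z, [/\ U z, `|z - x| < r & f z = y].
Proof.
move=> Ux r0; have [r1 r10 Hr1] := open_ball_sub Ux.
pose q := Num.min r r1 / 2.
have q0 : 0 < q by rewrite divr_gt0// lt_min r0.
have qm : q < Num.min r r1 by rewrite ltr_pdivrMr// ltr_pMr ?ltr1n// lt_min r0.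
have [qr qr1] : q < r /\ q < r1 by apply/andP; rewrite -lt_min.
have HU y : `|y - x| <= q -> U y by move=> yq; apply: Hr1; apply: le_trans yq (ltW qr1).
pose G y z := nrm (f z - y).
have Gc y z : U z -> {for z, continuous (G y)}.
  move=> Uz; have c1 : {in U, continuous (fun z => dot (f z - y) (f z - y))}.
    by apply: (Ck_dot (k := 0)) => //; apply: CkB => //; [exact: CkW|exact: Ck_cst|exact: CkW|exact: Ck_cst].
  have cz : {for z, continuous (fun z : V => dot (f z - y) (f z - y))} by apply: c1; rewrite inE.
  exact: (continuous_comp cz (@sqrt_continuous _ _)).
have Gw y (A : set V) : A `<=` U -> {within A, continuous (G y)}.
  move=> AU; apply: continuous_in_subspaceT => z; rewrite inE => Az.
  exact/Gc/AU.
pose Sp := [set z : V | `|z - x| = q].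
have [mu mu0 Hmu] : exists2 mu : R, 0 < mu & forall z, `|z - x| = q -> mu <= G (f x) z.
  (* In dimension 0 the sphere is empty and any positive [mu] will do. *)
  have [S0|/set0P/negP/negPn/eqP S0] := pselect (Sp !=set0); last first.
    by exists 1 => // z zq; have : Sp z by []; rewrite S0.
  have cSp : compact Sp.
    have clS : closed Sp.
      have -> : Sp = (fun z => `|z - x|) @^-1` [set s | s = q] by [].
      apply: closed_comp; last exact: closed_eq.
      move=> z _; apply: (@continuous_comp _ _ _ (fun z : V => z - x) (fun z => `|z|)).
        exact: (cvgB cvg_id (cvg_cst x)).
      exact: norm_continuous.
    apply: subclosed_compact clS (@cV_ball_compact R m x q) _ => z /= ->.
    exact: lexx.
  have SU : Sp `<=` U by move=> z zq; apply: HU; rewrite zq.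
  have [z0 z0S Hz0] := compact_EVT_min S0 cSp (Gw (f x) _ SU).
  exists (G (f x) z0); last by move=> z zq; apply: Hz0; rewrite inE.
  rewrite inE in z0S; rewrite lt0r nrm_ge0 andbT; apply/eqP => /nrm_eq0/eqP.
  rewrite subr_eq0 => /eqP E; have zx := f_inj (SU _ z0S) Ux E.
  by move: z0S q0; rewrite /Sp /= zx subrr normr0 => <-; rewrite ltxx.
exists (mu / 2 / m.+1%:R); first by rewrite !divr_gt0.
move=> y yd; have Gx : G y x < mu / 2.
  rewrite /G nrm_distC; apply: le_lt_trans (nrm_le_norm _) _.
  by rewrite mulrC -ltr_pdivlMr.
pose B := [set z : V | `|z - x| <= q].
have B0 : B !=set0 by exists x; rewrite /B /= subrr normr0 ltW.
have BU : B `<=` U by move=> z; exact: HU.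
have [z zB Hz] := compact_EVT_min B0 (@cV_ball_compact R m x q) (Gw y _ BU).
rewrite inE in zB.
have zq : `|z - x| < q.
  rewrite lt_neqAle zB andbT; apply/eqP => zS.
  have H1 : mu <= G (f x) z by exact: Hmu.
  have H2 : G y z <= G y x by apply: Hz; rewrite inE /B /= subrr normr0 ltW.
  have H3 : G (f x) z <= G y z + G y x.
    rewrite /G (_ : f z - f x = (f z - y) - (f x - y)); first exact: nrmB.
    by rewrite opprB addrA subrK.
  by have : mu < mu; [lra|rewrite ltxx].
exists z; split; [exact: BU|exact: lt_trans zq qr|].
apply/eqP; rewrite -subr_eq0; apply/eqP/dot_eq0.
set w := f z - y.
(* In this direction [f] moves along the residual [w], so the derivative of the squared distance is
   2 |w|^2, and it must vanish at the minimum. *)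
pose v := invmx (jac f z) *m w.
have Uz : U z by exact: BU.
have vE : 'd f z v = w by rewrite (jacE _ (df Uz)) mulmxA mulmxV ?mul1mx// jac_unit.
pose h (s : R) := dot (f (z + s *: v) - y) (f (z + s *: v) - y).
have [e e0 He] : exists2 e : R, 0 < e & forall s, `|s| < e -> `|z + s *: v - x| <= q.
  have v1 : 0 < `|v| + 1 by rewrite ltr_wpDl.
  exists ((q - `|z - x|) / (`|v| + 1)).
    by rewrite divr_gt0 ?subr_gt0.
  move=> s; rewrite ltr_pdivlMr// => Hs.
  rewrite -addrA [s *: v - x]addrC addrA; apply: le_trans (ler_normD _ _) _.
  rewrite normrZ -lerBrDl; apply: le_trans _ (ltW Hs).
  by rewrite ler_wpM2l// lerDl.
have hd (s : R) : `|s| < e -> is_derive s 1 h (2 * dot ('d f (z + s *: v) v) (f (z + s *: v) - y)).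
  move=> se; have Us : U (z + s *: v) by apply: HU; exact: He.
  have A1 : is_derive s 1 (fun s : R => f (z + s *: v)) ('d f (z + s *: v) v).
    by apply: is_derive_along; [exact: is_derive_line|exact: df].
  have A2 : is_derive s 1 (fun s : R => f (z + s *: v) - y) ('d f (z + s *: v) v).
    have := is_deriveB A1 (is_derive_cst y s 1).
    by rewrite subr0.
  have := is_derive_dot A2 A2.
  by rewrite [X in _ + X]dotC -mulr2n mulr_natl.
have eNe : - e < e by rewrite gtrN.
have in0 : (0 : R) \in `]- e, e[%R by rewrite in_itv/= oppr_lt0 e0.
have : is_derive (0 : R) 1 h 0.
  apply: (@derive1_at_min R h (- e) e 0 (ltW eNe)) => // [t|t].
    by rewrite in_itv/= -ltr_norml => /hd[].
  rewrite in_itv/= -ltr_norml => te.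
  have := Hz (z + t *: v); rewrite inE => /(_ (He t te)).
  rewrite /h scale0r addr0 -!nrm_sqr => H.
  by rewrite lerXn2r ?nnegrE ?nrm_ge0.
have e0' : `|0 : R| < e by rewrite normr0.
have [_ E1] := hd 0 e0'.
move=> [_]; rewrite E1 scale0r addr0 vE -/w => /eqP.
by rewrite mulf_eq0 pnatr_eq0/= => /eqP.
Qed.

Lemma image_open (O : set V) : open O -> O `<=` U -> open (f @` O).
Proof.
move=> oO OU; rewrite openE => _ [x Ox <-].
have Ux := OU x Ox.
have /nbhs_ballP[r /= r0 Hr] := open_nbhs_nbhs (conj oO Ox).
have [d d0 Hd] := open_mapping_at Ux r0.
apply/nbhs_ballP; exists d => // y; rewrite -ball_normE/= /ball_/= distrC => /Hd[z [Uz zr <-]].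
by exists z => //; apply: Hr; rewrite -ball_normE/= /ball_/= distrC.
Qed.

Variable g : V -> V.
Hypothesis gK : {in U, cancel f g}.

Let gfK x : U x -> g (f x) = x.
Proof. by move=> Ux; apply: gK; rewrite inE. Qed.

(** The open mapping property supplies, for each small [k], the increment [h] with f (x + h) = f x +
    k; the expansion of [f] in [h] is then solved for [h]. *)
Lemma inverse_diff x : U x -> differentiable g (f x) /\
  'd g (f x) = mulmx (invmx (jac f x)) :> (V -> V).
Proof.
move=> Ux; set B := invmx (jac f x).
have cB : continuous (mulmx B : {linear V -> V}).
  apply/setT_continuous; apply: (Ck_mulmxl B) => //; exact: Ck_id.
apply: (diff_criterion_ball cB) => e e0.
pose b := m%:R * `|B| + 1.
have b1 : 0 < b by rewrite ltr_wpDl// mulr_ge0.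
have Bb (k : V) : `|B *m k| <= b * `|k|.
  by apply: le_trans (mulmx_norm _ _) _; rewrite ler_wpM2r// lerDl.
(* The first bound gives b eta <= 1/2, whence |h| <= 2 b |k|; the second makes the resulting
   remainder b eta (2 b |k|) at most e |k|. *)
pose eta := Num.min (1 / (2 * b)) (e / (2 * b * b)).
have b2 : 0 < 2 * b by rewrite mulr_gt0.
have eta0 : 0 < eta by rewrite lt_min !divr_gt0// mulr_gt0.
have /nbhs_ballP[r /= r0 Hr] := diff_near (df Ux) eta0.
have [d d0 Hd] := open_mapping_at Ux r0.
exists d => // k kd; have [|z [Uz zr fz]] := Hd (k + f x); first by rewrite addrK.
rewrite -fz !gfK//.
set h := z - x; have zE : z = h + x by rewrite /h subrK.
have kE : k = f (h + x) - f x by rewrite -zE fz addrK.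
have Hh : `|k - 'd f x h| <= eta * `|h|.
  by rewrite kE; apply: Hr; rewrite -ball_normE/= /ball_/= sub0r normrN.
have hB : h - B *m k = - (B *m (k - 'd f x h)).
  rewrite mulmxBr (jacE _ (df Ux)) mulmxA mulVmx ?jac_unit// mul1mx opprB.
  by [].
have H1 : `|h - B *m k| <= b * eta * `|h|.
  rewrite hB normrN; apply: le_trans (Bb _) _.
  by rewrite -mulrA ler_wpM2l// ltW.
have be1 : b * eta <= 2^-1.
  apply: (@le_trans _ _ (b * (1 / (2 * b)))).
    by rewrite ler_wpM2l ?(ltW b1)// ge_min lexx.
  rewrite le_eqVlt; apply/orP; left; apply/eqP; field.
  by rewrite gt_eqF.
have H2 : `|h| <= 2 * b * `|k|.
  have : `|h| <= b * `|k| + 2^-1 * `|h|.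
    rewrite -{1}[h](subrK (B *m k)) addrC; apply: le_trans (ler_normD _ _) _.
    apply: lerD => //; apply: le_trans H1 _.
    by rewrite ler_wpM2r.
  rewrite -mulrA; set X := b * `|k|; set Y := `|h|; lra.
apply: le_trans H1 _; apply: (@le_trans _ _ (b * eta * (2 * b * `|k|))).
  by rewrite ler_wpM2l// mulr_ge0 ?ltW.
rewrite mulrA ler_wpM2r//; apply: (@le_trans _ _ (b * (e / (2 * b * b)) * (2 * b))).
  by rewrite ler_wpM2r ?(ltW b2)// ler_wpM2l ?(ltW b1)// ge_min lexx orbT.
rewrite le_eqVlt; apply/orP; left; apply/eqP; field.
by rewrite gt_eqF.
Qed.

(** Bootstrap: the derivative of [g] is the inverse of the Jacobian of [f] evaluated at [g], hence
    as regular as [g] itself, so each order yields the next. *)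
Lemma inverse_Ck k : (forall l, Ck_on l U f) -> Ck_on k (f @` U) g.
Proof.
move=> cfs; have oV : open (f @` U) by exact: image_open.
elim: k => [|k IH].
  move=> y; rewrite inE => -[x Ux <-].
  by have [dg _] := inverse_diff Ux; exact: differentiable_continuous.
split=> [_ [x Ux <-]|v]; first by have [] := inverse_diff Ux.
apply: (@Ck_eq _ _ _ _ _ (fun y => invmx (jac f (g y)) *m v)) => //.
  move=> y; rewrite inE => -[x Ux <-]; have [dg eg] := inverse_diff Ux.
  by rewrite deriveE// eg gfK.
apply: Ck_mulmx => //; last exact: Ck_cst.
apply: Ck_invmx => //.
  by move=> _ [x Ux <-]; rewrite gfK//; exact: jac_unit.
apply: (@Ck_comp _ _ _ _ _ _ _ U _ (jac f)) => //.
  by move=> _ [_ [x Ux <-] <-]; rewrite gfK.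
exact: Ck_jac.
Qed.

End InverseFunction.

(** * Smooth cutoff functions *)

Section Bump.
Variable R : realType.
Implicit Types (p : {poly R}).

(** The functions p(1/s) exp (-1/s), extended by 0, form a family closed under differentiation: [p]
    is replaced by X^2 (p - p'). One induction over the family proves the bump smooth. *)
Definition flat p (s : R) : R := if 0 < s then p.[s^-1] * expR (- s^-1) else 0.

Lemma horner_bound p : exists2 A : R, 0 <= A & forall x, 1 <= x -> `|p.[x]| <= A * x ^+ size p.
Proof.
exists (\sum_(i < size p) `|p`_i|); first by rewrite sumr_ge0.
move=> x x1; rewrite horner_coef mulr_suml; apply: le_trans (ler_norm_sum _ _ _) _.
apply: ler_sum => i _; rewrite normrM normrX ler_wpM2l// ger0_norm; last exact: le_trans x1.
by rewrite ler_weXn2l// ltnW.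
Qed.

(** With x = 1/s, the polynomial grows at most like x^d, while exp x dominates its Taylor term of
    order d + 2. The surplus s^2 is what makes the derivative at 0 exist and vanish. *)
Lemma flat_bound p : exists2 C : R, 0 <= C & forall s, `|s| <= 1 -> `|flat p s| <= C * `|s| ^+ 2.
Proof.
have [A A0 HA] := horner_bound p; pose d := size p.
exists (A * d.+2`!%:R); first by rewrite mulr_ge0.
move=> s s1; rewrite /flat; case: ifPn => s0; last by rewrite normr0 !mulr_ge0// exprn_ge0.
rewrite (gtr0_norm s0) in s1 *; set x := s^-1.
have x0 : 0 < x by rewrite invr_gt0.
have x1 : 1 <= x by rewrite invf_ge1.
have sx : s = x^-1 by rewrite invrK.
rewrite normrM (gtr0_norm (expR_gt0 _)) expRN.
have ex : x ^+ d.+2 / d.+2`!%:R <= expR x.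
  by apply: le_trans (expR_ge1Dxn d.+1 (ltW x0)); rewrite lerDr.
have F0 : 0 < d.+2`!%:R :> R by rewrite ltr0n fact_gt0.
have xd : 0 < x ^+ d.+2 / d.+2`!%:R by rewrite divr_gt0// exprn_gt0.
apply: (@le_trans _ _ (A * x ^+ d * (x ^+ d.+2 / d.+2`!%:R)^-1)).
  apply: ler_pM; [by []|by rewrite invr_ge0 expR_ge0|exact: HA|].
  by rewrite lef_pV2 ?posrE ?expR_gt0.
set F := d.+2`!%:R in F0 *; rewrite sx; clearbody x F.
rewrite 2!exprS le_eqVlt; apply/orP; left; apply/eqP.
have xd0 : x ^+ d != 0 by rewrite expf_neq0// gt_eqF.
field; rewrite (gt_eqF F0) (gt_eqF x0) xd0.
by [].
Qed.

Lemma is_derive_flat p (s : R) : is_derive s 1 (flat p) (flat ('X ^+ 2 * (p - p^`())) s).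
Proof.
have [s0|s0|s0] := ltgtP s 0.
- have -> : flat ('X ^+ 2 * (p - p^`())) s = 0 by rewrite /flat ltNge (ltW s0).
  apply: near_eq_is_derive (is_derive_cst (0 : R) s 1).
  near=> t; rewrite /flat ltNge; have -> // : t <= 0.
  by apply: ltW; near: t; exact: lt_nbhsl.
- pose h (t : R) := p.[t^-1] * expR (- t^-1).
  have hd : is_derive s 1 h (flat ('X ^+ 2 * (p - p^`())) s).
    have iV : is_derive s 1 (fun t : R => t^-1) (- s ^- 2).
      apply: DeriveDef; first by apply: (@derivableV R R id) => //; exact: lt0r_neq0.
      rewrite (@deriveV R R id)//; last exact: lt0r_neq0.
      by rewrite derive_id -[_ *: 1]/(_ * 1) mulr1.
    have iP := @is_derive1_comp R (horner p) (fun t => t^-1) s _ _ (is_derive_poly p _) iV.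
    have iN := @is_deriveN R R R _ s 1 _ iV.
    have iE := @is_derive1_comp R expR (fun t => - t^-1) s _ _ (is_derive_expR _) iN.
    have := is_deriveM iP iE.
    rewrite /flat s0 -![_ *: _]/(_ * _) !hornerE /=.
    congr (is_derive _ _ _ _).
    by rewrite exprVn; ring.
  apply: near_eq_is_derive hd; near=> t; rewrite /flat /h; have -> // : 0 < t.
  by near: t; exact: lt_nbhsr.
- have -> : flat ('X ^+ 2 * (p - p^`())) s = 0 by rewrite /flat s0 ltxx.
  have [C C0 HC] := flat_bound p.
  pose l := 'd (cst (0 : R)) s.
  have l0 (h : R) : l h = 0 by rewrite /l diff_cst.
  have cl : continuous l by apply: diff_continuous; exact: differentiable_cst.
  have [d e] : differentiable (flat p) s /\ 'd (flat p) s = l :> (R -> R).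
    apply: (diff_criterion_ball cl) => e e0.
    have C1 : 0 < C + 1 by rewrite ltr_wpDl.
    exists (Num.min 1 (e / (C + 1))); first by rewrite lt_min ltr01 divr_gt0.
    move=> t; rewrite lt_min => /andP[/ltW t1 te].
    rewrite s0 addr0 [flat p 0]/flat ltxx subr0 l0 subr0.
    apply: le_trans (HC t t1) _; rewrite expr2 mulrA ler_wpM2r//.
    rewrite ltr_pdivlMr// in te; apply: le_trans _ (ltW te).
    by rewrite mulrC ler_wpM2l// lerDl.
  by apply: DeriveDef; [exact: diff_derivable|rewrite deriveE// e l0].
Unshelve. all: by end_near. Qed.

Lemma Ck_flat k p : Ck_on k setT (flat p).
Proof.
have dflat q s : differentiable (flat q) s.
  by apply/derivable1_diffP; have [] := is_derive_flat q s.
elim: k p => [|k IH] p.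
  by apply/setT_continuous => s; exact: differentiable_continuous.
split=> [s _|v]; first exact: dflat.
have -> : 'D_v (flat p) = fun s => v * flat ('X ^+ 2 * (p - p^`())) s.
  apply/funext => s; have [_ <-] := is_derive_flat p s.
  rewrite !deriveE// -[RHS]/(v *: 'd (flat p) s 1) -linearZ.
  by congr ('d _ _ _); rewrite /GRing.scale/= mulr1.
by apply: CkM => //; exact: Ck_cst.
Qed.

Definition xi (s : R) : R := flat 1 s.

Lemma xiE s : xi s = if 0 < s then expR (- s^-1) else 0.
Proof. by rewrite /xi /flat hornerC mul1r. Qed.

Lemma Ck_xi k : Ck_on k setT xi.
Proof. exact: Ck_flat. Qed.

Lemma xi_ge0 s : 0 <= xi s.
Proof. by rewrite xiE; case: ifP => // _; exact: expR_ge0. Qed.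

Lemma xi_gt0 s : 0 < s -> 0 < xi s.
Proof. by move=> s0; rewrite xiE s0 expR_gt0. Qed.

Lemma xi_eq0 s : s <= 0 -> xi s = 0.
Proof. by move=> s0; rewrite xiE ltNge s0. Qed.

Lemma xi_nondecr s t : s <= t -> xi s <= xi t.
Proof.
move=> st; have [s0|s0] := leP s 0; first by rewrite xi_eq0// xi_ge0.
have t0 := lt_le_trans s0 st.
by rewrite !xiE s0 t0 ler_expR lerN2 lef_pV2.
Qed.

(** For a < b, a cutoff equal to 1 up to [a] and to 0 from [b] on; it is smooth because the two
    terms of the denominator never vanish together. *)
Definition step (a b s : R) : R := xi (b - s) / (xi (b - s) + xi (s - a)).

Section Step.
Variables (a b : R).
Hypothesis ab : a < b.

Lemma step_den s : 0 < xi (b - s) + xi (s - a).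
Proof.
have [sb|bs] := ltP s b; first by rewrite ltr_pwDl ?xi_ge0// xi_gt0// subr_gt0.
by rewrite ltr_wpDl ?xi_ge0// xi_gt0// subr_gt0 (lt_le_trans ab).
Qed.

Lemma Ck_step k : Ck_on k setT (step a b).
Proof.
have sub1 : Ck_on k setT (fun s : R => b - s).
  by apply: CkB => //; [exact: Ck_cst|exact: Ck_id].
have sub2 : Ck_on k setT (fun s : R => s - a).
  by apply: CkB => //; [exact: Ck_id|exact: Ck_cst].
have c1 : Ck_on k setT (fun s : R => xi (b - s)).
  by apply: (Ck_comp1 openT openT) => //; exact: Ck_xi.
have c2 : Ck_on k setT (fun s : R => xi (s - a)).
  by apply: (Ck_comp1 openT openT) => //; exact: Ck_xi.
apply: CkM => //.
apply: CkV; [exact: openT|by move=> s _; rewrite gt_eqF// step_den|].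
by apply: CkD => //.
Qed.

Lemma step_ge0 s : 0 <= step a b s.
Proof. by rewrite divr_ge0 ?xi_ge0// ltW ?step_den. Qed.

Lemma step_le1 s : step a b s <= 1.
Proof. by rewrite ler_pdivrMr ?step_den// mul1r lerDl xi_ge0. Qed.

Lemma step_eq1 s : s <= a -> step a b s = 1.
Proof.
move=> sa; have := step_den s; rewrite /step (@xi_eq0 (s - a)) ?subr_le0// addr0 => x0.
by rewrite divff// gt_eqF.
Qed.

Lemma step_eq0 s : b <= s -> step a b s = 0.
Proof. by move=> bs; rewrite /step xi_eq0 ?subr_le0// mul0r. Qed.

End Step.

End Bump.

(** * Closed two-forms *)

Lemma C1_compact_lipschitz (R : realType) m p (f : 'cV[R]_m -> 'cV[R]_p) (B : R) :
  Ck_on 1 setT f -> (forall x, B < `|x| -> f x = 0) ->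
  exists2 L : R, 0 <= L & forall x y, `|f x - f y| <= L * `|x - y|.
Proof.
move=> cf f0; have [L L0 HL] := C1_bounded_diff cf (@cV_ball_compact R m 0 B).
exists L => // x y; apply: C1_lipschitz => // s _ h; set z := y + _.
have [zB|zB] := leP `|z| B; first by apply: HL; rewrite /= subr0.
have dfz : differentiable f z by exact: Ck_differentiable cf I.
rewrite -deriveE//.
have oB : open [set w : 'cV[R]_m | B < `|w|].
  apply: (@open_comp _ _ (fun w : 'cV[R]_m => `|w|) [set r | B < r]); last exact: open_gt.
  by move=> w _; exact: norm_continuous.
have near0 : \forall w \near z, f w = cst 0 w.
  by apply: (open_near_eq oB) => // w; rewrite inE; exact: f0.
by rewrite (near_eq_derive _ near0) derive_cst normr0 mulr_ge0.
Qed.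

Lemma is_derive_dir (R : realType) (V W : normedModType R) (f : V -> W) (x v : V) :
  differentiable f x -> is_derive (0 : R) 1 (fun r : R => f (x + r *: v)) ('D_v f x).
Proof.
move=> df; have x0 : x + 0 *: v = x by rewrite scale0r addr0.
have := @is_derive_along R V W f (fun r : R => x + r *: v) v 0 (is_derive_line x v 0).
by rewrite x0 -deriveE//; exact.
Qed.

Lemma is_derive_curve (R : realType) (V W : normedModType R) (f : V -> W) (u : R -> V) du (t : R) :
  is_derive t 1 u du -> differentiable f (u t) ->
  is_derive t 1 (fun s => f (u s)) ('D_du f (u t)).
Proof. by move=> ud df; rewrite deriveE//; exact: is_derive_along. Qed.

Lemma is_derive_unique (R : realType) (W : normedModType R) (f : R -> W) a b (t : R) :
  is_derive t 1 f a -> is_derive t 1 f b -> a = b.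
Proof. by move=> [_ <-] [_ <-]. Qed.

Section Closed.
Variables (R : realType) (m : nat) (J : 'M[R]_m).
Hypothesis JT : J^T = - J.
Local Notation V := 'cV[R]_m.

Definition pull (f : V -> V) (y : V) : 'M[R]_m := (jac f y)^T *m J *m jac f y.

(** The cyclic sum is the exterior derivative, on constant fields a, b, c, of the two-form sending
    (b, c) to [dot b (S y *m c)]. *)
Definition closed_at (S : V -> 'M[R]_m) (y : V) := forall a b c : V,
  dot b ('D_a S y *m c) + dot c ('D_b S y *m a) + dot a ('D_c S y *m b) = 0.

Lemma dot_antisym (A : 'M[R]_m) u v : A^T = - A -> dot u (A *m v) = - dot v (A *m u).
Proof. by move=> AT; rewrite dot_mul AT mulNmx dotNl dotC. Qed.

Lemma pull_antisym f y : (pull f y)^T = - pull f y.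
Proof. by rewrite /pull !trmx_mul trmxK JT mulNmx mulmxN mulmxA. Qed.

Lemma dot_pull f y u v : dot u (pull f y *m v) = dot (jac f y *m u) (J *m (jac f y *m v)).
Proof. by rewrite /pull -!mulmxA dot_mul trmxK. Qed.

Lemma Ck_pull k U f : open U -> Ck_on k.+1 U f -> Ck_on k U (pull f).
Proof.
move=> oU cf; have cj := Ck_jac oU cf.
by apply: Ck_mulmx => //; apply: Ck_mulmx => //; [exact: Ck_tr|exact: Ck_cst].
Qed.

Lemma derive_sym_vec U (f : V -> V) y u v : open U -> U y -> Ck_on 2 U f ->
  'D_u ('D_v f) y = 'D_v ('D_u f) y.
Proof.
move=> oU Uy cf; have [df Df] := cf; apply/colP => i.
have dDf w z : U z -> derivable ('D_w f) z u /\ derivable ('D_w f) z v.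
  by move=> Uz; have [dd _] := Df w; split; apply: diff_derivable; exact: dd.
have e1 := derive_entry i ord0 (proj1 (dDf v y Uy)).
have e2 := derive_entry i ord0 (proj2 (dDf u y Uy)).
apply: (etrans e1); apply: (etrans _ (esym e2)).
have E w z : U z -> ('D_w f z) i ord0 = 'D_w (fun x => f x i ord0) z.
  by move=> Uz; rewrite derive_entry//; apply: diff_derivable; exact: df.
have nE w : \forall z \near y, ('D_w f z) i ord0 = 'D_w (fun x => f x i ord0) z.
  by apply: (open_near_eq oU Uy) => z; rewrite inE; exact: E.
rewrite (near_eq_derive _ (nE v)) (near_eq_derive _ (nE u)).
by apply: (derive_sym u v oU Uy); exact: Ck_entry.
Qed.

(** Differentiating the pairing of D_b f and D_c f in direction [a] gives two terms with second
    derivatives of [f]. In the cyclic sum the six terms cancel in pairs, by symmetry of second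
    derivatives and antisymmetry of [J]. *)
Lemma closed_pull U f y : open U -> Ck_on 2 U f -> U y -> closed_at (pull f) y.
Proof.
move=> oU cf Uy; have [df Df] := cf.
have dD w : differentiable ('D_w f) y by have [+ _] := Df w; apply.
have dP : differentiable (pull f) y by exact: Ck_differentiable (Ck_pull oU cf) Uy.
have E a b c : dot b ('D_a (pull f) y *m c) =
   dot ('D_a ('D_b f) y) (J *m 'D_c f y) + dot ('D_b f y) (J *m 'D_a ('D_c f) y).
  have x0 : y + 0 *: a = y by rewrite scale0r addr0.
  have D1 : is_derive (0 : R) 1 (fun r : R => dot b (pull f (y + r *: a) *m c))
      (dot b ('D_a (pull f) y *m c)).
    exact: is_derive_dotr (is_derive_mulmxr c (is_derive_dir a dP)).
  have A1 := is_derive_dir a (dD b).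
  have A2 := is_derive_mulmxl J (is_derive_dir a (dD c)).
  have := is_derive_dot A1 A2; rewrite x0 => D2.
  apply: (is_derive_unique D1); apply: near_eq_is_derive D2.
  have cl : {for (0 : R), continuous (fun r : R => y + r *: a)}.
    exact: is_derive_continuous (is_derive_line y a 0).
  have nU : nbhs (y + 0 *: a) U by rewrite x0; exact: (open_nbhs_nbhs (conj oU Uy)).
  have HU : \forall r \near (0 : R), U (y + r *: a) by exact: (cl U nU).
  apply: filterS HU => r Ur.
  by rewrite dot_pull !derive_jac//; exact: df.
have alg fa fb fc Hab Hbc Hca :
    dot Hab (J *m fc) + dot fb (J *m Hca) + (dot Hbc (J *m fa) + dot fc (J *m Hab))
      + (dot Hca (J *m fb) + dot fa (J *m Hbc)) = 0.
  have e1 := dot_antisym fb Hca JT; have e2 := dot_antisym fc Hab JT.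
  have e3 := dot_antisym fa Hbc JT; rewrite e1 e2 e3.
  by move: (dot _ _) (dot _ _) (dot _ _) => X Y Z; ring.
have [H [fd [Hs HE]]] : exists (H : V -> V -> V) (fd : V -> V),
    (forall x z, H x z = H z x) /\
    forall a b c, dot b ('D_a (pull f) y *m c) = dot (H a b) (J *m fd c) + dot (fd b) (J *m H a c).
  exists (fun x z => 'D_x ('D_z f) y), (fun z => 'D_z f y); split=> [x z|//].
  exact: derive_sym_vec oU Uy cf.
move=> a b c; rewrite (HE a b c) (HE b c a) (HE c a b) (Hs a c) (Hs b a) (Hs c b).
exact: alg.
Qed.

End Closed.

(** A bound comes before the equality: 0 <= z <= 1 keeps tau t between 0 and t, and in that range z
    is 1, so tau has unit speed. It identifies the time coordinate of the suspended flow. *)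
Lemma clock (R : realType) (tau z : R -> R) :
  (forall t : R, is_derive t 1 tau (z (tau t))) -> tau 0 = 0 ->
  (forall s, 0 <= z s <= 1) -> (forall s, 0 <= s <= 1 -> z s = 1) ->
  forall t, 0 <= t <= 1 -> tau t = t.
Proof.
move=> td t0 z01 z1.
have idd (s : R) : is_derive s 1 (fun t : R => t) 1 by exact: is_derive_id.
have H t : 0 <= t <= 1 -> 0 <= tau t <= t.
  move=> /andP[tp tl]; apply/andP; split.
    rewrite -t0; apply: (nondecr_derive tp (fun s _ => td s)) => s _.
    by case/andP: (z01 (tau s)).
  have := derive_compare tp (fun s _ => td s) (fun s _ => idd s) _.
  rewrite t0 !subr0 => H; apply: le_trans (ler_norm _) (H _) => s _.
  by case/andP: (z01 (tau s)) => z0 zl; rewrite ger0_norm.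
move=> t /andP[tp tl].
have dd (s : R) : s \in `[0, t]%R -> is_derive s 1 (fun s => tau s - s) 0.
  rewrite in_itv/= => /andP[sp sl].
  have s1 : 0 <= s <= 1 by rewrite sp (le_trans sl).
  have := is_deriveB (td s) (idd s).
  rewrite z1 ?subrr//; have /andP[-> ts] := H s s1.
  by rewrite (le_trans ts)//; case/andP: s1.
have := const_derive tp dd; rewrite t0 subr0 => /esym/eqP.
by rewrite subr_eq0 => /eqP.
Qed.

(** * Poincare lemma *)

Section Poincare.
Variables (R : realType) (m : nat) (e : R) (S : 'cV[R]_m -> 'M[R]_m) (G : set 'cV[R]_m).
Local Notation V := 'cV[R]_m.
Hypotheses (cS : forall k, Ck_on k setT S) (ST : forall y, (S y)^T = - S y).
Hypothesis Sb : forall y u v, `|dot u (S y *m v)| <= e * (nrm u * nrm v).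
Hypothesis starG : forall y (s : R), G y -> 0 <= s <= 1 -> G (s *: y).
Hypothesis clS : forall y, G y -> closed_at S y.

Let dS y : differentiable S y.
Proof. exact: Ck_differentiable (cS 1) I. Qed.

Lemma derive_antisym y v : ('D_v S y)^T = - 'D_v S y.
Proof.
have D := is_derive_dir v (dS y).
have D1 := is_derive_tr D; have D2 := @is_deriveN R R _ _ (0 : R) 1 _ D.
apply: (is_derive_unique D1).
have -> : (fun r : R => (S (y + r *: v))^T) = - (fun r : R => S (y + r *: v)).
  by apply/funext => r; rewrite ST.
exact: D2.
Qed.

(** The integrand - s S(s y) y of the radial homotopy formula, as a function of the space-time point
    (s, y). *)
Let Phi (p : 'cV[R]_(1 + m)) : V :=
  - (usubmx p ord0 ord0 *: (S (usubmx p ord0 ord0 *: dsubmx p) *m dsubmx p)).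

Let PhiE s x : Phi (tpt s x) = - (s *: (S (s *: x) *m x)).
Proof. by rewrite /Phi /tpt col_mxKu col_mxKd !mxE eqxx mulr1n. Qed.

Let cPhi k : Ck_on k setT Phi.
Proof.
have c1 : Ck_on k setT (fun p : 'cV[R]_(1 + m) => usubmx p ord0 ord0).
  by apply: Ck_entry; [exact: openT|apply: Ck_usubmx => //; exact: Ck_id].
have c2 : Ck_on k setT (fun p : 'cV[R]_(1 + m) => dsubmx p).
  by apply: Ck_dsubmx => //; exact: Ck_id.
apply: CkN => //.
apply: CkZ => //.
apply: Ck_mulmx => //.
apply: (@Ck_compT _ _ _ _ _ _ _ _ S) => //.
by apply: CkZ => //.
Qed.

Let PhiD s x v : 'd Phi (tpt s x) (tpt 0 v) =
  - (s *: (s *: ('D_v S (s *: x) *m x) + S (s *: x) *m v)).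
Proof.
have dPhi : differentiable Phi (tpt s x) by exact: Ck_differentiable (cPhi 1) I.
rewrite -deriveE//; apply: (is_derive_unique (is_derive_dir (tpt 0 v) dPhi)).
have -> : (fun r : R => Phi (tpt s x + r *: tpt 0 v)) =
          (fun r : R => - (s *: (S (s *: (x + r *: v)) *m (x + r *: v)))).
  by apply/funext => r; rewrite tpt_line PhiE.
have L := is_derive_line x v (0 : R).
have x0 : x + 0 *: v = x by rewrite scale0r addr0.
have L1 : is_derive (0 : R) 1 (fun r : R => s *: (x + r *: v)) (s *: v).
  exact: (@is_deriveZ R R _ (fun r : R => x + r *: v) s 0 1 v L).
have dSx : differentiable S (s *: (x + (0 : R) *: v)) by exact: dS.
have L2 := is_derive_curve L1 dSx.
have L3 := is_derive_mulmx L2 L.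
have L4 := @is_deriveN R R _ _ (0 : R) 1 _ (@is_deriveZ R R _ _ s (0 : R) 1 _ L3).
rewrite x0 in L4; move: L4.
have -> : 'D_(s *: v) S (s *: x) = s *: 'D_v S (s *: x).
  by rewrite !deriveE// linearZ.
by rewrite scalemxAl.
Qed.

(** The constant e / 2 is e times the integral of s over [0, 1]. The bound needs no closedness and
    holds everywhere; the primitive property is obtained on the star-shaped set [G], which contains
    the segment from 0 to each of its points. *)
Lemma poincare : exists lam : V -> V, [/\ forall k, Ck_on k setT lam,
  forall y v, `|dot v (lam y)| <= e / 2 * (nrm y * nrm v) &
  forall y u v, G y -> dot ('D_u lam y) v - dot ('D_v lam y) u = dot u (S y *m v)].
Proof.
have [lam [H [K [clam HH HK]]]] := param_integral cPhi.
exists lam; split=> // [y v|y u v Gy].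
  have [H0 H1 Hd] := HH y.
  have dd (s : R) : s \in `[0, 1]%R ->
      is_derive s 1 (fun s => dot v (H y s)) (dot v (Phi (tpt s y))).
    move=> _; exact: is_derive_dotr (Hd s).
  have gd (s : R) : s \in `[0, 1]%R ->
      is_derive s 1 (fun s : R => (e / 2 * (nrm y * nrm v)) * s ^+ 2) (e * (nrm y * nrm v) * s).
    move=> _; have X := @is_deriveX R R id 2 s 1 1 (is_derive_id _ _).
    have := @is_deriveZ R R R _ (e / 2 * (nrm y * nrm v)) s 1 _ X.
    rewrite -![_ *: _]/(_ * _) mulr1 expr1.
    have -> : e / 2 * (nrm y * nrm v) * (2 * s) = e * (nrm y * nrm v) * s by field.
    exact.
  have := derive_compare (@ler01 R) dd gd _.
  rewrite H0 H1 dot0r subr0 expr1n mulr1 expr0n/= mulr0 subr0; apply => s.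
  rewrite in_itv/= => /andP[s0 s1].
  rewrite PhiE dotNr normrN dotZr normrM (ger0_norm s0).
  rewrite mulrC ler_wpM2r//; apply: le_trans (Sb _ _ _) _.
  by rewrite [nrm v * _]mulrC.
have [Ku0 Ku1 Kud] := HK y u; have [Kv0 Kv1 Kvd] := HK y v.
(* [A] vanishes at s = 0, and [A 1] = 0 is the claim. After the antisymmetries are used, its
   derivative is a multiple, by s^2 up to sign, of the closedness relation at s y. *)
pose A s := dot (K y u s) v - dot (K y v s) u - s ^+ 2 * dot u (S (s *: y) *m v).
suff : A 0 = A 1.
  rewrite /A Ku0 Kv0 Ku1 Kv1 !dot0l expr0n/= mul0r !subr0 expr1n mul1r scale1r.
  by move=> /esym/eqP; rewrite subr_eq0 => /eqP.
have dA (s : R) : s \in `[0, 1]%R -> is_derive s 1 A 0.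
  rewrite in_itv/= => s01.
  have D1 := is_derive_dot (Kud s) (is_derive_cst v s 1).
  have D2 := is_derive_dot (Kvd s) (is_derive_cst u s 1).
  rewrite dot0r addr0 in D1; rewrite dot0r addr0 in D2.
  have Ls : is_derive s 1 (fun r : R => r *: y) y.
    have := is_derive_line 0 y s.
    by congr (is_derive _ _ _ _); apply/funext => r; rewrite add0r.
  have dSy : differentiable S (s *: y) by exact: dS.
  have D4 := is_derive_dotr u (is_derive_mulmxr v (is_derive_curve Ls dSy)).
  have X := @is_deriveX R R id 2 s 1 1 (is_derive_id _ _).
  have D5 := is_deriveM X D4.
  have D6 := is_deriveB (is_deriveB D1 D2) D5.
  have cl := clS (starG Gy s01) u v y.
  have aS : dot v (S (s *: y) *m u) = - dot u (S (s *: y) *m v) by rewrite (dot_antisym _ _ (ST _)).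
  have aD : dot u ('D_v S (s *: y) *m y) = - dot y ('D_v S (s *: y) *m u).
    by rewrite (dot_antisym _ _ (derive_antisym _ _)).
  have Eu w z : dot ('d Phi (tpt s y) (tpt 0 w)) z =
      - (s * (s * dot z ('D_w S (s *: y) *m y) + dot z (S (s *: y) *m w))).
    by rewrite PhiD dotNl dotZl dotDl dotZl (dotC (_ *m y)) (dotC (_ *m w)).
  have E : dot ('d Phi (tpt s y) (tpt 0 u)) v - dot ('d Phi (tpt s y) (tpt 0 v)) u -
      (s ^+ 2 * dot u ('D_y S (s *: y) *m v) + dot u (S (s *: y) *m v) * (2 * s ^+ 1 * 1)) = 0.
    rewrite Eu Eu aS aD; move: cl.
    move: (dot u (S (s *: y) *m v)) (dot u ('D_y S (s *: y) *m v)) (dot v _) (dot y _) => d c a b cl.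
    have -> : c = - a - b by apply/eqP; rewrite eq_sym -subr_eq0 -oppr_eq0 -cl; apply/eqP; ring.
    by rewrite expr1; ring.
  by rewrite -E; exact: D6.
exact: (const_derive ler01 dA).
Qed.

End Poincare.

(** * Moser's path method *)

Lemma Ck_scalar_mx (R : realType) (V : normedModType R) k (U : set V) p (a : V -> R) : open U ->
  Ck_on k U a -> Ck_on k U (fun x => (a x)%:M : 'M[R]_p).
Proof.
move=> oU ca; apply/Ck_mxP => // i j.
rewrite (_ : (fun y => _) = fun y => a y *+ (i == j)); last by apply/funext => y; rewrite mxE.
by case: (i == j); [exact: ca|exact: Ck_cst].
Qed.

(** Cartan's formula in coordinates. Here [a], [b] are two variations of a trajectory, [La], [Lb]
    the derivatives of the primitive along them, and the matrices [P], [S] with suffix those of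
    [pull J N] and [S]. Closedness turns the transport of the form along [X] into the exterior
    derivative of the primitive, which cancels the time derivative [S0]. *)
Lemma moser_cancel (R : realType) m (a b X La Lb : 'cV[R]_m)
    (Pa Pb PX Sa Sb SX S0 : 'M[R]_m) (t : R) :
  dot a (Pb *m X) = - dot X (Pb *m a) -> dot a (Sb *m X) = - dot X (Sb *m a) ->
  dot La b - dot Lb a = dot a (S0 *m b) ->
  dot b (Pa *m X) + dot X (Pb *m a) + dot a (PX *m b) = 0 ->
  dot b (Sa *m X) + dot X (Sb *m a) + dot a (SX *m b) = 0 ->
  0 = - dot (La - (Pa + t *: Sa) *m X) b +
      dot a ((PX + (S0 + t *: SX)) *m b + (Lb - (Pb + t *: Sb) *m X)).
Proof.
move=> aP aS dl cP cS.
rewrite !(mulmxDl, dotDl, dotDr, dotNl, dotNr) -!scalemxAl !(dotZl, dotZr).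
rewrite (dotC (Pa *m X)) (dotC (Sa *m X)) (dotC a Lb) aP aS.
by move: (congr1 ( *%R t) cS) cP dl; rewrite mulr0; lra.
Qed.

Section Moser.
Variables (R : realType) (m : nat) (J : 'M[R]_m) (e B : R).
Variables (S : 'cV[R]_m -> 'M[R]_m) (N : 'cV[R]_m -> 'cV[R]_m) (chi : 'cV[R]_m -> R).
Variable (G : set 'cV[R]_m).
Local Notation V := 'cV[R]_m.
Hypotheses (JT : J^T = - J) (JJ : J^T *m J = 1%:M) (e0 : 0 <= e) (e1 : e < 1).
Hypotheses (cS : forall k, Ck_on k setT S) (ST : forall y, (S y)^T = - S y).
Hypothesis Sb : forall y u v, `|dot u (S y *m v)| <= e * (nrm u * nrm v).
Hypotheses (cN : forall k, Ck_on k setT N).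
Hypothesis Nexp : forall y v, nrm v <= nrm (jac N y *m v).
Hypotheses (cchi : forall k, Ck_on k setT chi) (chi01 : forall y, 0 <= chi y <= 1).
Hypotheses (chiG : forall y, G y -> chi y = 1) (chi_supp : forall y, B < `|y| -> chi y = 0).
Hypotheses (oG : open G) (starG : forall y (s : R), G y -> 0 <= s <= 1 -> G (s *: y)).
Hypothesis clS : forall y, G y -> closed_at S y.

Let nrmJ v : nrm (J *m v) = nrm v.
Proof. by rewrite /nrm dot_mul mulmxA JJ mul1mx. Qed.

Let dS y : differentiable S y.
Proof. exact: Ck_differentiable (cS 1) I. Qed.

Let dN y : differentiable N y.
Proof. exact: Ck_differentiable (cN 1) I. Qed.

Let cP k : Ck_on k setT (pull J N).
Proof. by apply: Ck_pull => //; exact: cN. Qed.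

Let dP y : differentiable (pull J N) y.
Proof. exact: Ck_differentiable (cP 1) I. Qed.

Lemma expanding_unit y : jac N y \in unitmx.
Proof.
apply: inj_unitmx => v Nv; apply: nrm_eq0; apply/eqP.
by rewrite eq_le nrm_ge0 andbT; apply: le_trans (Nexp y v) _; rewrite Nv nrm0.
Qed.

Definition Om (t : R) (y : V) : 'M[R]_m := pull J N y + t *: S y.

(* Testing Om t y z against the u with N' u = J (N' z) controls |N' z|. *)
Lemma Om_coercive (t c : R) y z : 0 <= c ->
  (forall u, dot u (Om t y *m z) <= c * nrm u) ->
  (1 - `|t| * e) * nrm (jac N y *m z) <= c.
Proof.
move=> c0 Hc; set w := jac N y *m z.
have [w0|w0] := eqVneq (nrm w) 0; first by rewrite w0 mulr0.
have wp : 0 < nrm w by rewrite lt0r w0 nrm_ge0.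
pose u := invmx (jac N y) *m (J *m w).
have Nu : jac N y *m u = J *m w by rewrite mulmxA mulmxV ?mul1mx// expanding_unit.
have un : nrm u <= nrm w by apply: le_trans (Nexp y u) _; rewrite Nu nrmJ.
have zn : nrm z <= nrm w by exact: Nexp.
have := Hc u; rewrite mulmxDl dotDr dot_pull Nu -/w -nrm_sqr nrmJ.
rewrite -scalemxAl dotZr => H1.
have H2 : `|t * dot u (S y *m z)| <= `|t| * e * nrm w ^+ 2.
  rewrite normrM -mulrA ler_wpM2l//; apply: le_trans (Sb y u z) _.
  by rewrite ler_wpM2l// expr2 ler_pM// nrm_ge0.
have H3 : c * nrm u <= c * nrm w by rewrite ler_wpM2l.
have : (1 - `|t| * e) * nrm w * nrm w <= c * nrm w.
  move: H2; rewrite ler_norml => /andP[H2 _].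
  rewrite -mulrA -expr2 mulrBl mul1r; move: H1 H2 H3.
  set a := t * _; set b := `|t| * e * _; set d := c * nrm u; lra.
by rewrite ler_pM2r.
Qed.

Lemma Om_unit t y : `|t| * e < 1 -> Om t y \in unitmx.
Proof.
move=> te; apply: inj_unitmx => z Oz; apply: nrm_eq0; apply/eqP.
rewrite eq_le nrm_ge0 andbT; apply: le_trans (Nexp y z) _.
have := @Om_coercive t 0 y z (lexx 0); rewrite Oz => H.
have {}H : (1 - `|t| * e) * nrm (jac N y *m z) <= 0.
  by apply: H => u; rewrite dot0r mul0r.
by rewrite pmulr_rle0 // subr_gt0 in H.
Qed.

Lemma Om_antisym t y : (Om t y)^T = - Om t y.
Proof. by rewrite /Om linearD linearZ /= pull_antisym// ST scalerN opprD. Qed.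

Let is_derive_Om_dir t y w :
  is_derive (0 : R) 1 (fun r : R => Om t (y + r *: w)) ('D_w (pull J N) y + t *: 'D_w S y).
Proof.
apply: is_deriveD; first exact: is_derive_dir.
by apply: is_deriveZ; exact: is_derive_dir.
Qed.

(** For e > 0 this is the harmonic mean of 1 and e^(-2), so that 1 < bz and bz e^2 < 1: the time
    cutoff ends after t = 1 but before the form can degenerate at |t| e = 1. *)
Let bz : R := 2 / (1 + e ^+ 2).

Let bz_gt1 : 1 < bz.
Proof.
have E : 0 < 1 + e ^+ 2 by rewrite ltr_pwDl// sqr_ge0.
rewrite /bz ltr_pdivlMr// mul1r.
have : e ^+ 2 < 1 by rewrite expr_lt1.
by move=> H; lra.
Qed.

Let bz_e : bz * e ^+ 2 < 1.
Proof.
have E : 0 < 1 + e ^+ 2 by rewrite ltr_pwDl// sqr_ge0.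
rewrite /bz mulrAC ltr_pdivrMr// mul1r.
have : e ^+ 2 < 1 by rewrite expr_lt1.
by move=> H; lra.
Qed.

(* Time cutoff: it makes the suspended autonomous field [field] compactly supported, hence complete. *)
Definition zeta (t : R) : R := step 1 bz (t ^+ 2).

Let zeta01 t : 0 <= zeta t <= 1.
Proof. by rewrite step_ge0// step_le1. Qed.

Let zeta1 t : 0 <= t <= 1 -> zeta t = 1.
Proof.
by move=> /andP[t0 t1]; rewrite /zeta step_eq1// expr_le1.
Qed.

Let zeta0 t : bz <= t ^+ 2 -> zeta t = 0.
Proof. by move=> H; rewrite /zeta step_eq0. Qed.

Let zeta_out t : bz < `|t| -> zeta t = 0.
Proof.
move=> tb; apply: zeta0; rewrite -real_normK ?num_real// expr2; have t1 := lt_trans bz_gt1 tb.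
by apply/ltW/(lt_trans tb); rewrite ltr_pMr// (lt_trans ltr01 t1).
Qed.

Let Ck_zeta k (W : normedModType R) (U : set W) (f : W -> R) : open U -> Ck_on k U f ->
  Ck_on k U (fun x => zeta (f x)).
Proof.
move=> oU cf; apply: (Ck_comp1 (g := step 1 bz) oU openT) => //.
  exact: Ck_step.
exact: Ck_exp.
Qed.

Section Field.
Variable lam : V -> V.
Hypotheses (clam : forall k, Ck_on k setT lam).
Hypothesis lamb : forall y v, `|dot v (lam y)| <= e / 2 * (nrm y * nrm v).
Hypothesis dlam : forall y u v, G y ->
  dot ('D_u lam y) v - dot ('D_v lam y) u = dot u (S y *m v).

Let time (p : 'cV[R]_(1 + m)) : R := usubmx p ord0 ord0.
Let spc (p : 'cV[R]_(1 + m)) : V := dsubmx p.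

Let timeE t y : time (tpt t y) = t.
Proof. by rewrite /time /tpt col_mxKu mxE eqxx mulr1n. Qed.

Let spcE t y : spc (tpt t y) = y.
Proof. by rewrite /spc /tpt col_mxKd. Qed.

Let tpt_eta p : tpt (time p) (spc p) = p.
Proof.
rewrite /tpt /time /spc -[RHS]vsubmxK; congr col_mx.
by apply/matrixP => i j; rewrite !ord1 mxE eqxx mulr1n.
Qed.

Let c_time k U : Ck_on k U time.
Proof.
apply: (@Ck_sub _ _ _ _ _ setT) => //.
by apply: Ck_entry; [exact: openT|apply: Ck_usubmx => //; exact: Ck_id].
Qed.

Let c_spc k U : Ck_on k U spc.
Proof.
apply: (@Ck_sub _ _ _ _ _ setT) => //.
by apply: Ck_dsubmx => //; exact: Ck_id.
Qed.

Definition vel (p : 'cV[R]_(1 + m)) : V :=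
  (zeta (time p) * chi (spc p)) *: (invmx (Om (time p) (spc p)) *m lam (spc p)).

Definition field (p : 'cV[R]_(1 + m)) : 'cV[R]_(1 + m) := tpt (zeta (time p)) (vel p).

Let c_comp k p q (U : set 'cV[R]_(1 + m)) (f : V -> 'M[R]_(p, q)) : open U -> (forall k, Ck_on k setT f) ->
  Ck_on k U (fun p => f (spc p)).
Proof.
by move=> oU cf; apply: (@Ck_compT _ _ _ _ _ _ _ _ f).
Qed.

(** Two open sets cover space-time: where t^2 e^2 < 1 the form is invertible, and where t^2 > bz the
    time cutoff kills the field, whatever [invmx] returns there. *)
Lemma Ck_vel k : Ck_on k setT vel.
Proof.
pose U1 := [set p | time p ^+ 2 * e ^+ 2 < 1].
pose U2 := [set p | bz < time p ^+ 2].
have ct : continuous (fun p => time p ^+ 2).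
  by apply/setT_continuous; apply: Ck_exp => //; exact: c_time.
have ct2 : continuous (fun p => time p ^+ 2 * e ^+ 2).
  by apply/setT_continuous; apply: CkM; [exact: openT|exact/setT_continuous|exact: Ck_cst].
have oU1 : open U1.
  apply: (@open_comp _ _ (fun p => time p ^+ 2 * e ^+ 2) [set r | r < 1]); last exact: open_lt.
  by move=> p _; exact: ct2.
have oU2 : open U2.
  apply: (@open_comp _ _ (fun p => time p ^+ 2) [set r | bz < r]); last exact: open_gt.
  by move=> p _; exact: ct.
apply: (@Ck_sub _ _ _ _ _ (U1 `|` U2)).
  move=> p _; have [H|H] := ltP bz (time p ^+ 2); first by right.
  left; apply: le_lt_trans _ bz_e; rewrite ler_wpM2r// sqr_ge0.
  by [].
apply: CkU.
  apply: CkZ => //.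
    apply: CkM => //; first by apply: Ck_zeta => //; exact: c_time.
    apply: (@Ck_comp_scalar _ _ _ _ _ setT spc chi) => //.
  apply: Ck_mulmx => //; last exact: c_comp.
  apply: Ck_invmx => //.
    move=> p; rewrite /U1 /= => H; apply: Om_unit.
    rewrite -(@ltr_pXn2r _ 2) ?nnegrE ?mulr_ge0// exprMn expr1n.
    by rewrite real_normK ?num_real.
  apply: CkD => //; first exact: c_comp.
  by apply: CkZ => //; exact: c_comp.
apply: (@Ck_eq _ _ _ _ _ (fun=> 0)) => //; last exact: Ck_cst.
by move=> p; rewrite inE /U2 /= => H; rewrite /vel zeta0 ?(ltW H)// mul0r scale0r.
Qed.

Lemma Ck_field k : Ck_on k setT field.
Proof.
apply: Ck_col_mx => //; last exact: Ck_vel.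
apply: Ck_scalar_mx => //.
by apply: Ck_zeta => //; exact: c_time.
Qed.

(** The two blocks are treated separately: the velocity vanishes outside a bounded region of
    space-time, whereas the clock component depends on time alone and does not decay in space. *)
Lemma field_lipschitz : exists2 L : R, 0 <= L & forall x y, `|field x - field y| <= L * `|x - y|.
Proof.
have [L1 L10 HL1] : exists2 L : R, 0 <= L &
    forall x y, `|vel x - vel y| <= L * `|x - y|.
  apply: (@C1_compact_lipschitz _ _ _ _ (Num.max B bz) (Ck_vel 1)) => p.
  rewrite gt_max => /andP[pB pbz].
  have [yB|yB] := ltP B `|spc p|; first by rewrite /vel chi_supp// mulr0 scale0r.
  rewrite /vel zeta_out ?mul0r ?scale0r// ltNge; apply/negP => tb.
  have : `|p| <= Num.max B bz.
    rewrite -[p]tpt_eta; apply: mx_norm_le => [|i j].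
      by rewrite le_max (ltW (lt_trans ltr01 bz_gt1)) orbT.
    rewrite /tpt; case: (split_ordP i) => l ->.
      by rewrite col_mxEu !ord1 mxE eqxx mulr1n le_max tb orbT.
    by rewrite col_mxEd le_max (le_trans (mx_norm_ge _ _ _) yB).
  by rewrite leNgt gt_max pB pbz.
have [L2 L20 HL2] : exists2 L : R, 0 <= L &
    forall x y : 'cV[R]_1, `|(zeta (x ord0 ord0))%:M - (zeta (y ord0 ord0))%:M : 'cV[R]_1| <= L * `|x - y|.
  apply: (@C1_compact_lipschitz _ _ _ (fun x : 'cV[R]_1 => (zeta (x ord0 ord0))%:M : 'cV[R]_1) bz).
    apply: Ck_scalar_mx => //.
    by apply: Ck_zeta; [exact: openT|apply: Ck_entry => //; exact: Ck_id].
  move=> x xb; rewrite zeta_out ?raddf0// ltNge; apply/negP => tb; have : `|x| <= bz.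
    apply: mx_norm_le => [|i j]; first exact: ltW (lt_trans ltr01 bz_gt1).
    by rewrite !ord1.
  by rewrite leNgt xb.
exists (Num.max L1 L2); first by rewrite le_max L10.
move=> x y; apply: mx_norm_le => [|i j]; first by rewrite mulr_ge0// le_max L10.
rewrite /field /tpt opp_col_mx add_col_mx; case: (split_ordP i) => l ->.
  rewrite col_mxEu; apply: le_trans (mx_norm_ge _ _ _) _.
  apply: le_trans (HL2 (usubmx x) (usubmx y)) _; apply: ler_pM => //.
    by rewrite le_max lexx orbT.
  apply: mx_norm_le => // a b; rewrite !mxE.
  by have := mx_norm_ge (x - y) (lshift m a) b; rewrite !mxE.
rewrite col_mxEd; apply: le_trans (mx_norm_ge _ _ _) _.
by apply: le_trans (HL1 x y) _; rewrite ler_wpM2r// le_max lexx.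
Qed.

Let dF p : differentiable field p.
Proof. exact: Ck_differentiable (Ck_field 1) I. Qed.

Let dlam_ y : differentiable lam y.
Proof. exact: Ck_differentiable (clam 1) I. Qed.

Let dvel p : differentiable vel p.
Proof. exact: Ck_differentiable (Ck_vel 1) I. Qed.

(* The derivative of the identity Om t X = lam in a spatial direction. *)
Lemma vel_dir (t : R) y w : 0 <= t <= 1 -> G y ->
  Om t y *m 'D_(tpt 0 w) vel (tpt t y) =
    'D_w lam y - ('D_w (pull J N) y + t *: 'D_w S y) *m vel (tpt t y).
Proof.
move=> t01 Gy.
have te : `|t| * e < 1.
  have /andP[t0 t1] := t01; rewrite ger0_norm//.
  by apply: le_lt_trans e1; rewrite ler_piMl.
have D1 : is_derive (0 : R) 1 (fun r : R => vel (tpt t (y + r *: w))) ('D_(tpt 0 w) vel (tpt t y)).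
  have := is_derive_dir (tpt 0 w) (dvel (tpt t y)).
  by rewrite (_ : (fun r : R => vel (tpt t y + r *: tpt 0 w)) = (fun r : R => vel (tpt t (y + r *: w))))//;
     apply/funext => r; rewrite tpt_line.
have D2 := is_derive_mulmx (is_derive_Om_dir t y w) D1.
have D3 := is_derive_dir w (dlam_ y).
rewrite scale0r addr0 in D2.
apply/eqP; rewrite eq_sym subr_eq addrC; apply/eqP.
apply: (is_derive_unique D3); apply: near_eq_is_derive D2.
have cl : {for (0 : R), continuous (fun r : R => y + r *: w)}.
  exact: is_derive_continuous (is_derive_line y w 0).
have nG : nbhs (y + 0 *: w) G by rewrite scale0r addr0; exact: (open_nbhs_nbhs (conj oG Gy)).
have HG : \forall r \near (0 : R), G (y + r *: w) by exact: (cl G nG).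
apply: filterS HG => r Gr.
rewrite /vel timeE spcE zeta1// chiG// mulr1 scale1r mulmxA mulmxV ?mul1mx//.
exact: Om_unit.
Qed.

Variable ga : R -> 'cV[R]_(1 + m) -> 'cV[R]_(1 + m).
Hypotheses (flow : is_flow field ga) (gaK : forall t x, ga (- t) (ga t x) = x).

Let ga0 p : ga 0 p = p. Proof. by have [-> _ _] := flow. Qed.

Let gad (t : R) p : is_derive t 1 (ga^~ p) (field (ga t p)).
Proof. by have [_ + _] := flow; apply. Qed.

Let is_derive_time (u : R -> 'cV[R]_(1 + m)) du (t : R) :
  is_derive t 1 u du -> is_derive t 1 (fun s => time (u s)) (time du).
Proof.
move=> ud; have -> : (fun s => time (u s)) = (fun s => u s (lshift m ord0) ord0).
  by apply/funext => s; rewrite /time mxE.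
by rewrite /time mxE; exact: is_derive_entry.
Qed.

Let is_derive_spc (u : R -> 'cV[R]_(1 + m)) du (t : R) :
  is_derive t 1 u du -> is_derive t 1 (fun s => spc (u s)) (spc du).
Proof.
move=> ud; apply: is_derive_mxP => i j.
have -> : (fun s => spc (u s) i j) = (fun s => u s (rshift 1 i) j).
  by apply/funext => s; rewrite /spc mxE.
by rewrite /spc mxE; exact: is_derive_entry.
Qed.

Lemma flow_time (t : R) y : 0 <= t <= 1 -> time (ga t (tpt 0 y)) = t.
Proof.
have D (s : R) : is_derive s 1 (fun s => time (ga s (tpt 0 y))) (zeta (time (ga s (tpt 0 y)))).
  by have := is_derive_time (gad s (tpt 0 y)); rewrite /field timeE.
apply: (@clock R (fun s => time (ga s (tpt 0 y))) zeta D) => //.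
by rewrite ga0 timeE.
Qed.

Lemma flow_time_back y : time (ga (-1) (tpt 1 y)) = 0.
Proof.
have H : 1 - time (ga (-1) (tpt 1 y)) = 1.
  apply: (@clock R (fun s => 1 - time (ga (- s) (tpt 1 y))) (fun s => zeta (1 - s))) => //.
  - move=> s; have D := is_derive_rev (is_derive_time (gad (- s) (tpt 1 y))).
    have := is_deriveB (is_derive_cst (1 : R) s 1) D.
    by rewrite sub0r opprK /field timeE subKr.
  - by rewrite oppr0 ga0 timeE subrr.
  - by move=> s /andP[s0 s1]; rewrite zeta1// subr_ge0 s1 gerBl.
  - by rewrite ler01 lexx.
by move: H; set T := time _ => H; lra.
Qed.

Definition psi y := spc (ga 1 (tpt 0 y)).
Definition psi' y := spc (ga (-1) (tpt 1 y)).

Let psiE y : ga 1 (tpt 0 y) = tpt 1 (psi y).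
Proof.
have h : time (ga 1 (tpt 0 y)) = 1 by apply: flow_time; rewrite ler01 lexx.
by rewrite -[LHS]tpt_eta h.
Qed.

Let psi'E y : ga (-1) (tpt 1 y) = tpt 0 (psi' y).
Proof. by rewrite /psi' -{1}(flow_time_back y) tpt_eta. Qed.

Lemma psiK : cancel psi psi'.
Proof. by move=> y; rewrite /psi' -psiE gaK spcE. Qed.

Lemma psi'K : cancel psi' psi.
Proof. by move=> y; rewrite /psi -psi'E -{1}(opprK 1) gaK spcE. Qed.

Let c_tpt k (t : R) : Ck_on k setT (fun y : V => tpt t y).
Proof. by apply: Ck_col_mx => //; [exact: Ck_cst|exact: Ck_id]. Qed.

Let c_ga k (t : R) : 0 <= t -> Ck_on k setT (ga t).
Proof. exact: flow_Ck (Ck_field k.+1) flow t. Qed.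

Lemma Ck_psi k : Ck_on k setT psi.
Proof.
apply: Ck_dsubmx => //.
apply: (@Ck_compT _ _ _ _ _ _ _ _ (ga 1)) => //.
exact: c_ga ler01.
Qed.

Lemma Ck_psi' k : Ck_on k setT psi'.
Proof.
have [L L0 HL] := field_lipschitz.
have flow' := flow_rev L0 HL flow.
apply: Ck_dsubmx => //.
apply: (@Ck_compT _ _ _ _ _ _ _ _ (ga (-1))) => //.
apply: (flow_Ck _ flow' ler01); apply: CkN => //; exact: Ck_field.
Qed.

Definition path y (t : R) := spc (ga t (tpt 0 y)).

Let pathE y (t : R) : 0 <= t <= 1 -> ga t (tpt 0 y) = tpt t (path y t).
Proof. by move=> t01; rewrite -{2}(flow_time y t01) tpt_eta. Qed.

Lemma path_derive y (t : R) : 0 <= t <= 1 -> is_derive t 1 (path y) (vel (tpt t (path y t))).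
Proof.
move=> t01; have := is_derive_spc (gad t (tpt 0 y)).
by rewrite /field spcE -pathE.
Qed.

(** [Om_coercive] is applied to the solution of Om X = lam, with the Poincare bound on lam as
    constant. It controls the derivative of N along the path, not merely the velocity of the
    path. *)
Lemma path_speed y (t : R) : 0 <= t <= 1 ->
  nrm (jac N (path y t) *m vel (tpt t (path y t))) * (1 - t * e) <=
    chi (path y t) * (e / 2 * nrm (path y t)).
Proof.
move=> t01; set z := path y t; have /andP[t0 t1] := t01.
have te : `|t| * e < 1.
  by rewrite ger0_norm//; apply: le_lt_trans e1; rewrite ler_piMl.
have /andP[c0 c1] := chi01 z.
rewrite /vel timeE spcE zeta1// mul1r -scalemxAr nrmZ (ger0_norm c0) -[leLHS]mulrA ler_wpM2l//.
rewrite mulrC -{1}(ger0_norm t0).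
apply: Om_coercive => [|u]; first by rewrite mulr_ge0 ?nrm_ge0// divr_ge0.
rewrite mulmxA mulmxV ?Om_unit// mul1mx; apply: le_trans (ler_norm _) _.
by apply: le_trans (lamb z u) _; rewrite mulrA.
Qed.

(** The derivative of the space-time flow in its starting point solves the linearised equation. Its
    time component vanishes on [0, 1], because there the clock reads t for every start at time 0;
    hence only spatial derivatives of [vel] remain. *)
Lemma path_var y (u : V) : exists w : R -> V,
  [/\ w 0 = u, w 1 = jac psi y *m u &
   forall t : R, 0 <= t <= 1 -> is_derive t 1 w ('D_(tpt 0 (w t)) vel (tpt t (path y t)))].
Proof.
have [W [W0 Wd dg]] := flow_variation (Ck_field 1) flow.
pose p := tpt 0 y; pose v := tpt 0 u.
have WD (t : R) : 0 <= t -> is_derive (0 : R) 1 (fun r : R => ga t (tpt 0 (y + r *: u))) (W t p v).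
  move=> t0; have [d1 e1'] := dg t p t0.
  have := is_derive_dir v d1; rewrite deriveE// e1'.
  by rewrite (_ : (fun r : R => ga t (p + r *: v)) = (fun r : R => ga t (tpt 0 (y + r *: u))))//;
     apply/funext => r; rewrite tpt_line.
have Wt (t : R) : 0 <= t <= 1 -> time (W t p v) = 0.
  move=> t01; have /andP[t0 _] := t01.
  have D := is_derive_time (WD t t0).
  apply: (is_derive_unique D).
  have -> : (fun r : R => time (ga t (tpt 0 (y + r *: u)))) = cst t.
    by apply/funext => r; rewrite flow_time.
  exact: is_derive_cst.
exists (fun t => spc (W t p v)); split.
- by rewrite W0 spcE.
- have dpsi : differentiable psi y by exact: Ck_differentiable (Ck_psi 1) I.
  rewrite -derive_jac//; apply/esym/(is_derive_unique (is_derive_dir u dpsi)).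
  exact: is_derive_spc (WD 1 ler01).
- move=> t t01; have D := is_derive_spc (Wd p v t).
  have WE : W t p v = tpt 0 (spc (W t p v)) by rewrite -{1}(Wt t t01) tpt_eta.
  rewrite -pathE//.
  have -> : 'D_(tpt 0 (spc (W t p v))) vel (ga t (tpt 0 y)) = spc ('d field (ga t p) (W t p v)).
    rewrite -WE -deriveE//.
    apply: (is_derive_unique (is_derive_dir (W t p v) (dvel (ga t p)))).
    have := is_derive_spc (is_derive_dir (W t p v) (dF (ga t p))).
    by rewrite (_ : (fun r : R => spc (field (ga t p + r *: W t p v))) = (fun r : R => vel (ga t p + r *: W t p v)))//;
       apply/funext => r; rewrite /field spcE.
  exact: D.
Qed.

(** The pairing of two variations under [Om t] is constant along the path: its derivative is the
    expression that [moser_cancel] annihilates. The path must stay in [G], where the spatial cutoff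
    is 1 and [S] is closed. *)
Lemma path_pullback y : (forall t : R, 0 <= t <= 1 -> G (path y t)) ->
  (jac psi y)^T *m (pull J N (psi y) + S (psi y)) *m jac psi y = pull J N y.
Proof.
move=> HG.
suff H u v : dot (jac psi y *m u) (Om 1 (psi y) *m (jac psi y *m v)) = dot u (pull J N y *m v).
  apply/matrixP => i j.
  have E (A : 'M[R]_m) : A i j = dot (bvec i) (A *m bvec j).
    by rewrite /dot -colE trmx_delta -rowE !mxE.
  rewrite E [RHS]E -H /Om scale1r -!mulmxA dot_mul trmxK.
  by [].
have [wu [wu0 wu1 wud]] := path_var y u; have [wv [wv0 wv1 wvd]] := path_var y v.
pose A (t : R) := dot (wu t) (Om t (path y t) *m wv t).
have path0 : path y 0 = y by rewrite /path ga0 spcE.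
suff : A 0 = A 1.
  by rewrite /A wu0 wv0 wu1 wv1 path0 {1}/Om scale0r addr0 => ->.
apply: (const_derive ler01) => t; rewrite in_itv/= => t01.
set z := path y t; have Gz : G z by exact: HG.
pose X := vel (tpt t z).
have Pd : is_derive t 1 (fun s : R => pull J N (path y s)) ('D_X (pull J N) z).
  by apply: is_derive_curve; [exact: path_derive|exact: dP].
have Sd : is_derive t 1 (fun s : R => S (path y s)) ('D_X S z).
  by apply: is_derive_curve; [exact: path_derive|exact: dS].
have tSd : is_derive t 1 (fun s : R => s *: S (path y s)) (S z + t *: 'D_X S z).
  apply: is_derive_mxP => i j.
  have -> : (fun s : R => (s *: S (path y s)) i j) = id * (fun s : R => S (path y s) i j).
    by apply/funext => s; rewrite mxE.
  have := is_deriveM (is_derive_id t 1) (is_derive_entry i j Sd).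
  by rewrite -![_ *: _]/(_ * _) mulr1 addrC !mxE.
have Od : is_derive t 1 (fun s : R => Om s (path y s)) ('D_X (pull J N) z + (S z + t *: 'D_X S z)).
  exact: is_deriveD.
have D := is_derive_dot (wud t t01) (is_derive_mulmx Od (wvd t t01)).
have Vu := vel_dir (wu t) t01 Gz; have Vv := vel_dir (wv t) t01 Gz.
have Ea : dot ('D_(tpt 0 (wu t)) vel (tpt t z)) (Om t z *m wv t) =
    - dot ('D_(wu t) lam z - ('D_(wu t) (pull J N) z + t *: 'D_(wu t) S z) *m X) (wv t).
  by rewrite (dot_antisym _ _ (Om_antisym _ _)) Vu dotC.
rewrite (_ : 0 = dot ('D_(tpt 0 (wu t)) vel (tpt t (path y t))) (Om t (path y t) *m wv t) +
    dot (wu t) (('D_X (pull J N) z + (S z + t *: 'D_X S z)) *m wv t +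
                Om t (path y t) *m 'D_(tpt 0 (wv t)) vel (tpt t (path y t))))//.
rewrite -/z Ea Vv -/X.
have cP1 := closed_pull JT openT (cN 2) (y := z) Logic.I (wu t) (wv t) X.
have cS1 := clS Gz (wu t) (wv t) X.
have dl := dlam (wu t) (wv t) Gz.
have aP : dot (wu t) ('D_(wv t) (pull J N) z *m X) = - dot X ('D_(wv t) (pull J N) z *m wu t).
  apply: dot_antisym; apply: (derive_antisym cP) => x; exact: pull_antisym.
have aS : dot (wu t) ('D_(wv t) S z *m X) = - dot X ('D_(wv t) S z *m wu t).
  by apply: dot_antisym; apply: (derive_antisym cS).
exact: (@moser_cancel R m (wu t) (wv t) X _ _ _ _ _ _ _ _ _ t aP aS dl cP1 cS1).
Qed.

End Field.

(** The speed estimate is unconditional, while the pullback identity assumes that the path stays in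
    [G]. This order lets the first be used to verify the hypothesis of the second. *)
Theorem moser : exists psi psi' : 'cV[R]_m -> 'cV[R]_m, exists path dx : 'cV[R]_m -> R -> 'cV[R]_m,
    [/\ (forall k, Ck_on k setT psi) /\ (forall k, Ck_on k setT psi'),
        cancel psi psi', cancel psi' psi &
        forall y, [/\ path y 0 = y, path y 1 = psi y,
          forall t : R, 0 <= t <= 1 ->
            is_derive t 1 (fun s => N (path y s)) (dx y t) /\
            nrm (dx y t) * (1 - t * e) <= chi (path y t) * (e / 2 * nrm (path y t)) &
          (forall t : R, 0 <= t <= 1 -> G (path y t)) ->
            (jac psi y)^T *m (pull J N (psi y) + S (psi y)) *m jac psi y = pull J N y]].
Proof.
have [lam [clam lamb dlam]] := poincare cS ST Sb starG clS.
have cF k := Ck_field clam k.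
have [L L0 HL] := field_lipschitz clam.
have [ga [flow gaK]] := flow_exists (cF 1) L0 HL.
exists (psi ga), (psi' ga), (path ga).
exists (fun y t => jac N (path ga y t) *m vel lam (tpt t (path ga y t))).
split.
- split=> k; first exact: (Ck_psi clam flow).
  exact: (Ck_psi' clam flow).
- exact: (psiK flow gaK).
- exact: (psi'K flow gaK).
move=> y; have [ga0 _ _] := flow; split.
- by rewrite /path ga0 /tpt col_mxKd.
- by [].
- move=> t t01; split; last exact: (path_speed lamb ga y t01).
  rewrite -jacE//; apply: (fun H => is_derive_along H (dN _)).
  exact: (path_derive flow y t01).
- exact: (path_pullback clam dlam flow).
Qed.

End Moser.

(** * Gauge of an ellipsoid *)

(** The expansion inequality is applied at y + s v for one small s and divided by s; the tolerance
    is scaled so that the remainder, converted to the Euclidean norm, costs at most e. *)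
Lemma expanding_jac (R : realType) m (N : 'cV[R]_m -> 'cV[R]_m) y v :
  differentiable N y -> (forall z, nrm (z - y) <= nrm (N z - N y)) ->
  nrm v <= nrm (jac N y *m v).
Proof.
move=> dN Nexp; apply/ler_addgt0Pr => e e0.
have M0 : 0 < m.+1%:R * (`|v| + 1) by rewrite mulr_gt0// ltr_wpDl.
have /nbhs_ballP[r /= r0 Hr] := diff_near dN (divr_gt0 e0 M0).
pose s := r / 2 / (`|v| + 1).
have v1 : 0 < `|v| + 1 by rewrite ltr_wpDl.
have s0 : 0 < s by rewrite !divr_gt0.
have vs : `|s *: v| < r.
  rewrite normrZ (gtr0_norm s0); apply: (@le_lt_trans _ _ (r / 2)).
    have -> : s * `|v| = r / 2 * (`|v| / (`|v| + 1)) by rewrite /s mulrAC mulrA.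
    by rewrite ler_piMr ?divr_ge0 ?(ltW r0)// ler_pdivrMr// mul1r lerDl.
  by rewrite ltr_pdivrMr// ltr_pMr// ltr1n.
have /Hr : ball (0 : 'cV[R]_m) r (s *: v) by rewrite -ball_normE/= /ball_/= sub0r normrN.
rewrite -[in 'd N y _]deriveE ?derive_jac//; set w := jac N y *m v; rewrite -scalemxAr.
move=> H; have := Nexp (s *: v + y); rewrite addrK => H1.
rewrite -(ler_pM2l s0) mulrDr -{1 2}(gtr0_norm s0) -!nrmZ.
apply: le_trans H1 _.
rewrite -[N _ - N y](subrK (s *: w)) addrC; apply: le_trans (nrmD _ _) _.
rewrite lerD2l; apply: le_trans (nrm_le_norm _) _.
rewrite -ler_pdivlMl ?ltr0n//; apply: le_trans H _.
have M1 : 0 < (m.+1)%:R :> R by rewrite ltr0n.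
rewrite normrZ (gtr0_norm s0).
have -> : e / (m.+1%:R * (`|v| + 1)) * (s * `|v|) = m.+1%:R^-1 * (s * e) * (`|v| / (`|v| + 1)).
  by field; rewrite !gt_eqF.
rewrite ler_piMr//; first by apply: ltW; rewrite pmulr_lgt0 ?invr_gt0// pmulr_lgt0.
by rewrite ler_pdivrMr// mul1r lerDl.
Qed.

Section Radial.
Variables (R : realType) (m : nat) (A : 'M[R]_m).
Local Notation V := 'cV[R]_m.
Hypothesis A_unit : A \in unitmx.

Definition gauge (y : V) : R := nrm (invmx A *m y).

Lemma gauge_ge0 y : 0 <= gauge y. Proof. exact: nrm_ge0. Qed.

Lemma gaugeD y z : gauge (y + z) <= gauge y + gauge z.
Proof. by rewrite /gauge mulmxDr; exact: nrmD. Qed.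

Lemma gaugeZ a y : gauge (a *: y) = `|a| * gauge y.
Proof. by rewrite /gauge -scalemxAr nrmZ. Qed.

Lemma Ck_gauge_sqr k : Ck_on k setT (fun y => gauge y ^+ 2).
Proof.
rewrite (_ : (fun y => _) = fun y => dot (invmx A *m y) (invmx A *m y)); last first.
  by apply/funext => y; rewrite nrm_sqr.
have cA : Ck_on k setT (fun y : V => invmx A *m y).
  by apply: (Ck_mulmxl (invmx A)) => //; exact: Ck_id.
by apply: Ck_dot => //.
Qed.

Lemma gauge_sqr_continuous : continuous (fun y : V => gauge y ^+ 2).
Proof. by apply/setT_continuous; exact: (Ck_gauge_sqr 0). Qed.

Lemma open_gauge_lt c : open [set y | gauge y ^+ 2 < c].
Proof.
apply: (@open_comp _ _ (fun y => gauge y ^+ 2) [set r | r < c]); last exact: open_lt.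
by move=> y _; exact: gauge_sqr_continuous.
Qed.

Lemma open_gauge_gt c : open [set y | c < gauge y ^+ 2].
Proof.
apply: (@open_comp _ _ (fun y => gauge y ^+ 2) [set r | c < r]); last exact: open_gt.
by move=> y _; exact: gauge_sqr_continuous.
Qed.

Lemma nrm_le_gauge y : nrm y <= frob A * gauge y.
Proof. by have := nrm_mulmx A (invmx A *m y); rewrite mulKVmx. Qed.

Lemma dot_gram y z : dot ((invmx A)^T *m (invmx A *m y)) z = dot (invmx A *m y) (invmx A *m z).
Proof. by rewrite -{1}[(invmx A)^T]trmxK trmxK dot_mul. Qed.

Lemma gauge_gram y : gauge y <= frob A^T * nrm ((invmx A)^T *m (invmx A *m y)).
Proof.
have := nrm_mulmx A^T ((invmx A)^T *m (invmx A *m y)).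
by rewrite [A^T *m _]mulmxA -trmx_mul mulVmx// trmx1 mul1mx.
Qed.

Section Push.
Variables (a0 K : R).
Hypotheses (a00 : 0 < a0) (K0 : 0 <= K).

Definition weight (y : V) : R := K * xi (gauge y ^+ 2 - a0).
(* The map N of the header: a gradient map, since the added vector is a multiple of grad (gauge ^+ 2). *)
Definition push (y : V) : V :=
  y + weight y *: ((invmx A)^T *m (invmx A *m y)).

Lemma weight_ge0 y : 0 <= weight y. Proof. by rewrite mulr_ge0 ?xi_ge0. Qed.

Lemma Ck_push k : Ck_on k setT push.
Proof.
apply: CkD; [exact: openT|exact: Ck_id|apply: CkZ; first exact: openT].
  apply: CkM; [exact: openT|exact: Ck_cst|].
  have := @Ck_comp1 _ _ k setT setT (fun y : V => gauge y ^+ 2 - a0) (@xi R).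
  apply => //; try exact: openT.
    exact: Ck_xi.
  by apply: CkB => //; [exact: Ck_gauge_sqr|exact: Ck_cst].
apply: (Ck_mulmxl (invmx A)^T) => //.
by apply: (Ck_mulmxl (invmx A)) => //; exact: Ck_id.
Qed.

Lemma push_id y : gauge y ^+ 2 <= a0 -> push y = y.
Proof. by move=> ya; rewrite /push /weight xi_eq0 ?subr_le0// mulr0 scale0r addr0. Qed.

Lemma weight_le y z : gauge y <= gauge z -> weight y <= weight z.
Proof.
move=> yz; rewrite ler_wpM2l//; apply: xi_nondecr.
by rewrite lerD2r lerXn2r ?nnegrE ?gauge_ge0.
Qed.

(** By Cauchy-Schwarz it suffices that the inner product of y - z with the difference of images is
    at least |y - z|^2. The added term is monotone: the weight grows with the gauge, so (p a - r b)
    (a - b) >= 0 for the gauges a, b and weights p, r of the two points. *)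
Lemma push_expand y z : nrm (y - z) <= nrm (push y - push z).
Proof.
have [->|d0] := eqVneq (nrm (y - z)) 0; first exact: nrm_ge0.
have dp : 0 < nrm (y - z) by rewrite lt0r d0 nrm_ge0.
rewrite -(ler_pM2r dp) -expr2 nrm_sqr; apply: le_trans _ (dot_le' _ _).
have -> : push y - push z = (y - z) +
    (weight y *: ((invmx A)^T *m (invmx A *m y)) - weight z *: ((invmx A)^T *m (invmx A *m z))).
  by rewrite /push opprD addrACA.
rewrite [leRHS]dotDl lerDl dotBl !dotZl !dot_gram mulmxBr !dotBr.
have := dot_le' (invmx A *m y) (invmx A *m z); rewrite -/(gauge y) -/(gauge z).
rewrite (dotC (invmx A *m z) (invmx A *m y)) -!nrm_sqr -/(gauge y) -/(gauge z).
have p0 := weight_ge0 y; have r0 := weight_ge0 z.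
have mono : 0 <= (weight y * gauge y - weight z * gauge z) * (gauge y - gauge z).
  have [yz|/ltW zy] := leP (gauge y) (gauge z).
    rewrite mulr_le0 ?subr_le0//; apply: ler_pM => //; first exact: gauge_ge0.
    exact: weight_le.
  rewrite mulr_ge0 ?subr_ge0//; apply: ler_pM => //; first exact: gauge_ge0.
  exact: weight_le.
move: p0 r0 mono; move: (weight y) (weight z) (gauge y) (gauge z) (dot _ _) => p r a b c p0 r0 mono cab.
have : (p + r) * c <= (p + r) * (a * b) by rewrite ler_wpM2l// addr_ge0.
by move: mono; lra.
Qed.

Lemma push_expand0 y : nrm y <= nrm (push y).
Proof.
have p0 : push 0 = 0 by rewrite push_id// /gauge mulmx0 nrm0 expr0n ltW.
by have := push_expand y 0; rewrite p0 !subr0.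
Qed.

Lemma push_jac y v : nrm v <= nrm (jac push y *m v).
Proof.
apply: expanding_jac => [|z]; last exact: push_expand.
exact: Ck_differentiable (Ck_push 1) I.
Qed.

(** Expanding the square, the cross term is exact, since pairing A^(-1) y with A^(-1) w gives |w|^2
    for w = A^(-T) A^(-1) y; the non-negative quadratic term is dropped. *)
Lemma gauge_push y :
  gauge y ^+ 2 + 2 * weight y * nrm ((invmx A)^T *m (invmx A *m y)) ^+ 2 <= gauge (push y) ^+ 2.
Proof.
rewrite [gauge (push y)]/gauge /push mulmxDr -scalemxAr [leRHS]nrm_sqr dotDl !dotDr !dotZl !dotZr.
set u := invmx A *m y; set w := _ *m u.
have E : dot u (invmx A *m w) = nrm w ^+ 2 by rewrite dot_mul nrm_sqr.
rewrite [dot (invmx A *m w) u]dotC E /gauge -nrm_sqr -/u.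
have : 0 <= weight y * (weight y * dot (invmx A *m w) (invmx A *m w)).
  by do 2![apply: mulr_ge0; first exact: weight_ge0]; exact: dot_ge0.
set X := weight y * (_ * _); lra.
Qed.

Lemma gauge_push_ge y : gauge y ^+ 2 <= gauge (push y) ^+ 2.
Proof.
apply: le_trans (gauge_push y); rewrite lerDl.
apply: mulr_ge0; last exact: sqr_ge0.
by apply: mulr_ge0 => //; exact: weight_ge0.
Qed.

End Push.

Lemma push_far a0 a1 Q : 0 < a0 -> a0 < a1 -> exists2 K, 0 <= K &
  forall y, a1 <= gauge y ^+ 2 -> Q < gauge (push a0 K y) ^+ 2.
Proof.
move=> a00 a01; set F := frob A^T; set c := xi (a1 - a0).
have c0 : 0 < c by rewrite xi_gt0// subr_gt0.
have F0 : 0 <= F by exact: sqrtr_ge0.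
have a10 := lt_trans a00 a01.
(* Where gauge^2 >= a1, the weight is at least K c and |w|^2 at least a1 / F^2. This value makes the
   gain 2 K c |w|^2 at least |Q|. *)
pose K := `|Q| * F ^+ 2 / (2 * c * a1).
have K0 : 0 <= K by rewrite divr_ge0 ?mulr_ge0 ?sqr_ge0// ltW.
exists K => // y ya; apply: lt_le_trans (gauge_push a0 K0 y).
set w := _ *m _; have G := gauge_gram y; rewrite -/w -/F in G.
have G2 : gauge y ^+ 2 <= F ^+ 2 * nrm w ^+ 2.
  by rewrite -exprMn lerXn2r ?nnegrE ?gauge_ge0 ?mulr_ge0 ?nrm_ge0.
have Kw : K * c <= weight a0 K y by rewrite ler_wpM2l// xi_nondecr// lerD2r.
have F20 : 0 < F ^+ 2.
  rewrite lt0r sqr_ge0 andbT; apply/eqP => F2; move: G2; rewrite F2 mul0r => G2.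
  by have := lt_le_trans a10 (le_trans ya G2); rewrite ltxx.
have H : `|Q| <= 2 * weight a0 K y * nrm w ^+ 2.
  apply: (@le_trans _ _ (2 * (K * c) * nrm w ^+ 2)); last first.
    by rewrite ler_wpM2r ?sqr_ge0// ler_wpM2l.
  have -> : 2 * (K * c) * nrm w ^+ 2 = `|Q| * (F ^+ 2 * nrm w ^+ 2 / a1).
    by rewrite /K; field; rewrite !gt_eqF.
  by rewrite ler_peMr// ler_pdivlMr// mul1r (le_trans ya).
apply: le_lt_trans (ler_norm Q) _; apply: le_lt_trans H _.
by rewrite ltrDr (lt_le_trans a10).
Qed.

End Radial.

(** * Squeezing ellipsoids *)

Section Rate.
Variables (R : realType) (e : R).

(* Solves g' = e / 2 / (1 - t e) g, the comparison equation for the speed bound. *)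
Definition rate (t : R) : R := (Num.sqrt (1 - t * e))^-1.

Lemma is_derive_affine (t : R) : is_derive t 1 (fun s : R => 1 - s * e) (- e).
Proof.
rewrite (_ : (fun s : R => 1 - s * e) = cst 1 - *%R e); last by apply/funext => s; rewrite !fctE mulrC.
by have := is_deriveB (is_derive_cst (1 : R) t 1) (is_derive_scale e t); rewrite sub0r.
Qed.

Lemma is_derive_rate (t : R) : t * e < 1 ->
  is_derive t 1 rate (e / 2 / (1 - t * e) * rate t).
Proof.
move=> te; set h := fun s : R => 1 - s * e.
have h0 : 0 < h t by rewrite subr_gt0.
have hd : is_derive t 1 h (- e) := is_derive_affine t.
have q0 : 0 < Num.sqrt (h t) by rewrite sqrtr_gt0.
have sd := @is_derive1_comp R (@Num.sqrt R) h t _ _ (is_derive1_sqrt h0) hd.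
have vd : is_derive (Num.sqrt (h t)) 1 (fun s : R => s^-1) (- (Num.sqrt (h t)) ^- 2).
  apply: DeriveDef; first by apply: (@derivableV R R id) => //; exact: lt0r_neq0.
  rewrite (@deriveV R R id)//; last exact: lt0r_neq0.
  by rewrite derive_id -[_ *: 1]/(_ * 1) mulr1.
have := @is_derive1_comp R (fun s : R => s^-1) (fun s => Num.sqrt (h s)) t _ _ vd sd.
congr (is_derive _ _ _ _); rewrite /rate -/(h t).
have hq : h t = Num.sqrt (h t) ^+ 2 by rewrite sqr_sqrtr ?ltW.
move: q0 hq; move: (Num.sqrt (h t)) => q q0 ->.
by field; rewrite gt_eqF.
Qed.

Lemma rate0 : rate 0 = 1.
Proof. by rewrite /rate mul0r subr0 sqrtr1 invr1. Qed.

Hypothesis e0 : 0 <= e.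

Lemma rate_le (s t : R) : s <= t -> t * e < 1 -> rate s <= rate t.
Proof.
move=> st te.
have h : 1 - t * e <= 1 - s * e by rewrite lerD2l lerN2 ler_wpM2r.
have t0 : 0 < 1 - t * e by rewrite subr_gt0.
rewrite /rate lef_pV2 ?posrE ?sqrtr_gt0//; last exact: lt_le_trans h.
by rewrite ler_wsqrtr.
Qed.

Lemma rate_ge1 (t : R) : 0 <= t -> t * e < 1 -> 1 <= rate t.
Proof. by move=> t0 te; rewrite -rate0; exact: rate_le. Qed.

Hypothesis e1 : e < 1.
Variables (m : nat) (x dx : R -> 'cV[R]_m).
Hypothesis xd : forall t : R, 0 <= t <= 1 -> is_derive t 1 x (dx t).

Lemma te_lt1 (t : R) : 0 <= t <= 1 -> t * e < 1.
Proof. by move=> /andP[t0 t1]; apply: le_lt_trans e1; rewrite ler_piMl. Qed.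

(** Divided by 1 - u e, the assumed speed bound is exactly the derivative of c times [rate], so it
    integrates without loss. *)
Lemma displacement_le (c s t : R) : 0 <= s -> s <= t -> t <= 1 ->
  (forall u : R, 0 <= u <= 1 -> nrm (dx u) * (1 - u * e) <= c * (e / 2) * rate u) ->
  nrm (x t - x s) <= c * (rate t - rate s).
Proof.
move=> s0 st t1 H.
have in01 (u : R) : u \in `[s, t]%R -> 0 <= u <= 1.
  by rewrite in_itv/= => /andP[su ut]; rewrite (le_trans s0 su) (le_trans ut t1).
rewrite mulrBr; apply: (@nrm_mean_value _ _ x dx (fun u => c * rate u)
  (fun u => c * (e / 2 / (1 - u * e) * rate u)) _ _ st) => u /in01 u01.
- exact: xd.
- exact: (@is_deriveZ R R R rate c u 1 _ (is_derive_rate (te_lt1 u01))).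
- have h0 : 0 < 1 - u * e by rewrite subr_gt0 te_lt1.
  have -> : c * (e / 2 / (1 - u * e) * rate u) = c * (e / 2) * rate u / (1 - u * e).
    by field; rewrite gt_eqF.
  by rewrite ler_pdivlMr// H.
Qed.

(** The function (1 - t e) |x t|^2 is non-increasing: the hypothesis bounds 2 (1 - t e) times the
    inner product of x and x' by e |x|^2. Working with the square avoids dividing by the norm. *)
Lemma growth_le (t : R) : 0 <= t <= 1 ->
  (forall u : R, 0 <= u <= 1 -> nrm (dx u) * (1 - u * e) <= e / 2 * nrm (x u)) ->
  nrm (x t) <= nrm (x 0) * rate t.
Proof.
move=> t01 H; have /andP[t0 t1] := t01.
have in01 (u : R) : u \in `[0, t]%R -> 0 <= u <= 1.
  by rewrite in_itv/= => /andP[-> ut]; exact: le_trans ut t1.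
have D (u : R) : u \in `[0, t]%R -> is_derive u 1 ((fun s : R => 1 - s * e) * (fun s => dot (x s) (x s)))
    ((1 - u * e) *: (dot (dx u) (x u) + dot (x u) (dx u)) + dot (x u) (x u) *: (- e)).
  move=> /in01 u01; apply: is_deriveM; last exact: is_derive_dot (xd u01) (xd u01).
  exact: is_derive_affine.
have /= := nonincr_derive t0 D _; rewrite !fctE/= mul0r subr0 mul1r => /(_ _)H1.
have h0 : 0 < 1 - t * e by rewrite subr_gt0 te_lt1.
rewrite /rate ler_pdivlMr ?sqrtr_gt0// -(@ler_pXn2r _ 2) ?nnegrE ?mulr_ge0 ?nrm_ge0 ?sqrtr_ge0//.
rewrite exprMn !nrm_sqr sqr_sqrtr ?(ltW h0)// mulrC; apply: H1 => u /in01 u01.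
rewrite -![_ *: _]/(_ * _) (dotC (dx u)) -nrm_sqr.
have H2 := H u u01.
have h1 : 0 <= 1 - u * e by rewrite subr_ge0 ltW// te_lt1.
have H3 : (1 - u * e) * dot (x u) (dx u) <= e / 2 * nrm (x u) ^+ 2.
  apply: (@le_trans _ _ (nrm (x u) * (nrm (dx u) * (1 - u * e)))).
    by rewrite mulrA [leRHS]mulrC ler_wpM2l// dot_le'.
  by rewrite expr2 [leRHS]mulrCA ler_wpM2l ?nrm_ge0.
by rewrite mulrDr; move: H3; set P := _ * dot _ _; set Q := nrm _ ^+ 2; lra.
Qed.

End Rate.

Lemma jac_near_id (R : realType) m (f : 'cV[R]_m -> 'cV[R]_m) (U : set 'cV[R]_m) y :
  open U -> U y -> (forall z, U z -> f z = z) -> jac f y = 1%:M.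
Proof.
move=> oU Uy fU; apply/matrixP => i j; rewrite mxE.
have E : \forall z \near y, f z = z.
  by apply: (open_near_eq oU Uy) => z; rewrite inE; exact: fU.
rewrite (near_eq_derive _ E).
by rewrite derive_id !mxE andbT.
Qed.

(** * Cutoff of the deviation form and the gauge estimates *)

Section Squeeze.
Variables (R : realType) (m : nat) (J A : 'M[R]_m) (e : R).
Local Notation V := 'cV[R]_m.
Variables (O : set V) (f : V -> V) (a0 a1 b : R).
Hypotheses (JT : J^T = - J) (JJ : J^T *m J = 1%:M) (e0 : 0 <= e) (e1 : e < 1).
Hypotheses (A_unit : A \in unitmx) (oO : open O).
Hypotheses (a00 : 0 < a0) (a01 : a0 < a1) (a1b : a1 < b).
Hypothesis subO : forall y, gauge A y ^+ 2 <= b -> O y.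
Hypothesis cf : forall k, Ck_on k O f.
Hypothesis fJ : forall y u v, O y ->
  `|dot u ((pull J f y - J) *m v)| <= e * (nrm u * nrm v).

(** Three levels of the squared gauge: up to [a0] the map N is the identity, up to [a1] the form is
    the uncut and closed difference, and from [b] on it vanishes. Cutting the form itself keeps the
    bound [e] everywhere, at the cost of closedness between [a1] and [b]. *)
Definition cut (y : V) : R := step a1 b (gauge A y ^+ 2).
Definition cut_form (y : V) : 'M[R]_m := cut y *: (pull J f y - J).

Lemma Ck_cut k : Ck_on k setT cut.
Proof.
have := @Ck_comp1 _ _ k setT setT (fun y : V => gauge A y ^+ 2) (step a1 b).
apply => //; try exact: openT; first exact: Ck_step.
exact: Ck_gauge_sqr.
Qed.

Lemma cut_form0 y : b <= gauge A y ^+ 2 -> cut_form y = 0.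
Proof. by move=> yb; rewrite /cut_form /cut step_eq0// scale0r. Qed.

Lemma cut_formE y : gauge A y ^+ 2 <= a1 -> cut_form y = pull J f y - J.
Proof. by move=> ya; rewrite /cut_form /cut step_eq1// scale1r. Qed.

Lemma Ck_cut_form k : Ck_on k setT cut_form.
Proof.
apply: (@Ck_sub _ _ _ _ _ (O `|` [set y | b < gauge A y ^+ 2])).
  by move=> y _; have [/subO|] := leP (gauge A y ^+ 2) b; [left|right].
apply: CkU.
  apply: CkZ => //; first exact: Ck_sub (Ck_cut k).
  by apply: CkB => //; [exact: Ck_pull|exact: Ck_cst].
apply: (@Ck_eq _ _ _ _ _ (fun=> 0)); [exact: open_gauge_gt| |exact: Ck_cst].
by move=> y; rewrite inE /= => yb; rewrite cut_form0// ltW.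
Qed.

Lemma cut_form_antisym y : (cut_form y)^T = - cut_form y.
Proof. by rewrite /cut_form linearZ/= linearB/= pull_antisym// JT -opprD scalerN. Qed.

Lemma cut_form_bound y u v : `|dot u (cut_form y *m v)| <= e * (nrm u * nrm v).
Proof.
have E0 : 0 <= e * (nrm u * nrm v) by rewrite !mulr_ge0 ?nrm_ge0.
have [/subO Oy|/ltW yb] := leP (gauge A y ^+ 2) b; last by rewrite cut_form0// mul0mx dot0r normr0.
rewrite -scalemxAl dotZr normrM -[leRHS]mul1r; apply: ler_pM => //; last exact: fJ.
by rewrite ger0_norm ?step_le1 ?step_ge0.
Qed.

Lemma cut_form_closed y : gauge A y ^+ 2 < a1 -> closed_at cut_form y.
Proof.
move=> ya.
have Oy : O y by apply: subO; apply: ltW; apply: lt_trans a1b.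
have E : \forall z \near y, cut_form z = pull J f z - J.
  have := @open_near_eq _ _ _ _ cut_form (fun z => pull J f z - J) y (@open_gauge_lt _ _ A a1) ya.
  by apply=> z; rewrite inE => /ltW; exact: cut_formE.
have dP : differentiable (pull J f) y by exact: Ck_differentiable (Ck_pull J oO (cf 2)) Oy.
have D w : 'D_w cut_form y = 'D_w (pull J f) y.
  rewrite (near_eq_derive _ E) deriveB//; last exact: diff_derivable.
  by rewrite derive_cst subr0.
by move=> u v w; rewrite !D; exact: closed_pull (cf 2) Oy u v w.
Qed.

Variables (kap r : R).
Hypotheses (kap0 : 0 <= kap) (r0 : 0 <= r).
Hypothesis kapP : forall v, gauge A v <= kap * nrm v.
Hypothesis rP : forall v, nrm v <= r * gauge A v.

Let d := kap * (rate e 1 - 1) * r.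

Let rate1 : 1 <= rate e 1. Proof. by apply: rate_ge1; rewrite ?mul1r. Qed.

Lemma squeeze_ge0 : 0 <= d.
Proof. by rewrite !mulr_ge0// subr_ge0. Qed.

Lemma gauge_lt_sqrt c y : 0 < c -> (gauge A y < Num.sqrt c) = (gauge A y ^+ 2 < c).
Proof.
by move=> c0; rewrite -[in RHS](sqr_sqrtr (ltW c0)) ltr_pXn2r ?nnegrE ?gauge_ge0 ?sqrtr_ge0.
Qed.

(** One deformation serves both inequalities. Forward, a trajectory starting at [y] stays where N is
    the identity, and the pulled-back form is [J]. Backward from [y], the starting point [psi' y]
    may lie outside that region: its image under N is what is controlled, and the form there is
    [pull J N]. *)
Theorem squeeze : exists psi psi' N : V -> V,
  [/\ (forall k, Ck_on k setT psi) /\ (forall k, Ck_on k setT psi'),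
      cancel psi psi' /\ cancel psi' psi,
      (forall k, Ck_on k setT N) /\ (forall y z, nrm (y - z) <= nrm (N y - N z)),
      forall y, (1 + d) * gauge A y < Num.sqrt a0 ->
        gauge A (psi y) <= (1 + d) * gauge A y /\
        (jac psi y)^T *m pull J f (psi y) *m jac psi y = J &
      forall y, gauge A y ^+ 2 < a0 ->
        gauge A (N (psi' y)) <= gauge A y + Num.sqrt b * d /\
        (jac psi (psi' y))^T *m pull J f y *m jac psi (psi' y) = pull J N (psi' y)].
Proof.
have a10 := lt_trans a00 a01; have b0 := lt_trans a10 a1b.
have d0 := squeeze_ge0.
(* sqrt a0 + sqrt b d bounds the gauge that N of a backward trajectory can reach; K is chosen so
   that N sends every point of squared gauge at least [a1] strictly beyond it. *)
have [K K0 HK] := push_far A_unit ((Num.sqrt a0 + Num.sqrt b * d) ^+ 2) a00 a01.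
set N := push A a0 K in HK.
have Nexp y z : nrm (y - z) <= nrm (N y - N z) by exact: push_expand.
have Nexp0 y : nrm y <= nrm (N y) by exact: push_expand0.
have Njac y v : nrm v <= nrm (jac N y *m v) by exact: push_jac.
have Nid y : gauge A y ^+ 2 <= a0 -> N y = y by exact: push_id.
have cN k : Ck_on k setT N by exact: Ck_push.
have Ngauge y : gauge A y <= gauge A (N y).
  have := gauge_push_ge A a0 K0 y.
  by rewrite ler_pXn2r// nnegrE gauge_ge0.
have Nfar y : gauge A (N y) <= Num.sqrt a0 + Num.sqrt b * d -> gauge A y ^+ 2 < a1.
  rewrite ltNge => H; apply/negP => /HK; apply/negP; rewrite -leNgt.
  have Q0 : 0 <= Num.sqrt a0 + Num.sqrt b * d.
    by apply: addr_ge0; [exact: sqrtr_ge0|apply: mulr_ge0 => //; exact: sqrtr_ge0].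
  by rewrite lerXn2r// nnegrE gauge_ge0.
have cut01 y : 0 <= cut y <= 1 by rewrite step_ge0// step_le1.
have cutG y : gauge A y ^+ 2 < a1 -> cut y = 1 by move=> ya; rewrite /cut step_eq1// ltW.
have cutB y : frob A * Num.sqrt b < `|y| -> cut y = 0.
  move=> yB; rewrite /cut step_eq0// leNgt; apply/negP; rewrite -gauge_lt_sqrt// => yb.
  move: yB; rewrite ltNge (le_trans (norm_le_nrm y))//.
  by apply: le_trans (nrm_le_gauge A_unit y) _; rewrite ler_wpM2l ?sqrtr_ge0// ltW.
have starG y (s : R) : gauge A y ^+ 2 < a1 -> 0 <= s <= 1 -> gauge A (s *: y) ^+ 2 < a1.
  move=> ya /andP[s0 s1]; apply: le_lt_trans ya.
  rewrite lerXn2r ?nnegrE ?gauge_ge0// gaugeZ (ger0_norm s0) ler_piMl// gauge_ge0.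
  by [].
have JN z : gauge A z ^+ 2 < a0 -> pull J N z = J.
  move=> za; rewrite /pull (@jac_near_id _ _ _ [set z | gauge A z ^+ 2 < a0])//.
  - by rewrite trmx1 mul1mx mulmx1.
  - exact: open_gauge_lt.
  - by move=> w /ltW; exact: Nid.
have [psi [psi' [path [dx [[cpsi cpsi'] psiK psi'K Hpath]]]]] :=
  @moser R m J e _ _ N cut [set y | gauge A y ^+ 2 < a1] JT JJ e0 e1 Ck_cut_form cut_form_antisym cut_form_bound cN
    Njac Ck_cut cut01 cutG cutB (@open_gauge_lt _ _ A a1) starG cut_form_closed.
exists psi, psi', N; split; [by []|by []|by []| |].
- move=> y yd; have [p0 p1 Hx _] := Hpath y.
  have y0 : gauge A y ^+ 2 < a0.
    rewrite -gauge_lt_sqrt//; apply: le_lt_trans yd.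
    by rewrite ler_peMl ?gauge_ge0// lerDl.
  set x := fun s : R => N (path y s).
  have x0 : x 0 = y by rewrite /x p0 Nid// ltW.
  have xd (t : R) (t01 : 0 <= t <= 1) : is_derive t 1 x (dx y t) := (Hx t t01).1.
  have xs (t : R) : 0 <= t <= 1 -> nrm (dx y t) * (1 - t * e) <= e / 2 * nrm (x t).
    move=> t01; apply: le_trans (Hx t t01).2 _.
    have /andP[c0 c1] := cut01 (path y t).
    apply: (@le_trans _ _ (e / 2 * nrm (path y t))).
      by rewrite ler_piMl// mulr_ge0 ?nrm_ge0// divr_ge0.
    by rewrite ler_wpM2l ?divr_ge0.
  have xg (t : R) : 0 <= t <= 1 -> gauge A (x t) <= (1 + d) * gauge A y.
    move=> t01; have /andP[t0 t1] := t01.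
    rewrite -[x t](subrK y) addrC; apply: le_trans (gaugeD _ _ _) _.
    rewrite mulrDl mul1r lerD2l.
    have := displacement_le e0 e1 xd (lexx 0) t0 t1 (c := nrm y).
    rewrite x0 rate0 => H.
    apply: le_trans (kapP _) _; rewrite /d -!mulrA ler_wpM2l//.
    apply: (@le_trans _ _ (nrm y * (rate e t - 1))).
      apply: H => u u01; apply: le_trans (xs u u01) _.
      have := growth_le e0 e1 xd u01 xs; rewrite x0 => H.
      by rewrite [leRHS]mulrAC [leRHS]mulrC ler_wpM2l ?divr_ge0.
    rewrite mulrC; apply: ler_pM => //; [|exact: nrm_ge0|].
      by rewrite subr_ge0 rate_ge1// (te_lt1 e0 e1).
    by rewrite lerD2r rate_le ?mul1r.
  have pa (t : R) : 0 <= t <= 1 -> gauge A (path y t) ^+ 2 < a0.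
    move=> t01; rewrite -gauge_lt_sqrt//; apply: le_lt_trans (Ngauge _) _.
    exact: le_lt_trans (xg t t01) yd.
  have one01 : 0 <= (1 : R) <= 1 by rewrite ler01 lexx.
  have := xg 1 one01; have := pa 1 one01; rewrite /x p1 => pa1.
  rewrite Nid ?(ltW pa1)// => ->; split; first by [].
  have [_ _ _ Hpull] := Hpath y.
  have := Hpull (fun (t : R) t01 => lt_trans (pa t t01) a01).
  rewrite cut_formE; last by rewrite ltW// (lt_trans pa1).
  by rewrite !JN// addrC subrK.
- move=> y1 ya; set y := psi' y1; have [p0 p1 Hx _] := Hpath y.
  rewrite /y psi'K -/y in p1.
  set x := fun s : R => N (path y s).
  have x1 : x 1 = y1 by rewrite /x p1 Nid// ltW.
  have xd (t : R) (t01 : 0 <= t <= 1) : is_derive t 1 x (dx y t) := (Hx t t01).1.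
  (* The norm at the start is unknown, so [growth_le] gives nothing. Instead the cutoff stops all
     motion at gauge sqrt b, and 1 <= [rate] brings the constant bound into the shape that
     [displacement_le] integrates. *)
  have xs (t : R) : 0 <= t <= 1 -> nrm (dx y t) * (1 - t * e) <= r * Num.sqrt b * (e / 2) * rate e t.
    move=> t01; have /andP[t0 t1] := t01; apply: le_trans (Hx t t01).2 _.
    have B0 : 0 <= r * Num.sqrt b * (e / 2) by rewrite !mulr_ge0 ?sqrtr_ge0 ?divr_ge0.
    apply: (@le_trans _ _ (r * Num.sqrt b * (e / 2))); last first.
      by rewrite ler_peMr// rate_ge1// (te_lt1 e0 e1).
    have [yb|yb] := leP b (gauge A (path y t) ^+ 2).
      by rewrite /cut step_eq0// mul0r.
    have /andP[c0 c1] := cut01 (path y t).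
    apply: (@le_trans _ _ (e / 2 * nrm (path y t))).
      by rewrite ler_piMl// mulr_ge0 ?nrm_ge0// divr_ge0.
    rewrite mulrC ler_wpM2r ?divr_ge0//; apply: le_trans (rP _) _.
    by rewrite ler_wpM2l// ltW// gauge_lt_sqrt.
  have xg (t : R) : 0 <= t <= 1 -> gauge A (x t) <= gauge A y1 + Num.sqrt b * d.
    move=> /andP[t0 t1].
    have := displacement_le e0 e1 xd t0 t1 (lexx 1) xs; rewrite x1 => H.
    rewrite -[x t](subrK y1) addrC; apply: le_trans (gaugeD _ _ _) _.
    rewrite lerD2l; apply: le_trans (kapP _) _; rewrite nrm_distC.
    have -> : Num.sqrt b * d = kap * (r * Num.sqrt b * (rate e 1 - 1)) by rewrite /d; ring.
    rewrite ler_wpM2l//; apply: le_trans H _; rewrite ler_wpM2l ?mulr_ge0 ?sqrtr_ge0//.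
    rewrite lerD2l lerN2 rate_ge1// (te_lt1 e0 e1)// t0 t1.
    by [].
  (* The choice of K read backwards: N of the path stays within the bound, so the path never enters
     the layer where the cut off form may fail to be closed. *)
  have pa (t : R) : 0 <= t <= 1 -> gauge A (path y t) ^+ 2 < a1.
    move=> t01; apply: Nfar; apply: le_trans (xg t t01) _.
    by rewrite lerD2r ltW// gauge_lt_sqrt.
  have zero01 : 0 <= (0 : R) <= 1 by rewrite ler01 lexx.
  have := xg 0 zero01; rewrite /x p0 => H; split; first exact: H.
  have [_ _ _ Hpull] := Hpath y.
  have := Hpull pa; rewrite /y psi'K -/y cut_formE; last by rewrite ltW// (lt_trans ya).
  by rewrite JN// addrC subrK.
Qed.

End Squeeze.

(** * Translations *)

Section JacComp.
Variables (R : realType) (m : nat).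
Local Notation V := 'cV[R]_m.

Lemma jac_col (M N : 'M[R]_m) : (forall v : V, M *m v = N *m v) -> M = N.
Proof. by move=> H; apply/matrixP => i j; have := congr1 (fun w : V => w i ord0) (H (bvec j)); rewrite -!colE !mxE. Qed.

Lemma jac_comp (f g : V -> V) x : differentiable f x -> differentiable g (f x) ->
  jac (fun y => g (f y)) x = jac g (f x) *m jac f x.
Proof.
move=> df dg; apply: jac_col => v.
have dgf := differentiable_compE df dg.
by rewrite -mulmxA -(derive_jac _ dgf) derive_comp// jacE// derive_jac.
Qed.

Lemma pull_comp (J : 'M[R]_m) (f g : V -> V) x :
  differentiable f x -> differentiable g (f x) ->
  pull J (fun y => g (f y)) x = (jac f x)^T *m pull J g (f x) *m jac f x.
Proof. by move=> df dg; rewrite /pull jac_comp// trmx_mul !mulmxA. Qed.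

Lemma Ck_shift k (b : V) : Ck_on k setT (fun y : V => b + y).
Proof. by apply: CkD => //; [exact: Ck_cst|exact: Ck_id]. Qed.

Lemma jac_translate (b : V) (f : V -> V) x : differentiable f (b + x) ->
  jac (fun y => f (b + y)) x = jac f (b + x).
Proof.
move=> df.
have ds : differentiable (fun y : V => b + y) x by exact: Ck_differentiable (Ck_shift 1 b) I.
rewrite (jac_comp ds df) [X in _ *m X](_ : _ = 1%:M) ?mulmx1//.
apply: jac_col => v; rewrite mul1mx -derive_jac//.
rewrite (_ : (fun y : V => b + y) = cst b + id)// deriveD//.
by rewrite derive_cst add0r derive_id.
Qed.

Lemma open_translate (b : V) (U : set V) : open U -> open [set y | U (b + y)].
Proof.
move=> oU; apply: (@open_comp _ _ (fun y => b + y) U) => // y _; apply: (setT_continuous _).2.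
exact: Ck_shift.
Qed.

Lemma Ck_translate k (b : V) (U : set V) (f : V -> V) : open U -> Ck_on k U f ->
  Ck_on k [set y | U (b + y)] (fun y => f (b + y)).
Proof.
move=> oU cf.
apply: (@Ck_comp _ _ _ _ _ _ _ U (fun y => b + y) f) => //; last exact: Ck_sub (Ck_shift k b).
  exact: open_translate.
by move=> _ [y Uy <-].
Qed.

End JacComp.

Section Room.
Variables (R : realType) (m : nat) (A : 'M[R]_m).
Hypothesis A_unit : A \in unitmx.

(* The gauge attains its minimum on the part of a larger ellipsoid outside O. *)
Lemma gauge_room (O : set 'cV[R]_m) : open O -> (forall y, gauge A y <= 1 -> O y) ->
  exists2 b : R, 1 < b & forall y, gauge A y ^+ 2 <= b -> O y.
Proof.
move=> oO subO; pose C := [set y | gauge A y ^+ 2 <= 2] `&` ~` O.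
have [C0|C0] := pselect (C !=set0); last first.
  exists 2; first by rewrite ltr1n.
  by move=> y y2; apply: contrapT => nO; apply: C0; exists y.
have cg := @gauge_sqr_continuous R m A.
have closedC : closed C.
  apply: closedI; last exact: open_closedC.
  apply: (@closed_comp _ _ (fun y => gauge A y ^+ 2) [set r | r <= 2]); last exact: closed_le.
  by move=> y _; exact: cg.
have boundedC : bounded_set C.
  exists (frob A * 2); split; first by rewrite num_real.
  move=> M HM y [/= y2 _]; apply: le_trans (ltW HM).
  apply: le_trans (norm_le_nrm y) _; apply: le_trans (nrm_le_gauge A_unit y) _.
  rewrite ler_wpM2l ?sqrtr_ge0//.
  rewrite -(@ler_pXn2r _ 2) ?nnegrE ?gauge_ge0//; apply: le_trans y2 _.
  by rewrite -natrX ler_nat.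
have [y1 + Hmin] := compact_EVT_min C0 (cV_compact boundedC closedC) (continuous_subspaceT cg).
rewrite inE => -[/= y2 nO].
have y1_gt1 : 1 < gauge A y1 ^+ 2.
  rewrite ltNge; apply/negP => H; apply/nO/subO.
  by rewrite -(@ler_pXn2r _ 2) ?nnegrE ?gauge_ge0// expr1n.
exists ((1 + gauge A y1 ^+ 2) / 2); first by rewrite ltr_pdivlMr// mul1r ltrD2l.
move=> y yb; apply: contrapT => nOy.
have yC : y \in C.
  rewrite inE; split=> //=; apply: le_trans yb _; rewrite ler_pdivrMr//.
  by move: y2 y1_gt1; set a := gauge A y1 ^+ 2; lra.
have := Hmin y yC; move: yb y1_gt1; set a := gauge A y1 ^+ 2; set c := gauge A y ^+ 2.
by rewrite ler_pdivlMr//; lra.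
Qed.

End Room.

(** For 0 < d < 1, the inequality (1 + s d) (1 - d) <= 1 amounts to s <= (1 - d)^(-1), so [b] is
    capped by (1 - d)^(-2), which exceeds 1. This fits the gauge bound 1 + sqrt b d under
    [outer_factor]. *)
Lemma outer_margin (R : realType) (d b0 : R) : 0 <= d -> 1 < b0 ->
  exists b, [/\ 1 < b, b <= b0 & d < 1 -> (1 + Num.sqrt b * d) * (1 - d) <= 1].
Proof.
move=> d0 b01; have [d1|d1] := ltP d 1; last by exists b0; split.
have [d00|dn0] := eqVneq d 0.
  by exists b0; split=> // _; rewrite d00 mulr0 addr0 subr0 mulr1.
have d1p : 0 < 1 - d by rewrite subr_gt0.
have dp : 0 < d by rewrite lt0r dn0.
have i1 : 1 < (1 - d)^-1 by rewrite invf_gt1// gtrBl.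
exists (Num.min b0 ((1 - d)^-1 ^+ 2)); split.
- by rewrite lt_min b01 expr_gt1// ltW// (lt_trans ltr01).
- by rewrite ge_min lexx.
- move=> _; set b := Num.min _ _.
  have sb : Num.sqrt b <= (1 - d)^-1.
    rewrite -[leRHS]gtr0_norm ?invr_gt0// -sqrtr_sqr ler_wsqrtr//.
    by rewrite /b ge_min lexx orbT.
  have : Num.sqrt b * (1 - d) <= 1 by rewrite -ler_pdivlMr// mul1r.
  move: (Num.sqrt b) => s H.
  have : d * (s * (1 - d)) <= d * 1 by rewrite ler_wpM2l.
  by nra.
Qed.

(** * The standard symplectic structure *)

Section Standard.
Variables (R : realType) (n : nat).
Local Notation V := (R2n R n).

Definition stdJ : 'M[R]_(n + n) := block_mx 0 1%:M (- 1%:M) 0.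

Lemma stdJ_antisym : stdJ^T = - stdJ.
Proof. by rewrite /stdJ tr_block_mx opp_block_mx !trmx0 trmx1 linearN/= trmx1 oppr0 opprK. Qed.

Lemma stdJ_orth : stdJ^T *m stdJ = 1%:M.
Proof.
rewrite stdJ_antisym mulNmx /stdJ mulmx_block !mul0mx !mulmx0 !add0r !addr0 mul1mx mulmx1.
by rewrite opp_block_mx !oppr0 opprK -scalar_mx_block.
Qed.

Lemma omega0E (x u v : V) : omega0 x u v = dot u (stdJ *m v).
Proof.
rewrite /omega0 /dot -[in RHS](vsubmxK u) -[in RHS](vsubmxK v) /stdJ mul_block_col.
rewrite !mul0mx add0r addr0 mul1mx mulNmx mul1mx tr_col_mx mul_row_col mulmxN !mxE -sumrB.
by apply: eq_bigr => j _; rewrite /wedge /coord_x /coord_y !mxE [v _ _ * _]mulrC.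
Qed.

Lemma pullback_omega0E (f : V -> V) x u v : differentiable f x ->
  pullback f (@omega0 R n) x u v = dot u (pull stdJ f x *m v).
Proof. by move=> df; rewrite /pullback omega0E !jacE// dot_pull. Qed.

Lemma enormE (v : V) : enorm v = nrm v.
Proof. by rewrite /enorm /nrm dotE; congr Num.sqrt; apply: eq_bigr => i _; rewrite expr2. Qed.

Lemma frob_antisym m (S : 'M[R]_m) : S^T = - S ->
  \sum_i \sum_j S i j ^+ 2 = 2 * \sum_(i < m) \sum_(j < m | (i < j)%N) S i j ^+ 2.
Proof.
move=> ST; have Sij i j : S i j ^+ 2 = S j i ^+ 2.
  have := congr1 (fun M : 'M[R]_m => M i j ^+ 2) ST.
  by rewrite !mxE sqrrN.
have Sii i : S i i = 0.
  have := congr1 (fun M : 'M[R]_m => M i i) ST; rewrite !mxE => /eqP.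
  by rewrite -subr_eq0 opprK -mulr2n mulrn_eq0/= => /eqP.
have E : \sum_(i < m) \sum_(j < m | (i < j)%N) S i j ^+ 2 =
    \sum_(i < m) \sum_(j < m | (j < i)%N) S i j ^+ 2.
  by rewrite (exchange_big_dep xpredT)//=; apply: eq_bigr => i _; apply: eq_bigr => j _; exact: Sij.
rewrite mulr_natl mulr2n {2}E -big_split/=; apply: eq_bigr => i _.
rewrite (bigID (fun j : 'I_m => (i < j)%N))/=; congr (_ + _).
rewrite (bigID (pred1 i))/= [X in X + _]big1 ?add0r.
  by apply: eq_bigl => j; rewrite -leqNgt andbC ltn_neqAle.
by move=> j /andP[_ /eqP->]; rewrite Sii expr0n.
Qed.

(** The source of sqrt 2: an antisymmetric matrix carries each coefficient with i < j twice, so its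
    Frobenius norm, which bounds the operator norm, is sqrt 2 times the coefficient norm. *)
Lemma coef_norm_bound (S : 'M[R]_(n + n)) (c : R) u v : S^T = - S ->
  coef_norm (fun a b => dot a (S *m b)) <= c ->
  `|dot u (S *m v)| <= Num.sqrt 2 * c * (nrm u * nrm v).
Proof.
move=> ST cS; apply: le_trans (dot_le _ _) _.
rewrite mulrCA ler_wpM2l ?nrm_ge0//; apply: le_trans (nrm_mulmx _ _) _.
rewrite ler_wpM2r ?nrm_ge0// /frob frob_antisym// sqrtrM// ler_wpM2l ?sqrtr_ge0//.
apply: le_trans cS; rewrite /coef_norm.
rewrite le_eqVlt; apply/orP; left; apply/eqP; congr Num.sqrt.
apply: eq_bigr => i _; apply: eq_bigr => j _; congr (_ ^+ 2).
by rewrite /dot /basis_vec trmx_delta -colE -rowE !mxE.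
Qed.

(** [stdJ] is invertible, so preserving it makes the differential injective; the inverse function
    theorem then yields continuity on the image for whatever left inverse is supplied. *)
Lemma pull_symplectic (W : set V) (F G : V -> V) : open W -> (forall k, Ck_on k W F) ->
  (forall x, W x -> pull stdJ F x = stdJ) -> {in W, cancel F G} ->
  symplectic_embedding W F.
Proof.
move=> oW cF FJ FG.
have dF x : W x -> differentiable F x by move=> Wx; exact: Ck_differentiable (cF 1) Wx.
have ker x : W x -> forall v, 'd F x v = 0 -> v = 0.
  move=> Wx v; rewrite (jacE _ (dF x Wx)) => Fv.
  have : stdJ^T *m (pull stdJ F x *m v) = 0 by rewrite /pull -!mulmxA Fv !mulmx0.
  by rewrite FJ// mulmxA stdJ_orth mul1mx.
have injF x y : W x -> W y -> F x = F y -> x = y.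
  by move=> Wx Wy E; rewrite -(FG x) ?inE// E FG// inE.
split; last first.
  move=> x Wx u v; rewrite pullback_omega0E; last exact: dF.
  by rewrite FJ// omega0E.
split; [by []| |exists G; split=> //].
- move=> x Wx u v E; apply/eqP; rewrite -subr_eq0; apply/eqP.
  by apply: (ker x Wx); rewrite linearB/= E subrr.
- apply: continuous_in_subspaceT => y yW.
  exact: (inverse_Ck oW (cF 1) ker injF FG 0 cF).
Qed.

Let opnorm_ub (M : 'M[R]_(n + n)) : has_ubound [set enorm (M *m w) | w in cball n 1].
Proof.
exists (frob M) => _ [w /= w1 <-]; rewrite enormE; apply: le_trans (nrm_mulmx _ _) _.
by rewrite ler_piMr ?sqrtr_ge0// -enormE.
Qed.

Lemma opnorm_bound (M : 'M[R]_(n + n)) v : nrm (M *m v) <= opnorm M * nrm v.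
Proof.
have [v0|v0] := eqVneq (nrm v) 0; first by rewrite (nrm_eq0 v0) mulmx0 nrm0 mulr0.
have vp : 0 < nrm v by rewrite lt0r v0 nrm_ge0.
rewrite -ler_pdivrMr// mulrC; apply: ub_le_sup => //.
exists ((nrm v)^-1 *: v).
  by rewrite /cball/= enormE nrmZ ger0_norm ?invr_ge0 ?nrm_ge0// mulVf.
by rewrite enormE -scalemxAr nrmZ ger0_norm ?invr_ge0 ?nrm_ge0.
Qed.

Lemma opnorm_ge0 (M : 'M[R]_(n + n)) : 0 <= opnorm M.
Proof.
apply: (@le_trans _ _ (enorm (M *m 0))); first by rewrite enormE nrm_ge0.
by apply: ub_le_sup => //; exists 0 => //; rewrite /cball/= enormE nrm0.
Qed.

Section Ellipsoid.
Variable A : 'M[R]_(n + n).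
Hypothesis A_unit : A \in unitmx.

Lemma ellipsoidE v : ellipsoid A v <-> gauge A v <= 1.
Proof.
split=> [[w /= w1 <-]|v1]; first by rewrite /gauge mulKmx// -enormE.
by exists (invmx A *m v); [rewrite /cball/= enormE|rewrite mulKVmx].
Qed.

Lemma scaled_ellipsoidE (s : R) v : 0 < s ->
  [set s *: w | w in ellipsoid A] v <-> gauge A v <= s.
Proof.
move=> s0; split=> [[w /ellipsoidE w1 <-]|vs].
  by rewrite gaugeZ (gtr0_norm s0) ler_piMr// ltW.
exists (s^-1 *: v); last by rewrite scalerA divff ?gt_eqF// scale1r.
by apply/ellipsoidE; rewrite gaugeZ gtr0_norm ?invr_gt0// mulrC ler_pdivrMr// mul1r.
Qed.

Let radii_lb : lbound [set r | ellipsoid A `<=` cball n r] 0.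
Proof.
move=> r /= Er; apply: le_trans (nrm_ge0 (0 : V)) _; rewrite -enormE; apply: Er.
by apply/ellipsoidE; rewrite /gauge mulmx0 nrm0.
Qed.

Let radii_nonempty : [set r | ellipsoid A `<=` cball n r] !=set0.
Proof.
exists (frob A) => v /ellipsoidE v1; rewrite /cball/= enormE.
by apply: le_trans (nrm_le_gauge A_unit v) _; rewrite ler_piMr// sqrtr_ge0.
Qed.

Lemma outer_radius_ge0 : 0 <= outer_radius A.
Proof. by apply: lb_le_inf => //; exact: radii_lb. Qed.

Lemma outer_radius_bound v : nrm v <= outer_radius A * gauge A v.
Proof.
have [v0|v0] := eqVneq (gauge A v) 0.
  by rewrite v0 mulr0 -(mulr0 (frob A)) -v0; exact: nrm_le_gauge.
have vp : 0 < gauge A v by rewrite lt0r v0 gauge_ge0.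
rewrite -ler_pdivrMr//; apply: lb_le_inf => // r /= Er.
have := Er ((gauge A v)^-1 *: v); rewrite /cball/= enormE nrmZ gtr0_norm ?invr_gt0// mulrC; apply.
by apply/ellipsoidE; rewrite gaugeZ gtr0_norm ?invr_gt0// mulVf.
Qed.

End Ellipsoid.

Section Capacity.
Variable c : set V -> \bar R.
Hypothesis cap : capacity c.

Lemma capacity_mono (U X W : set V) (F G : V -> V) : open W -> U `<=` W ->
  (forall k, Ck_on k W F) -> (forall x, W x -> pull stdJ F x = stdJ) ->
  {in W, cancel F G} -> F @` U `<=` X -> (c U <= c X)%E.
Proof.
move=> oW UW cF FJ FG; have [_ mono _ _ _] := cap.
exact: (mono U X W F oW UW (pull_symplectic oW cF FJ FG)).
Qed.

Lemma capacity_shift_le (b : V) (U : set V) : (c U <= c (translate b U))%E.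
Proof.
apply: (@capacity_mono _ _ setT (fun y => b + y) (fun y => - b + y)) => //.
- by move=> k; exact: Ck_shift.
- move=> x _; rewrite /pull.
  have -> : jac (fun y : V => b + y) x = 1%:M.
    rewrite (@jac_translate _ _ b id)//.
    by apply: (@jac_near_id _ _ _ setT) => //.
  by rewrite trmx1 mul1mx mulmx1.
- by move=> x _; rewrite addKr.
Qed.

Lemma capacity_translate (b : V) (U : set V) : c (translate b U) = c U.
Proof.
apply/eqP; rewrite eq_le capacity_shift_le andbT.
rewrite [leRHS](_ : _ = c (translate (- b) (translate b U))); first exact: capacity_shift_le.
congr c; apply/seteqP; split=> [x Ux|_ [_ [x Ux <-] <-]]; last by rewrite addKr.
by exists (b + x); [exists x|rewrite addKr].
Qed.

End Capacity.

End Standard.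

(** * Transport of capacities *)

Lemma congruence_inj (F : comUnitRingType) m (T X Y : 'M[F]_m) : T \in unitmx ->
  T^T *m X *m T = T^T *m Y *m T -> X = Y.
Proof.
move=> uT /(congr1 (mulmx^~ (invmx T))); rewrite !mulmxK// => /(congr1 (mulmx (invmx T^T))).
by rewrite !mulKmx// unitmx_tr.
Qed.

Section Transport.
Variables (R : realType) (n : nat).
Local Notation V := (R2n R n).
Variables (A : 'M[R]_(n + n)) (e : R) (O : set V) (f g : V -> V).
Variable c : set V -> \bar R.
Hypotheses (e0 : 0 <= e) (e1 : e < 1) (A_unit : A \in unitmx) (oO : open O).
Hypotheses (cf : forall k, Ck_on k O f) (fK : {in O, cancel f g}).
Hypothesis df_inj : forall x, O x -> injective ('d f x).
Hypothesis fJ : forall y u v, O y ->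
  `|dot u ((pull (stdJ R n) f y - stdJ R n) *m v)| <= e * (nrm u * nrm v).
Hypothesis subO : ellipsoid A `<=` O.
Hypothesis cap : capacity c.
Local Notation J := (stdJ R n).
Local Notation d := (distortion e A).

Let df x : O x -> differentiable f x.
Proof. by move=> Ox; exact: Ck_differentiable (cf 1) Ox. Qed.

Let df_ker x : O x -> forall v, 'd f x v = 0 -> v = 0.
Proof. by move=> Ox v fv; apply: (df_inj Ox); rewrite fv linear0. Qed.

Let f_inj x y : O x -> O y -> f x = f y -> x = y.
Proof. by move=> Ox Oy E; rewrite -(fK (mem_set Ox)) E fK// inE. Qed.

(** Conformality rewrites both factors as dilations, and each inequality becomes one symplectic
    embedding: of the ellipsoid dilated by (1 + d)^(-1) into its image under [f], and of that image
    into the ellipsoid dilated by (1 - d)^(-1). *)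
Lemma transport : 
  ((inner_factor e A ^+ 2)%:E * c (ellipsoid A) <= c (f @` ellipsoid A))%E /\
  (d < 1 -> (c (f @` ellipsoid A) <= (outer_factor e A ^+ 2)%:E * c (ellipsoid A))%E).
Proof.
have dE : d = opnorm (invmx A) * (rate e 1 - 1) * outer_radius A.
  by rewrite /distortion /rate mul1r.
have kap0 := opnorm_ge0 (invmx A); have r0 := outer_radius_ge0 A_unit.
have d0 : 0 <= d by rewrite dE; exact: squeeze_ge0.
have [b' b'1 Hb'] : exists2 b : R, 1 < b & forall y, gauge A y ^+ 2 <= b -> O y.
  by apply: gauge_room => // y y1; apply: subO; apply/ellipsoidE.
have [b [b1 bb' Hb]] := outer_margin d0 b'1.
have subb y : gauge A y ^+ 2 <= b -> O y by move=> yb; apply: Hb'; exact: le_trans bb'.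
(* The levels divide the interval from 1 to [b] into thirds; 1 < a0 leaves an open neighbourhood of
   the ellipsoid inside the core. *)
pose a0 := 1 + (b - 1) / 3; pose a1 := 1 + (b - 1) / 3 * 2.
have [a01 [a01' a1b]] : 1 < a0 /\ a0 < a1 /\ a1 < b by rewrite /a0 /a1; move: b1; lra.
have a00 : 0 < a0 := lt_trans ltr01 a01.
have [psi [psi' [N [[cpsi cpsi'] [psiK psi'K] [cN Nexp] H1 H2]]]] :=
  squeeze (stdJ_antisym R n) (stdJ_orth R n) e0 e1 A_unit oO a00 a01' a1b subb cf fJ
    kap0 r0 (opnorm_bound (invmx A)) (outer_radius_bound A_unit).
rewrite -dE in H1 H2.
have dpsi y : differentiable psi y by exact: Ck_differentiable (cpsi 1) I.
have dpsi' y : differentiable psi' y by exact: Ck_differentiable (cpsi' 1) I.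
have dN y : differentiable N y by exact: Ck_differentiable (cN 1) I.
have lev y : gauge A y ^+ 2 < a0 -> O y.
  by move=> ya; apply: subb; apply: ltW; apply: lt_trans ya (lt_trans a01' a1b).
have sq1 : 1 < Num.sqrt a0 by rewrite -sqrtr1 ltr_sqrt.
have [_ _ conf _ _] := cap.
split.
- have s0 : 0 < 1 + d by rewrite ltr_pwDl.
  rewrite -conf ?invr_eq0 ?gt_eqF//.
  (* Monotonicity asks for an embedding of an open neighbourhood. Since 1 < a0, this set contains
     the dilated ellipsoid, and each of its points meets the hypothesis of the forward clause of
     [squeeze]. *)
  pose W : set V := [set y : V | gauge A ((1 + d) *: y) ^+ 2 < a0].
  have oW : open W.
    apply: (@open_comp _ _ (fun y : V => (1 + d) *: y) [set z : V | gauge A z ^+ 2 < a0]); last exact: open_gauge_lt.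
    move=> y _; apply: (setT_continuous _).2.
    by apply: CkZ => //; [exact: Ck_cst|exact: Ck_id].
  have WE y : W y -> (1 + d) * gauge A y < Num.sqrt a0.
    by rewrite /W /= -gauge_lt_sqrt// gaugeZ gtr0_norm.
  have WO y : W y -> gauge A (psi y) ^+ 2 < a0.
    move=> /WE Wy; rewrite -gauge_lt_sqrt//.
    by have [H _] := H1 y Wy; exact: le_lt_trans Wy.
  apply: (@capacity_mono _ _ c cap _ _ W (fun y => f (psi y)) (fun z => psi' (g z))).
  + exact: oW.
  + move=> y Hy; rewrite /W /= -gauge_lt_sqrt// gaugeZ gtr0_norm//; apply: le_lt_trans sq1.
    by rewrite mulrC -ler_pdivlMr// mul1r; apply/(scaled_ellipsoidE A_unit); rewrite ?invr_gt0.
  + move=> k; apply: (@Ck_comp _ _ _ _ _ _ _ O psi f) => //.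
    * by move=> _ [y Wy <-]; apply: lev; exact: WO.
    * exact: Ck_sub (cpsi k).
  + move=> y Wy; rewrite pull_comp//; last by apply: df; apply: lev; exact: WO.
    by have [] := H1 y (WE y Wy).
  + by move=> y; rewrite inE => Wy; rewrite fK ?psiK// inE; apply: lev; exact: WO.
  + move=> _ [y Hy <-]; exists (psi y) => //; apply/ellipsoidE => //.
    have {}Hy : gauge A y <= (1 + d)^-1 by apply/(scaled_ellipsoidE A_unit); rewrite ?invr_gt0.
    have Hy1 : (1 + d) * gauge A y <= 1 by rewrite mulrC -ler_pdivlMr// mul1r.
    have [H _] := H1 y (le_lt_trans Hy1 sq1).
    exact: le_trans H Hy1.
- move=> d1; have s0 : 0 < 1 - d by rewrite subr_gt0.
  rewrite -conf ?invr_eq0 ?gt_eqF//.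
  pose W := [set y | gauge A y ^+ 2 < a0].
  have oW : open W by exact: open_gauge_lt.
  have cfW k : Ck_on k W f by apply: Ck_sub (cf k) => y; exact: lev.
  have oI : open (f @` W) by exact: (image_open oO (cf 1) df_ker f_inj oW lev).
  have N_inj y z : N y = N z -> y = z.
    move=> E; apply/eqP; rewrite -subr_eq0; apply/eqP/nrm_eq0/eqP.
    by rewrite eq_le nrm_ge0 andbT; apply: le_trans (Nexp y z) _; rewrite E subrr nrm0.
  (* A set-theoretic left inverse suffices to witness injectivity; off the range of N its value is
     arbitrary. *)
  have /choice[Ninv HNinv] : forall z, exists y, (exists y', N y' = z) -> N y = z.
    move=> z; have [[y' <-]|nz] := pselect (exists y', N y' = z); first by exists y'.
    by exists 0 => H; case: nz.
  have NK : cancel N Ninv by move=> y; apply: N_inj; apply: HNinv; exists y.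
  have cg k : Ck_on k (f @` W) g.
    apply: (inverse_Ck oW (cfW 1)) => // [x Wx|x y Wx Wy|x].
    - exact: df_ker (lev x Wx).
    - exact: f_inj (lev x Wx) (lev y Wy).
    - by rewrite inE => Wx; rewrite fK// inE; exact: lev.
  have cF k : Ck_on k (f @` W) (fun z => N (psi' (g z))).
    apply: (@Ck_compT _ _ _ _ _ _ _ (fun z => psi' (g z)) N) => //.
    by apply: (@Ck_compT _ _ _ _ _ _ _ g psi').
  apply: (@capacity_mono _ _ c cap _ _ (f @` W) (fun z => N (psi' (g z))) (fun z => f (psi (Ninv z)))) => //.
  + move=> _ [y /(ellipsoidE A_unit)y1 <-]; exists y => //.
    by rewrite /W /= -gauge_lt_sqrt//; exact: le_lt_trans y1 sq1.
  + move=> _ [y Wy <-]; have Oy := lev y Wy.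
    set y0 := psi' y.
    have psiy0 : psi y0 = y by rewrite /y0 psi'K.
    set F := fun z => N (psi' (g z)).
    have dF : differentiable F (f y) by apply: Ck_differentiable (cF 1) _; exists y.
    pose h x := f (psi x).
    have dfpsi : differentiable f (psi y0) by rewrite psiy0; exact: df.
    have dh : differentiable h y0 := differentiable_compE (dpsi y0) dfpsi.
    have dFh : differentiable F (h y0) by rewrite /h psiy0.
    (* Near [y0] the map N factors as F after [h] = f o psi. Both N and [h] pull the standard form
       back to the same form at [y0]; cancelling the invertible Jacobian of [h] on both sides shows
       that F preserves the standard form. *)
    have jE : jac N y0 = jac F (h y0) *m jac h y0.
      have oP : open [set x | W (psi x)].
        apply: (@open_comp _ _ psi W) => // x _; exact: (setT_continuous _).2 (cpsi 0) x.
      have near_y0 : \forall x \near y0, N x = F (h x).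
        apply: (@open_near_eq _ _ _ _ _ _ y0 oP); first by rewrite /= psiy0.
        by move=> x; rewrite inE /= => Wx; rewrite /F fK ?psiK// inE; exact: lev.
      rewrite -(jac_comp dh dFh).
      by apply/matrixP => i j; rewrite !mxE (near_eq_derive _ near_y0).
    have T_unit : jac h y0 \in unitmx.
      have := expanding_unit (fun x v => expanding_jac v (dN x) (fun z => Nexp z x)) y0.
      by rewrite jE unitmx_mul => /andP[].
    have hE : (jac h y0)^T *m J *m jac h y0 = pull J N y0.
      have [_ <-] := H2 y Wy.
      by rewrite -/(pull J h y0) (pull_comp J (dpsi y0) dfpsi) psiy0.
    by apply: (congruence_inj T_unit); rewrite hE /pull jE /h psiy0 trmx_mul !mulmxA.
  + move=> z; rewrite inE => -[y Wy <-].
    by rewrite NK psi'K fK// inE; exact: lev.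
  + move=> _ [_ [y /(ellipsoidE A_unit)y1 <-] <-].
    have Wy : W y by rewrite /W /= -gauge_lt_sqrt//; exact: le_lt_trans y1 sq1.
    apply/scaled_ellipsoidE; rewrite ?invr_gt0//.
    rewrite fK; last by rewrite inE; exact: lev.
    have [H _] := H2 y Wy; apply: le_trans H _.
    apply: (@le_trans _ _ (1 + Num.sqrt b * d)); first by rewrite lerD2r.
    by rewrite -[leRHS]mul1r ler_pdivlMr// Hb.
Qed.

End Transport.

Theorem proposition7p2 (R : realType) (n : nat) (hn : (0 < n)%N)
    (eps : R) (eps_ge0 : 0 <= eps) (eps_lt : eps < 1 / Num.sqrt 2)
    (U : set (R2n R n)) (openU : open U) (phi : R2n R n -> R2n R n)
    (hphi : epsilon_symplectic_embedding eps U phi)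
    (c : set (R2n R n) -> \bar R) (hc : capacity c) :
  preserves_ellipsoid_capacity c (Num.sqrt 2 * eps) U phi.
Proof.
have [[cphi phi_inj [g [gK _]]] hS] := hphi.
have e0 : 0 <= Num.sqrt 2 * eps by rewrite mulr_ge0 ?sqrtr_ge0.
have e1 : Num.sqrt 2 * eps < 1.
  by move: eps_lt; rewrite ltr_pdivlMr ?sqrtr_gt0// mulrC.
move=> A b A_unit /= EU.
(* The centre is moved to 0: precomposing with a shift leaves Jacobians unchanged up to the base
   point, and capacities are translation invariant because shifts are symplectic. *)
pose O : set (R2n R n) := [set y | U (b + y)].
have dphi x : U x -> differentiable phi x by move=> Ux; exact: Ck_differentiable (cphi 1) Ux.
have oO : open O by exact: open_translate.
have cf k : Ck_on k O (fun y => phi (b + y)) by exact: Ck_translate.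
have fK : {in O, cancel (fun y => phi (b + y)) (fun z => - b + g z)}.
  by move=> y; rewrite inE => Uy; rewrite gK ?addKr// inE.
have df_inj x : O x -> injective ('d (fun y => phi (b + y)) x).
  move=> Ox u v; rewrite !(jacE _ (Ck_differentiable (cf 1) Ox)).
  by rewrite (jac_translate (dphi _ Ox)) -!(jacE _ (dphi _ Ox)); exact: phi_inj.
have fJ y u v : O y -> `|dot u ((pull (stdJ R n) (fun z => phi (b + z)) y - stdJ R n) *m v)| <=
    Num.sqrt 2 * eps * (nrm u * nrm v).
  move=> Oy; have -> : pull (stdJ R n) (fun z => phi (b + z)) y = pull (stdJ R n) phi (b + y).
    by rewrite /pull (jac_translate (dphi _ Oy)).
  apply: coef_norm_bound.
    by rewrite linearB/= pull_antisym ?stdJ_antisym// -opprD.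
  rewrite -lee_fin; apply: le_trans hS; apply: ereal_sup_ubound; exists (b + y) => //.
  congr (coef_norm _)%:E; apply/funext => w; apply/funext => z.
  by rewrite (pullback_omega0E _ _ (dphi _ Oy)) omega0E mulmxBl dotBr.
have subO : ellipsoid A `<=` O by move=> y Ey; apply: EU; exists y.
have := transport e0 e1 A_unit oO cf fK df_inj fJ subO hc.
rewrite (capacity_translate hc) (_ : [set phi (b + y) | y in ellipsoid A] = phi @` translate b (ellipsoid A))//.
apply/seteqP; split=> [_ [y Ey <-]|_ [_ [y Ey <-] <-]]; last by exists y.
by exists (b + y) => //; exists y.
Qed.
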